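(* Consider the censoring setting with i.i.d. observations $(X_i,O_i,Y_i)$, $i=1,\dots,n$, and $\tau_0=\mathbb{E}[Y(1)-Y(0)]$. Assume: (Unconfoundedness) $(Y(1),Y(0))$ is independent of $(O,D)$ conditionally on $X$. (Common support) There is a constant $c>0$, independent of $n$, such that $\pi_0(d\mid x)>c$, $g_0(d\mid x)>c$, $\zeta_{\mathrm{T},0}(x)>c$, $\zeta_0(x)>c$ for all $x\in\mathcal{X}$ and $d\in\{0,1\}$. (Known propensity score) $g_0$ is known and used in the estimator. (Convergence rates) The nuisance estimators $\widehat{\mu}^{(\ell)}_{\mathrm{T},n},\widehat{\nu}^{(\ell)}_n,\widehat{\pi}^{(\ell)}_n$ are constructed via cross-fitting, and for each fold $\ell\in\{1,\dots,L\}$, as $n\to\infty$: - $\|\pi_0(d\mid X)-\widehat{\pi}^{(\ell)}_n(d\mid X)\|_2=o_p(1)$ for $d\in\{1,0\}$, $\|\mu_{\mathrm{T},0}(X)-\widehat{\mu}^{(\ell)}_{\mathrm{T},n}(X)\|_2=o_p(1)$, and $\|\nu_0(X)-\widehat{\nu}^{(\ell)}_n(X)\|_2=o_p(1)$; - $\|\pi_0(d\mid X)-\widehat{\pi}^{(\ell)}_n(d\mid X)\|_2\,\|\mu_{\mathrm{T},0}(X)-\widehat{\mu}^{(\ell)}_{\mathrm{T},n}(X)\|_2=o_p(n^{-1/2})$ for $d\in\{1,0\}$; - $\|\pi_0(0\mid X)-\widehat{\pi}^{(\ell)}_n(0\mid X)\|_2\,\|\nu_0(X)-\widehat{\nu}^{(\ell)}_n(X)\|_2=o_p(n^{-1/2})$.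 Let $$\widehat{\tau}^{\mathrm{cens\text{-}eff}}_n=\frac1n\sum_{\ell=1}^L\sum_{i\in\mathcal{I}^{(\ell)}}S^{\mathrm{cens}}\bigl(X_i,O_i,Y_i;\widehat{\mu}^{(\ell)}_{\mathrm{T},n},\widehat{\nu}^{(\ell)}_n,\widehat{\pi}^{(\ell)}_n,g_0\bigr).$$ Then, as $n\to\infty$, $$\sqrt{n}\bigl(\widehat{\tau}^{\mathrm{cens\text{-}eff}}_n-\tau_0\bigr)\xrightarrow{d}\mathcal{N}(0,V^{\mathrm{cens}}).$$
   Context: Censoring setting. $Y(1),Y(0)\in\mathbb{R}$ are potential outcomes, $X\in\mathcal{X}\subset\mathbb{R}^p$ covariates with density $\zeta_0$, $D\in\{0,1\}$ an unobserved treatment indicator, $O\in\{0,1\}$ an observation indicator; $O=1$ implies $D=1$. Set $\widetilde{Y}=\mathbf{1}[D=1]Y(1)+\mathbf{1}[D=0]Y(0)$ and $Y=\mathbf{1}[O=1]Y(1)+\mathbf{1}[O=0]\widetilde{Y}$. One observes $n$ i.i.d. copies of $(X,O,Y)$. All densities are assumed to exist. $\mathbb{E},\mathbb{P}$ are under the true distribution $P_0$. Notation: $\pi_0(o\mid X)=\mathbb{P}(O=o\mid X)$; $g_0(d\mid X)=\mathbb{P}(D=d\mid X,O=0)$; $\mu_{\mathrm{T},0}(X)=\mathbb{E}[Y(1)\mid X]$; $\nu_0(X)=\mathbb{E}[\widetilde{Y}\mid X,O=0]$; $\zeta_{\mathrm{T},0}$ is the density of the covariates in the treatment group (units receiving treatment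 $1$). $\|\cdot\|_2$ is the $L_2$ norm with respect to the distribution of $X$, the estimated function being held fixed. For functions $\mu_{\mathrm{T}},\nu,\pi,g$ define $$\begin{aligned}S^{\mathrm{cens}}(X,O,Y;\mu_{\mathrm{T}},\nu,\pi,g)=&\ \frac{\mathbf{1}[O=1](Y-\mu_{\mathrm{T}}(X))}{\pi(1\mid X)}-\frac{\mathbf{1}[O=0](Y-\nu(X))}{g(0\mid X)\pi(0\mid X)}+\frac{g(1\mid X)\mathbf{1}[O=1](Y-\mu_{\mathrm{T}}(X))}{g(0\mid X)\pi(1\mid X)}\\&+\mu_{\mathrm{T}}(X)-\frac{1}{g(0\mid X)}\nu(X)+\frac{g(1\mid X)}{g(0\mid X)}\mu_{\mathrm{T}}(X),\end{aligned}$$ and $V^{\mathrm{cens}}=\mathbb{E}\bigl[(S^{\mathrm{cens}}(X,O,Y;\mu_{\mathrm{T},0},\nu_0,\pi_0,g_0)-\tau_0)^2\bigr]$. Cross-fitting: the index set $\{1,\dots,n\}$ is randomly partitioned into a fixed number $L$ of roughly equal-sized folds $\mathcal{I}^{(1)},\dots,\mathcal{I}^{(L)}$; for each $\ell$, $\widehat{\mu}^{(\ell)}_{\mathrm{T},n},\widehat{\nu}^{(\ell)}_n,\widehat{\pi}^{(\ell)}_n$ are estimators of $\mu_{\mathrm{T},0},\nu_0,\pi_0$ constructed only from the observations with indices in $\{1,\dots,n\}\setminus\mathcal{I}^{(\ell)}$.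
   Formalization: Added assumption: for some constant c>0, for each fold and d, the estimated propensity π̂(d|X) is at least c almost surely in X with probability tending to 1 (the claim fails without it); Y(1), Y(0) integrable and V^cens finite are stated explicitly. *)

(* Defs.v *)
From HB Require Import structures.
From mathcomp Require Import all_boot all_order all_algebra finmap.
From mathcomp Require Import all_classical all_reals all_analysis.

Set Implicit Arguments.
Unset Strict Implicit.
Unset Printing Implicit Defensive.

Import Order.TTheory GRing.Theory Num.Theory.
Import numFieldNormedType.Exports.

Local Open Scope classical_set_scope.
Local Open Scope ring_scope.

Lemma sigma_finite_product d1 d2 (T1 : measurableType d1)
    (T2 : measurableType d2) (R : realType)
    (m1 : {sigma_finite_measure set T1 -> \bar R})
    (m2 : {sigma_finite_measure set T2 -> \bar R}) :
  sigma_finite [set: T1 * T2] (m1 \x m2)%E.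
Proof.
have /sigma_finiteP[F [TF ndF Foo]] := sigma_finiteT m1.
have /sigma_finiteP[G [TG ndG Goo]] := sigma_finiteT m2.
exists (fun n => F n `*` G n).
  rewrite -setXTT TF TG predeqE => -[x y]; split.
    move=> [/= [n _ Fnx] [k _ Gky]]; exists (maxn n k) => //; split.
    - by move: x Fnx; exact/subsetPset/ndF/leq_maxl.
    - by move: y Gky; exact/subsetPset/ndG/leq_maxr.
  by move=> [n _ []/= ? ?]; split; exists n.
move=> k; have [? ?] := Foo k; have [? ?] := Goo k.
split; first exact: measurableX.
by rewrite product_measure1E// lte_mul_pinfty// ge0_fin_numE.
Qed.

(* R^p is modelled by p.-tuple R with the product (Borel) sigma-algebra;
   lebesgue_tuple p is the p-fold product of the Lebesgue measure on R. *)
Section lebesgue_measure_on_tuples.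
Context {R : realType}.
Local Open Scope ereal_scope.

Definition tcons (n : nat) (xt : measurableTypeR R * n.-tuple R) :
  n.+1.-tuple R := [tuple of xt.1 :: xt.2].

Lemma measurable_tcons n : measurable_fun [set: _] (@tcons n).
Proof.
apply: measurable_cons; last exact: measurable_snd.
exact: (@measurable_fst _ _ (measurableTypeR R) (n.-tuple R)).
Qed.

Section step.
Variables (n : nat).
Variable mu : {sigma_finite_measure set (n.-tuple R) -> \bar R}.

Definition lebesgue_cons : set (n.+1.-tuple R) -> \bar R :=
  pushforward (lebesgue_measure \x mu) (@tcons n).

Let lebesgue_cons0 : lebesgue_cons set0 = 0.
Proof. by rewrite /lebesgue_cons /pushforward preimage_set0 measure0. Qed.

Let lebesgue_cons_ge0 A : 0 <= lebesgue_cons A.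
Proof. by rewrite /lebesgue_cons /pushforward measure_ge0. Qed.

Let lebesgue_cons_sigma_additive : semi_sigma_additive lebesgue_cons.
Proof.
move=> F mF tF mUF; rewrite /lebesgue_cons /pushforward preimage_bigcup.
have mp A : measurable A -> measurable (@tcons n @^-1` A).
  by move=> mA; rewrite -[X in measurable X]setTI; exact: measurable_tcons.
apply: measure_semi_sigma_additive.
- by move=> k; exact: mp.
- apply/trivIsetP => /= i j _ _ ij; rewrite -preimage_setI.
  by move/trivIsetP : tF => /(_ _ _ _ _ ij) ->//; rewrite preimage_set0.
- by rewrite -preimage_bigcup; exact: mp.
Qed.

HB.instance Definition _ := isMeasure.Build _ _ _ lebesgue_cons
  lebesgue_cons0 lebesgue_cons_ge0 lebesgue_cons_sigma_additive.

Let lebesgue_cons_sigma_finite : sigma_finite [set: _] lebesgue_cons.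
Proof.
have [F UF Foo] := sigma_finite_product
  (lebesgue_measure : {sigma_finite_measure set (measurableTypeR R) -> \bar R}) mu.
pose uncons (t : n.+1.-tuple R) : measurableTypeR R * n.-tuple R :=
  (thead t, [tuple of behead t]).
have munc : measurable_fun [set: _] uncons.
  apply/measurable_fun_pair; last exact: measurable_behead.
  exact: (@measurable_tnth _ R n.+1 ord0).
exists (fun k => uncons @^-1` (F k)).
  by rewrite -preimage_bigcup -UF preimage_setT.
move=> k; have [mF Fk] := Foo k; split.
  by rewrite -[X in measurable X]setTI; exact: munc.
rewrite /lebesgue_cons /pushforward -comp_preimage.
rewrite (_ : uncons \o _ = id)//.
by apply/funext => -[x t]/=; congr pair; apply/val_inj.
Qed.

HB.instance Definition _ := Measure_isSigmaFinite.Build _ _ _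
  lebesgue_cons lebesgue_cons_sigma_finite.

End step.

Fixpoint lebesgue_tuple (n : nat) :
    {sigma_finite_measure set (n.-tuple R) -> \bar R} :=
  match n with
  | 0 => \d_([tuple] : 0.-tuple R)
  | m.+1 => lebesgue_cons (lebesgue_tuple m)
  end.

End lebesgue_measure_on_tuples.

Section probability_notions.
Context d (T : measurableType d) (R : realType) (P : probability T R).
Local Open Scope ereal_scope.

Section conditioning.
Context d' (S : measurableType d') (X : T -> S).

(* x |-> m x is a version of x |-> E[Z | X = x, E], where E is an event. *)
Definition is_cond_expectation (E : set T) (Z : T -> R) (m : S -> R) :=
  [/\ measurable_fun [set: S] m,
      P.-integrable E (EFin \o (m \o X)) &
      forall A, measurable A ->
        \int[P]_(w in E `&` X @^-1` A) (m (X w))%:E =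
        \int[P]_(w in E `&` X @^-1` A) (Z w)%:E].

Definition is_cond_probability (E B : set T) (q : S -> R) :=
  is_cond_expectation E \1_B q.

Definition cond_independent d1 d2 (S1 : measurableType d1)
    (S2 : measurableType d2) (U : T -> S1) (V : T -> S2) :=
  forall (B : set S1) (C : set S2) (q r : S -> R),
    measurable B -> measurable C ->
    is_cond_probability [set: T] (U @^-1` B) q ->
    is_cond_probability [set: T] (V @^-1` C) r ->
    is_cond_probability [set: T] (U @^-1` B `&` V @^-1` C) (q \* r)%R.

End conditioning.

(* z is a Lebesgue density of the conditional law of X given the event E:
   P(X in A, E) = P(E) * \int_A z. *)
Definition has_density_given (p : nat) (X : T -> p.-tuple R) (E : set T)
    (z : p.-tuple R -> R) :=
  [/\ measurable_fun [set: p.-tuple R] z,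
      forall x, (0 <= z x)%R &
      forall A, measurable A ->
        P (E `&` X @^-1` A) = P E * \int[lebesgue_tuple p]_(x in A) (z x)%:E].

Definition has_density (p : nat) (X : T -> p.-tuple R) (z : p.-tuple R -> R) :=
  has_density_given X [set: T] z.

Definition mutually_independent d' (S : measurableType d') (Z : nat -> T -> S) :=
  forall (J : {fset nat}) (B : nat -> set S),
    (forall j, measurable (B j)) ->
    P (\bigcap_(j in [set` J]) Z j @^-1` B j) = \prod_(j <- J) P (Z j @^-1` B j).

(* Z_n = o_p(a_n) for a deterministic sequence a of positive reals. *)
Definition little_op (Z : nat -> T -> \bar R) (a : nat -> R) :=
  forall e : R, (0 < e)%R ->
    P [set w | (e * a n)%:E < `|Z n w|] @[n --> \oo] --> 0.

Definition cvg_in_distribution (Z : nat -> T -> R) (nu : set R -> \bar R) :=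
  (forall n, measurable_fun [set: T] (Z n)) /\
  forall x : R, {for x, continuous (fun y : R => nu `]-oo, y]%classic)} ->
    P (Z n @^-1` `]-oo, x]%classic) @[n --> \oo] --> nu `]-oo, x]%classic.

End probability_notions.

(* normal_prob m s is the normal law only when s != 0; a zero variance gives the
   point mass. *)
Definition normal_law (R : realType) (m v : R) : set R -> \bar R :=
  if v == 0 then \d_m else normal_prob m (Num.sqrt v).

(* L2 distance with respect to the distribution of X. *)
Definition l2_dist d d' (T : measurableType d) (S : measurableType d')
    (R : realType) (P : probability T R) (X : {RV P >-> S}) (f g : S -> R) :
  \bar R := 'N[distribution P X]_2%:E[EFin \o (f \- g)].

Section cross_fitting.
Context (R : realType) (L : nat).
Context ds (S : measurableType ds) dx (E : measurableType dx).

(* An estimator maps a fold assignment f, a fold l and a sample of size n to a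
   function on the covariate space. *)
Definition estimator :=
  forall n, {ffun 'I_n -> 'I_L} -> 'I_L -> n.-tuple S -> E -> R.

Definition cross_fitted (e : estimator) :=
  forall n (f : {ffun 'I_n -> 'I_L}) (l : 'I_L),
    measurable_fun [set: n.-tuple S * E] (fun zx => e n f l zx.1 zx.2) /\
    forall z z' : n.-tuple S,
      (forall i, f i != l -> tnth z i = tnth z' i) -> e n f l z = e n f l z'.

Context d (T : measurableType d) (P : probability T R).

Definition sample (W : nat -> T -> S) (n : nat) (w : T) : n.-tuple S :=
  [tuple W i w | i < n].

(* The folds {i | F n w i = l} form a random partition of the indices, drawn
   independently of the data, into L folds of size n / L + o_p(n). *)
Definition random_folds (W : nat -> T -> S)
    (F : forall n, T -> {ffun 'I_n -> 'I_L}) :=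
  [/\ forall n (f : {ffun 'I_n -> 'I_L}), measurable [set w | F n w = f],
      forall n (f : {ffun 'I_n -> 'I_L}) (B : set (n.-tuple S)), measurable B ->
        P ([set w | F n w = f] `&` sample W n @^-1` B) =
        (P [set w | F n w = f] * P (sample W n @^-1` B))%E &
      forall l : 'I_L, little_op P
        (fun n w => (#|[pred i | F n w i == l]|%:R / n%:R - L%:R^-1)%:E)
        (fun=> 1)].

Definition fitted (e : estimator) (W : nat -> T -> S)
    (F : forall n, T -> {ffun 'I_n -> 'I_L}) (l : 'I_L) (n : nat) (w : T) : E -> R :=
  e n (F n w) l (sample W n w).

End cross_fitting.

Section censoring.
Context (R : realType).

Definition Ytilde (T : Type) (D : T -> bool) (Y1 Y0 : T -> R) (w : T) : R :=
  if D w then Y1 w else Y0 w.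

Definition Yobs (T : Type) (O D : T -> bool) (Y1 Y0 : T -> R) (w : T) : R :=
  if O w then Y1 w else Ytilde D Y1 Y0 w.

(* The value true encodes 1, so pi o x is pi(o | x) and g d x is g(d | x). *)
Definition Scens (E : Type) (mu nu : E -> R) (pi g : bool -> E -> R)
    (z : E * bool * R) : R :=
  let: (x, o, y) := z in
  (o == true)%:R * (y - mu x) / pi true x
  - (o == false)%:R * (y - nu x) / (g false x * pi false x)
  + g true x * (o == true)%:R * (y - mu x) / (g false x * pi true x)
  + mu x - (g false x)^-1 * nu x + g true x / g false x * mu x.

Context d (T : measurableType d) (P : probability T R).

Definition ate (Y1 Y0 : T -> R) : R := fine 'E_P[Y1 \- Y0].

Definition Vcens (E : Type) (mu nu : E -> R) (pi g : bool -> E -> R)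
    (Z : T -> E * bool * R) (tau : R) : \bar R :=
  'E_P[fun w => (Scens mu nu pi g (Z w) - tau) ^+ 2].

Definition tau_cens_eff (L : nat) dx (E : measurableType dx)
    (muhat nuhat : estimator R L (E * bool * R)%type E)
    (pihat : bool -> estimator R L (E * bool * R)%type E)
    (g : bool -> E -> R) (W : nat -> T -> E * bool * R)
    (F : forall n, T -> {ffun 'I_n -> 'I_L}) (n : nat) (w : T) : R :=
  n%:R^-1 * \sum_(l < L) \sum_(i < n | F n w i == l)
    Scens (fitted muhat W F l n w) (fitted nuhat W F l n w)
          (fun o => fitted (pihat o) W F l n w) g (W i w).

End censoring.

(* Main.v *)
(* Write Z for the law of an observation, S for the score at the true nuisance
   functions and Delta_l for the error of the score made by the nuisance
   estimators of fold l. Then sqrt n (tauhat - tau0) is the normalised sum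
   n^(-1/2) sum_i (S(Z_i) - tau0) plus one remainder per fold,
   n^(-1/2) sum_(i in I_l) Delta_l(Z_i).

   The score S is a difference of two "arms", each of the form kap/p * N with N a
   residual of conditional mean 0 given X, plus a function of X; unconfoundedness
   yields E S = tau0, and V < +oo forces each arm to be square integrable on its
   own (the function of X is the projection of S, and each arm is, up to sign,
   the restriction of S minus this projection to an observation stratum).

   Each arm of Delta_l has a product structure: its mean is at most a constant
   times E |p - phat| |m - mhat|, which is o(n^(-1/2)) by Cauchy-Schwarz and the
   rate assumption, and its second moment is small when phat and mhat are close
   to p and m in L2. As Delta_l depends only on the observations outside fold l,
   conditioning on those and Chebyshev's inequality make the remainder
   negligible.

   The normalised sum is treated by Lindeberg's replacement method, tested
   against logistic functions; these approximate the indicators of half-lines,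
   which also absorbs the remainders at continuity points of the limit. *)
From HB Require Import structures.
Require Import Defs.
From mathcomp Require Import all_boot all_order all_algebra finmap.
From mathcomp Require Import all_classical all_reals all_analysis.
From mathcomp Require Import measurable_realfun ring lra.
Set Implicit Arguments.
Unset Strict Implicit.
Unset Printing Implicit Defensive.
Import Order.TTheory GRing.Theory Num.Theory.
Import numFieldNormedType.Exports.
Local Open Scope classical_set_scope.
Local Open Scope ring_scope.

(** * Expectations *)

(** No conditional expectation operator and no regular conditional law is built. Centering given X
    is a family of integral identities ([cmean0]), extended from indicators to arbitrary
    multipliers. Conditioning on the training data becomes Tonelli's theorem for the product law of
    one observation and the sample with that entry overwritten.

    The residuals are only square integrable and the fitted propensity is only close in L2, so a
    product of the two has no evident second moment. Boundedness of the weights settles the part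
    where the residual is large, L2 closeness the rest; this truncation level is where the [del] of
    the error bounds comes from.

    Overlap and rates hold for the estimators only with probability tending to 1. The fold error is
    therefore cut off to a set of good training samples; this set does not look at the fold, so the
    centering survives the cut.

    With two moments only, the Taylor remainder must be measured by the smaller of a square and a
    cube. The normal variables of the replacement method are never realised on the probability
    space: they act on the test function as averaging operators, under which the class of test
    functions is stable with unchanged constants. *)

Section measurable_sets.
Context d (T : measurableType d).

Lemma measurable_preimage d' (S : measurableType d') (f : T -> S) (A : set S) :
  measurable_fun [set: T] f -> measurable A -> measurable (f @^-1` A).
Proof. by move=> mf mA; rewrite -[X in measurable X]setTI; exact: mf. Qed.

Lemma measurable_set_lt (R : realType) (f g : T -> R) : measurable_fun [set: T] f ->
  measurable_fun [set: T] g -> measurable [set x | f x < g x].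
Proof.
move=> mf mg; have m := measurable_fun_ltr mf mg.
have := measurable_preimage (A := [set true]) m; rewrite (_ : _ @^-1` _ = [set x | f x < g x]).
  exact.
by apply/seteqP; split => x.
Qed.

Lemma measurable_abs_gt (R : realType) (f : T -> R) (r : R) :
  measurable_fun [set: T] f -> measurable [set x | r < `|f x|].
Proof. by move=> mf; apply: measurable_set_lt => //; exact: measurableT_comp. Qed.

Lemma measurable_abs_le (R : realType) (f : T -> R) (r : R) :
  measurable_fun [set: T] f -> measurable [set x | `|f x| <= r].
Proof.
move=> mf; rewrite (_ : [set x | _] = ~` [set x | r < `|f x|]).
  by apply: measurableC; exact: measurable_abs_gt.
by apply/seteqP; split => x /=; rewrite leNgt => /negP.
Qed.

End measurable_sets.

Section expectation_calculus.
Context d (T : measurableType d) (R : realType) (P : probability T R).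
Implicit Types (f g : T -> R).

Definition rint f := P.-integrable [set: T] (EFin \o f).

Lemma rint_measurable f : rint f -> measurable_fun [set: T] f.
Proof. by move=> /measurable_int/measurable_EFinP. Qed.

Lemma rintD f g : rint f -> rint g -> rint (fun x => f x + g x).
Proof. by move=> rf rg; have := integrableD measurableT rf rg. Qed.

Lemma rintZ f (r : R) : rint f -> rint (fun x => r * f x).
Proof. by move=> rf; have := integrableZl measurableT r rf. Qed.

Lemma rintN f : rint f -> rint (fun x => - f x).
Proof. by move=> rf; have := integrableN rf. Qed.

Lemma rintB f g : rint f -> rint g -> rint (fun x => f x - g x).
Proof. by move=> rf rg; apply: rintD => //; exact: rintN. Qed.

Lemma rint_cst (r : R) : rint (fun=> r).
Proof. exact: finite_measure_integrable_cst. Qed.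

Lemma rint_dom f g : measurable_fun [set: T] f -> (forall x, `|f x| <= g x) ->
  rint g -> rint f.
Proof.
move=> mf fg rg; apply: (le_integrable measurableT _ _ rg).
  exact/measurable_EFinP.
by move=> x _ /=; rewrite lee_fin (le_trans (fg x))// ler_norm.
Qed.

Lemma rint_bounded f (C : R) : measurable_fun [set: T] f ->
  (forall x, `|f x| <= C) -> rint f.
Proof. by move=> mf fC; apply: (rint_dom mf fC); exact: rint_cst. Qed.

Lemma rint_norm f : rint f -> rint (fun x => `|f x|).
Proof. by move=> rf; exact: integrable_norm. Qed.

Lemma rint_of_sqr f : measurable_fun [set: T] f -> rint (fun x => f x ^+ 2) -> rint f.
Proof.
move=> mf rf; apply: (rint_dom mf _ (rintD (rint_cst 1) rf)).
by move=> x; rewrite ler_norml; apply/andP; split; nra.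
Qed.

Lemma rint_sum (I : Type) (s : seq I) (Q : pred I) (h : I -> T -> R) :
  (forall i, Q i -> rint (h i)) -> rint (fun x => \sum_(i <- s | Q i) h i x).
Proof.
move=> rh; rewrite (_ : (fun x => _) = \sum_(i <- s | Q i) h i); last first.
  by apply/funext => x; rewrite fct_sumE.
elim/big_ind : _ => //; first exact: rint_cst.
by move=> f g rf rg; exact: rintD.
Qed.

(** A real number even for a non-integrable [f], since [fine] sends an infinite integral to 0; this
    is why linearity and comparison below require [rint]. *)
Definition Ex f : R := \int[P]_x f x.

Lemma ExE f : rint f -> (Ex f)%:E = (\int[P]_x (f x)%:E)%E.
Proof. by move=> rf; rewrite /Ex /Rintegral fineK//; exact: integrable_fin_num. Qed.

Lemma eq_Ex f g : f =1 g -> Ex f = Ex g.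
Proof. by move=> fg; apply: eq_Rintegral => x _. Qed.

Lemma ExD f g : rint f -> rint g -> Ex (fun x => f x + g x) = Ex f + Ex g.
Proof. by move=> rf rg; exact: RintegralD. Qed.

Lemma ExB f g : rint f -> rint g -> Ex (fun x => f x - g x) = Ex f - Ex g.
Proof. by move=> rf rg; exact: RintegralB. Qed.

Lemma ExZ f (r : R) : rint f -> Ex (fun x => r * f x) = r * Ex f.
Proof. by move=> rf; exact: RintegralZl. Qed.

Lemma Ex_cst (r : R) : Ex (fun=> r) = r.
Proof.
rewrite /Ex Rintegral_cst// [X in fine X](_ : _ = 1%E) ?mulr1//.
exact: probability_setT.
Qed.

Lemma Ex_le f g : rint f -> rint g -> (forall x, f x <= g x) -> Ex f <= Ex g.
Proof. by move=> rf rg fg; apply: le_Rintegral => // x _. Qed.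

Lemma Ex_ge0 f : (forall x, 0 <= f x) -> 0 <= Ex f.
Proof. by move=> f0; apply: Rintegral_ge0 => x _. Qed.

Lemma Ex_abs_le f g : rint f -> rint g -> (forall x, `|f x| <= g x) ->
  `|Ex f| <= Ex g.
Proof.
move=> rf rg fg; apply: (le_trans (le_normr_Rintegral measurableT rf)).
by apply: Ex_le => //; exact: rint_norm.
Qed.

Lemma Ex_abs_le_cst f (C : R) : measurable_fun [set: T] f ->
  (forall x, `|f x| <= C) -> `|Ex f| <= C.
Proof.
move=> mf fC; rewrite -[leRHS]Ex_cst; apply: Ex_abs_le => //.
- exact: rint_bounded fC.
- exact: rint_cst.
Qed.

Lemma Ex_sum (I : Type) (s : seq I) (Q : pred I) (h : I -> T -> R) :
  (forall i, Q i -> rint (h i)) ->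
  Ex (fun x => \sum_(i <- s | Q i) h i x) = \sum_(i <- s | Q i) Ex (h i).
Proof.
move=> rh; elim: s => [|i s IH].
  by rewrite big_nil -[RHS](Ex_cst 0); apply: eq_Ex => x; rewrite big_nil.
rewrite big_cons -IH; case: ifPn => Qi.
  rewrite -ExD ?rint_sum//; last exact: rh.
  by apply: eq_Ex => x; rewrite big_cons Qi.
by apply: eq_Ex => x; rewrite big_cons (negbTE Qi).
Qed.

End expectation_calculus.

(** No integrability is asked of the slices: by Tonelli both parts of [f] have measurable integrals,
    and [fine] of their difference is measurable whatever its value. *)
Lemma measurable_Ex d1 d2 (T1 : measurableType d1) (T2 : measurableType d2)
    (R : realType) (P : probability T2 R) (f : T1 * T2 -> R) :
  measurable_fun [set: T1 * T2] f ->
  measurable_fun [set: T1] (fun x => Ex P (fun y => f (x, y))).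
Proof.
move=> mf.
have mEf : measurable_fun [set: T1 * T2] (EFin \o f) by exact/measurable_EFinP.
have mp : measurable_fun [set: T1 * T2] (EFin \o f)^\+%E by exact: measurable_funepos.
have mn : measurable_fun [set: T1 * T2] (EFin \o f)^\-%E by exact: measurable_funeneg.
have mFp := measurable_fun_fubini_tonelli_F (m2 := P) _ mp (fun z => funepos_ge0 _ z).
have mFn := measurable_fun_fubini_tonelli_F (m2 := P) _ mn (fun z => funeneg_ge0 _ z).
rewrite (_ : (fun x => _) = fine \o (fubini_F P (EFin \o f)^\+%E \- fubini_F P (EFin \o f)^\-%E)%E).
  by apply: measurableT_comp; [exact: fine_measurable|exact: emeasurable_funB].
apply/funext => x /=; rewrite /Ex /Rintegral integralE /fubini_F.
by congr (fine (_ - _)%E); apply: eq_integral => y _; rewrite ?funeposE ?funenegE.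
Qed.

(** * Normal laws *)

Section density.
Context d (T : measurableType d) (R : realType).
Local Open Scope ereal_scope.

(** [Z] agrees almost everywhere with the Radon-Nikodym derivative of [nu], for which the change of
    variables is known. *)
Lemma ge0_integral_density (nu : {finite_measure set T -> \bar R})
    (P : {sigma_finite_measure set T -> \bar R}) (Z : T -> R) (h : T -> \bar R) :
  measurable_fun [set: T] Z ->
  (forall A, measurable A -> nu A = \int[P]_(x in A) (Z x)%:E) ->
  measurable_fun [set: T] h -> (forall x, 0 <= h x) ->
  \int[nu]_x h x = \int[P]_x (h x * (Z x)%:E).
Proof.
move=> mZ nuE mh h0; have mEZ : measurable_fun [set: T] (EFin \o Z) by exact/measurable_EFinP.
have dom : nu `<< P.
  apply/null_content_dominatesP => A mA PA0; rewrite nuE//.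
  by apply: null_set_integral => //; exact: measurable_funTS.
have rn := Radon_Nikodym_SigmaFinite.f_integrable dom.
have ZE : ae_eq P setT (Radon_Nikodym_SigmaFinite.f nu P) (EFin \o Z).
  apply: integral_ae_eq => // A _ mA.
  by rewrite -(Radon_Nikodym_SigmaFinite.f_integral dom mA) nuE.
rewrite -(Radon_Nikodym_SigmaFinite.change_of_variables dom h0 measurableT mh).
apply: ae_eq_integral => //.
- by apply: emeasurable_funM => //; exact: measurable_int rn.
- exact: emeasurable_funM.
- by apply: filterS ZE => x Zx Tx; rewrite Zx.
Qed.

End density.

Section gaussian.
Context (R : realType).
Notation mu := (@lebesgue_measure R).
Implicit Types (s t u v x y : R).

(** Translation invariance: the image of Lebesgue measure under a translation agrees with it on
    half-open intervals, hence everywhere. Scaling is treated in the same way further on. *)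
Lemma ge0_integral_shift (f : R -> \bar R) (c : R) : measurable_fun [set: _] f ->
  (forall x, 0 <= f x)%E -> (\int[mu]_x f x = \int[mu]_x f (x + c)%R)%E.
Proof.
move=> mf f0.
have mc : measurable_fun [set: _] (fun x : R => x + c) by exact: measurable_funD.
pose g : R -> measurableTypeR R := fun x : R => x + c.
transitivity (\int[pushforward mu g]_x f x)%E.
  apply: eq_measure_integral => A mA _; apply: lebesgue_measure_unique => //.
  move=> _ [[a b]] _ <-.
  transitivity (mu (g @^-1` `]a, b]%classic)); last by [].
  rewrite (_ : g @^-1` _ = `]a - c, b - c]%classic); last first.
    by apply/seteqP; split => x /=; rewrite !in_itv/= ltrBlDr lerBrDr.
  by rewrite !lebesgue_measure_itv/= !lte_fin ltrD2r; case: ifP => // _; rewrite -!EFinB; congr EFin; ring.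
by rewrite ge0_integral_pushforward.
Qed.

(** Completing the square. For independent centred normal summands with deviations [s] and [t], this
    factors the joint density into the density of the sum at [u] and the conditional density of the
    first summand given the sum. *)
Lemma normal_pdfM s t u y : 0 < s -> 0 < t ->
  normal_pdf 0 s y * normal_pdf 0 t (u - y) =
  normal_pdf 0 (Num.sqrt (s ^+ 2 + t ^+ 2)) u *
  normal_pdf (u * s ^+ 2 / (s ^+ 2 + t ^+ 2))
    (s * t / Num.sqrt (s ^+ 2 + t ^+ 2)) y.
Proof.
move=> s0 t0; set r2 := s ^+ 2 + t ^+ 2.
have r20 : 0 < r2 by rewrite addr_gt0 ?exprn_gt0.
have r0 : 0 < Num.sqrt r2 by rewrite sqrtr_gt0.
have rr : Num.sqrt r2 ^+ 2 = r2 by rewrite sqr_sqrtr// ltW.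
rewrite !normal_pdfE ?gt_eqF// ?divr_gt0 ?mulr_gt0//.
rewrite mulrACA [RHS]mulrACA; congr (_ * _).
  rewrite /normal_peak -!invfM -!sqrtrM ?mulrn_wge0 ?mulr_ge0 ?sqr_ge0 ?pi_ge0 ?(ltW s0)//.
  congr (Num.sqrt _)^-1; rewrite exprMn exprVn rr exprMn; field.
  by rewrite gt_eqF.
rewrite /normal_fun -!expRD; congr expR.
rewrite [(s * t / _) ^+ 2]exprMn exprVn rr exprMn; rewrite /r2.
by field; rewrite !gt_eqF.
Qed.

Lemma normal_pdf_convolution s t u : 0 < s -> 0 < t ->
  (\int[mu]_y (normal_pdf 0 s y * normal_pdf 0 t (u - y))%:E =
   (normal_pdf 0 (Num.sqrt (s ^+ 2 + t ^+ 2)) u)%:E)%E.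
Proof.
move=> s0 t0; under eq_integral do rewrite normal_pdfM// EFinM.
rewrite ge0_integralZl ?lee_fin ?normal_pdf_ge0//.
- by rewrite integral_normal_pdf mule1.
- by apply/measurable_EFinP; exact: measurable_normal_pdf.
- by move=> x _; rewrite lee_fin normal_pdf_ge0.
Qed.

Lemma ge0_integral_normal_prob m s (f : R -> \bar R) : measurable_fun [set: _] f ->
  (forall x, 0 <= f x)%E ->
  (\int[normal_prob m s]_x f x = \int[mu]_x (f x * (normal_pdf m s x)%:E))%E.
Proof.
by move=> mf f0; apply: ge0_integral_density => //; exact: measurable_normal_pdf.
Qed.

Lemma ge0_normal_prob_convolution s t (f : R -> \bar R) : 0 < s -> 0 < t ->
  measurable_fun [set: _] f -> (forall x, 0 <= f x)%E ->
  (\int[normal_prob 0 s]_y \int[normal_prob 0 t]_z f (y + z)%R =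
   \int[normal_prob 0 (Num.sqrt (s ^+ 2 + t ^+ 2))]_x f x)%E.
Proof.
move=> s0 t0 mf f0.
have mp m r : measurable_fun [set: _] (fun x => (normal_pdf m r x)%:E).
  by apply/measurable_EFinP; exact: measurable_normal_pdf.
have p0 m r x : (0 <= (normal_pdf m r x)%:E)%E by rewrite lee_fin normal_pdf_ge0.
have mfy y : measurable_fun [set: _] (fun z => f (y + z)).
  by apply: measurableT_comp => //; exact: measurable_funD.
under eq_integral do rewrite ge0_integral_normal_prob//.
rewrite [LHS]ge0_integral_normal_prob//; last 2 first.
- pose k (yz : measurableTypeR R * measurableTypeR R) :=
    (f (yz.1 + yz.2)%R * (normal_pdf 0 t yz.2)%:E)%E.
  apply: (@measurable_fun_fubini_tonelli_F _ _ (measurableTypeR R)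
    (measurableTypeR R) R mu k).
  + apply: emeasurable_funM; last exact: (measurableT_comp (mp 0 t) (@measurable_snd _ _ (measurableTypeR R) (measurableTypeR R))).
    by apply: measurableT_comp => //; exact: measurable_funD.
  + by move=> x; rewrite /k mule_ge0.
- by move=> x; apply: integral_ge0 => y _; rewrite mule_ge0.
(* The integrand after the substitution u = y + z in the inner integral; Tonelli then lets y be
   integrated out first. *)
pose k (yu : measurableTypeR R * measurableTypeR R) := (f yu.2 * (normal_pdf 0 s yu.1 * normal_pdf 0 t (yu.2 - yu.1))%:E)%E.
have mk : measurable_fun [set: _] k.
  apply: emeasurable_funM.
    exact: (measurableT_comp mf (@measurable_snd _ _ (measurableTypeR R) (measurableTypeR R))).
  apply/measurable_EFinP/measurable_funM.
    exact: (measurableT_comp (measurable_normal_pdf _ _) (@measurable_fst _ _ (measurableTypeR R) (measurableTypeR R))).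
  apply: measurableT_comp; first exact: measurable_normal_pdf.
  exact: measurable_funB.
have k0 z : (0 <= k z)%E.
  by rewrite mule_ge0// lee_fin mulr_ge0 ?normal_pdf_ge0.
transitivity (\int[mu]_y \int[mu]_u k (y, u))%E.
  apply: eq_integral => y _.
  rewrite -ge0_integralZr//; last 2 first.
  - by apply: emeasurable_funM; [exact: mfy|exact: mp].
  - by move=> x _; rewrite mule_ge0.
  rewrite [RHS](@ge0_integral_shift _ y)//; last first.
    exact: (measurableT_comp mk (@measurable_pair1 _ _ (measurableTypeR R) (measurableTypeR R) y)).
  apply: eq_integral => x _.
  by rewrite /k /= addrK [(x + y)%R]addrC EFinM -muleA [(_%:E * _%:E)%E]muleC.
rewrite (fubini_tonelli k)//= ge0_integral_normal_prob//.
apply: eq_integral => x _; rewrite -normal_pdf_convolution// -ge0_integralZl//.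
- apply/measurable_EFinP/measurable_funM; first exact: measurable_normal_pdf.
  apply: measurableT_comp; first exact: measurable_normal_pdf.
  exact: measurable_funB.
- by move=> y _; rewrite lee_fin mulr_ge0 ?normal_pdf_ge0.
Qed.

Lemma ge0_integral_scale (f : R -> \bar R) (c : R) : 0 < c ->
  measurable_fun [set: R] f -> (forall x, 0 <= f x)%E ->
  (\int[mu]_x f x = c%:E * \int[mu]_x f (c * x)%R)%E.
Proof.
move=> c0 mf f0.
have mc : measurable_fun [set: R] (fun x : R => c * x) by exact: measurable_funM.
pose g : R -> measurableTypeR R := fun x : R => c * x.
pose k := NngNum (ltW c0).
pose nu := measure_function_pushforward__canonical__measure_function_Measure mu (mc : measurable_fun _ g).
transitivity (\int[mscale k nu]_x f x)%E.
  apply: eq_measure_integral => A mA _; apply: lebesgue_measure_unique => //.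
  move=> _ [[a b]] _ <-.
  transitivity (c%:E * mu (g @^-1` `]a, b]%classic))%E; last by [].
  rewrite (_ : g @^-1` _ = `]a / c, b / c]%classic); last first.
    by apply/seteqP; split => x /=; rewrite !in_itv/= ltr_pdivrMr// ler_pdivlMr// mulrC.
  rewrite !lebesgue_measure_itv/= !lte_fin ltr_pM2r ?invr_gt0//.
  case: ifP => // _; last by rewrite mule0.
  by rewrite -!EFinB -EFinM; congr EFin; field; rewrite gt_eqF.
rewrite ge0_integral_mscale//=; congr (_ * _)%E.
by rewrite ge0_integral_pushforward.
Qed.

Lemma ge0_normal_prob_scale (s c : R) (f : R -> \bar R) : 0 < s -> 0 < c ->
  measurable_fun [set: R] f -> (forall x, 0 <= f x)%E ->
  (\int[normal_prob 0 (c * s)]_x f x = \int[normal_prob 0 s]_x f (c * x)%R)%E.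
Proof.
move=> s0 c0 mf f0; have mp m r : measurable_fun [set: R] (fun x => (normal_pdf m r x)%:E).
  by apply/measurable_EFinP; exact: measurable_normal_pdf.
have mfc : measurable_fun [set: R] (fun x => f (c * x)).
  by apply: measurableT_comp => //; exact: measurable_funM.
rewrite (ge0_integral_normal_prob 0 (c * s) mf f0).
rewrite (ge0_integral_normal_prob 0 s mfc (fun x => f0 _)).
rewrite [LHS](ge0_integral_scale c0); last 2 first.
- by apply: emeasurable_funM.
- by move=> x; rewrite mule_ge0// lee_fin normal_pdf_ge0.
rewrite -ge0_integralZl ?lee_fin ?ltW//; last 2 first.
- apply: emeasurable_funM => //; apply: (measurableT_comp (mp 0 (c * s))).
  exact: measurable_funM.
- by move=> x _; rewrite mule_ge0// lee_fin normal_pdf_ge0.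
apply: eq_integral => x _; rewrite muleCA -EFinM; congr (_ * _%:E)%E.
rewrite !normal_pdfE ?gt_eqF ?mulr_gt0// mulrA; congr (_ * _).
  rewrite /normal_peak (_ : (c * s) ^+ 2 * pi *+ 2 = c ^+ 2 * (s ^+ 2 * pi *+ 2)); last by ring.
  rewrite sqrtrM ?sqr_ge0// sqrtr_sqr ger0_norm ?ltW// invfM mulrA divff ?mul1r//.
  by rewrite gt_eqF.
rewrite /normal_fun; congr expR; field.
by rewrite !gt_eqF.
Qed.

Lemma ge0_normal_prob_sym (s : R) (f : R -> \bar R) : 0 < s ->
  measurable_fun [set: R] f -> (forall x, 0 <= f x)%E ->
  (\int[normal_prob 0 s]_x f x = \int[normal_prob 0 s]_x f (- x)%R)%E.
Proof.
move=> s0 mf f0; have mp m r : measurable_fun [set: R] (fun x => (normal_pdf m r x)%:E).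
  by apply/measurable_EFinP; exact: measurable_normal_pdf.
have mfc : measurable_fun [set: R] (fun x => f (- x)) by apply: measurableT_comp.
have mN : measurable_fun [set: R] (fun x : R => - x) by apply: oppr_measurable.
pose g : R -> measurableTypeR R := fun x : R => - x.
rewrite (ge0_integral_normal_prob 0 s mf f0).
rewrite (ge0_integral_normal_prob 0 s mfc (fun x => f0 _)).
transitivity (\int[pushforward mu g]_x (f x * (normal_pdf 0 s x)%:E))%E.
  by apply: eq_measure_integral => A mA _; rewrite -[LHS]lebesgue_measureN.
rewrite ge0_integral_pushforward; first last.
- by move=> x _; rewrite mule_ge0// lee_fin normal_pdf_ge0.
- by apply: emeasurable_funM; [exact: mf|exact: mp].
- exact: measurableT.
- exact: mN.
apply: eq_integral => x _; rewrite /g /=; congr (_ * _%:E)%E.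
by rewrite !normal_pdfE ?gt_eqF// /normal_fun !subr0 sqrrN.
Qed.

(** The exponential turns the standard density into 1/q times the density of deviation 1/q. Varying
    q around 1 on both sides gives access to the second moment without integration by parts. *)
Lemma normal_prob_expR_sqr (q : R) : 0 < q ->
  (\int[normal_prob 0 1]_x (expR (- ((q ^+ 2 - 1) * x ^+ 2 / 2)))%:E = (q^-1)%:E)%E.
Proof.
move=> q0; rewrite ge0_integral_normal_prob//; last first.
- apply/measurable_EFinP; apply: measurableT_comp => //.
  apply: measurableT_comp => //; apply: measurable_funM => //.
  by apply: measurable_funM => //; exact: measurable_funX.
transitivity ((q^-1)%:E * \int[mu]_x (normal_pdf 0 q^-1 x)%:E)%E; last first.
  by rewrite integral_normal_pdf mule1.
have mp : measurable_fun [set: R] (fun x => (normal_pdf 0 q^-1 x)%:E).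
  by apply/measurable_EFinP; exact: measurable_normal_pdf.
have p0 x : [set: R] x -> (0 <= (normal_pdf 0 q^-1 x)%:E)%E.
  by rewrite lee_fin normal_pdf_ge0.
have q'0 : (0 <= q^-1%:E)%E by rewrite lee_fin invr_ge0 ltW.
rewrite -(ge0_integralZl mu measurableT mp p0 q'0).
apply: eq_integral => x _; rewrite -!EFinM; congr EFin.
rewrite !normal_pdfE ?gt_eqF ?invr_gt0// /normal_peak /normal_fun mulrCA [RHS]mulrA; congr (_ * _).
  rewrite (_ : q^-1 ^+ 2 * pi *+ 2 = q^-1 ^+ 2 * (1 ^+ 2 * pi *+ 2)); last by ring.
  rewrite sqrtrM ?sqr_ge0// sqrtr_sqr ger0_norm ?invr_ge0 ?ltW// invfM invrK mulrA mulVf ?mul1r//.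
  by rewrite gt_eqF.
rewrite -expRD; congr expR; field.
by rewrite !gt_eqF.
Qed.

(** Here [m] is half the second moment of the standard normal law. Dividing by the coefficient of
    [m], both bounds compare it with 1 / (q (q + 1)), which tends to 1/2 as q tends to 1. *)
Lemma eq_half_of_bounds (m : R) :
  (forall q : R, 1 < q -> 1 - q^-1 <= (q ^+ 2 - 1) * m) ->
  (forall q : R, 0 < q -> q < 1 -> (1 - q ^+ 2) * m <= q^-1 - 1) -> m = 2^-1.
Proof.
move=> lo up.
apply/eqP; rewrite eq_le; apply/andP; split.
  - apply/ler_addgt0Pr => e' e0; set e : R := e' in e0 *; pose r := Num.min (e / 2) (1 / 4).
    have r0 : 0 < r by rewrite lt_min; apply/andP; split; lra.
    have re : r <= e / 2 by rewrite ge_min lexx.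
    have r4 : r <= 1 / 4 by rewrite ge_min lexx orbT.
    have := up (1 - r) ltac:(lra) ltac:(lra).
    have -> : (1 - r)^-1 - 1 = r / (1 - r) by field; lra.
    rewrite ler_pdivlMr; last by lra.
    have -> : (1 - (1 - r) ^+ 2) * m * (1 - r) = r * (m * ((2 - r) * (1 - r))) by ring.
    rewrite -[X in _ <= X]mulr1 ler_pM2l// => H.
    have : m <= 2^-1 + 2 * r by nra.
    lra.
  - apply/ler_addgt0Pr => e' r0; set r : R := e' in r0 *.
    have := lo (1 + r) ltac:(lra).
    have -> : 1 - (1 + r)^-1 = r / (1 + r) by field; lra.
    rewrite ler_pdivrMr; last by lra.
    have -> : ((1 + r) ^+ 2 - 1) * m * (1 + r) = r * (m * ((2 + r) * (1 + r))) by ring.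
    rewrite -[X in X <= _]mulr1 ler_pM2l// => H.
    nra.
Qed.

(** The inequality 1 - t <= exp (- t) is integrated at t = (q^2 - 1) x^2 / 2, which is positive for
    q > 1 and negative for q < 1; this gives the two bounds of [eq_half_of_bounds]. *)
Lemma normal_prob1_sqr : (\int[normal_prob 0 1]_x (x ^+ 2)%:E = (1 : R)%:E)%E.
Proof.
set N := normal_prob 0 1.
have mX : measurable_fun [set: R] (fun x : R => (x ^+ 2 / 2)%:E).
  by apply/measurable_EFinP; apply: measurable_funM => //; exact: measurable_funX.
have X0 (x : R) : (0 <= (x ^+ 2 / 2)%:E)%E by rewrite lee_fin mulr_ge0 ?sqr_ge0.
have mE (q : R) : measurable_fun [set: R] (fun x => (expR (- ((q ^+ 2 - 1) * x ^+ 2 / 2)))%:E).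
  apply/measurable_EFinP; apply: measurableT_comp => //.
  apply: measurableT_comp => //; apply: measurable_funM => //.
  by apply: measurable_funM => //; exact: measurable_funX.
have N1 : (\int[N]_x (1%:E : \bar R) = 1)%E.
  by rewrite integral_cst// mul1e; exact: probability_setT.
pose M := (\int[N]_x (x ^+ 2 / 2)%:E)%E.
have M0 : (0 <= M)%E by exact: integral_ge0.
have lo (q : R) : 1 < q -> ((1 - q^-1)%:E <= (q ^+ 2 - 1)%:E * M)%E.
  move=> q1; have q0 : 0 < q by lra.
  have h0 : 0 <= q ^+ 2 - 1 by nra.
  rewrite EFinB leeBlDr// -(normal_prob_expR_sqr q0) -ge0_integralZl ?lee_fin//.
  rewrite -ge0_integralD//; last 3 first.
  - by move=> x _; rewrite -EFinM lee_fin mulr_ge0 ?divr_ge0 ?sqr_ge0.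
  - by apply: emeasurable_funM; [exact: measurable_cst|exact: mX].
  - exact: mE.
  rewrite -N1; apply: ge0_le_integral => //.
  - apply: emeasurable_funD; last exact: mE.
    by apply: emeasurable_funM; [exact: measurable_cst|exact: mX].
  move=> x _; rewrite -EFinM -EFinD lee_fin.
  have := expR_ge1Dx (- ((q ^+ 2 - 1) * x ^+ 2 / 2)); lra.
have up (q : R) : 0 < q -> q < 1 -> ((1 - q ^+ 2)%:E * M <= (q^-1 - 1)%:E)%E.
  move=> q0 q1.
  have h0 : 0 <= 1 - q ^+ 2 by nra.
  rewrite [(q^-1 - 1)%:E]EFinB leeBrDr// -(normal_prob_expR_sqr q0) -ge0_integralZl ?lee_fin//.
  rewrite -N1 -ge0_integralD//; last 2 first.
  - by move=> x _; rewrite -EFinM lee_fin mulr_ge0 ?divr_ge0 ?sqr_ge0.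
  - by apply: emeasurable_funM; [exact: measurable_cst|exact: mX].
  apply: ge0_le_integral => //.
  - by move=> x _; rewrite adde_ge0// -EFinM lee_fin mulr_ge0 ?divr_ge0 ?sqr_ge0.
  - apply: emeasurable_funD; last exact: measurable_cst.
    by apply: emeasurable_funM; [exact: measurable_cst|exact: mX].
  - exact: mE.
  move=> x _; rewrite -EFinM -EFinD lee_fin.
  have := expR_ge1Dx (- ((q ^+ 2 - 1) * x ^+ 2 / 2)); lra.
(* The upper bound at q = 1/2 already excludes an infinite second moment. *)
have Mfin : M \is a fin_num.
  rewrite ge0_fin_numE//; have := up (1 / 2) _ _.
  have -> : 1 - (1 / 2) ^+ 2 = 3 / 4 :> R by field.
  case: (M) M0 => //= [r _ _|_ H]; first by rewrite ltry.
  exfalso.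
  have := H ltac:(lra) ltac:(lra); rewrite gt0_muley ?lte_fin; last by lra.
  by rewrite leye_eq.
have ME : M = (2^-1)%:E.
  rewrite -(fineK Mfin); move: (fine M) (fineK Mfin) => m mE'.
  have {}lo (q : R) : 1 < q -> 1 - q^-1 <= (q ^+ 2 - 1) * m.
    by move=> /lo; rewrite -mE' -EFinM lee_fin.
  have {}up (q : R) : 0 < q -> q < 1 -> (1 - q ^+ 2) * m <= q^-1 - 1.
    by move=> /up h /h; rewrite -mE' -EFinM lee_fin.
  by congr EFin; exact: eq_half_of_bounds.
transitivity (2%:E * M)%E.
  rewrite -ge0_integralZl//; apply: eq_integral => x _.
  by rewrite -EFinM; congr EFin; field.
by rewrite ME -EFinM divff.
Qed.

Lemma normal_prob_sqr s : 0 < s -> (\int[normal_prob 0 s]_x (x ^+ 2)%:E = (s ^+ 2)%:E)%E.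
Proof.
move=> s0; rewrite -[in LHS](mulr1 s) ge0_normal_prob_scale//; last 2 first.
- by apply/measurable_EFinP; exact: measurable_funX.
- by move=> x; rewrite lee_fin sqr_ge0.
under eq_integral do rewrite exprMn EFinM.
rewrite ge0_integralZl//; last 3 first.
- by apply/measurable_EFinP; exact: measurable_funX.
- by move=> x _; rewrite lee_fin sqr_ge0.
- by rewrite lee_fin sqr_ge0.
by rewrite normal_prob1_sqr mule1.
Qed.

(** By symmetry the positive and negative parts have equal integrals, which are finite because |x|
    <= 1 + x^2. *)
Lemma normal_prob_mean s : 0 < s -> (\int[normal_prob 0 s]_x (x%:E) = 0 :> \bar R)%E.
Proof.
move=> s0.
pose f (x : R) : \bar R := x%:E.
have mf : measurable_fun [set: R] f by exact: EFin_measurable.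
have mfp : measurable_fun [set: R] (f^\+)%E by exact: measurable_funepos.
rewrite -/f integralE (ge0_normal_prob_sym s0 mfp)//.
rewrite (_ : (fun x : R => _) = (f^\-)%E); last first.
  by apply/funext => x; rewrite funeposE funenegE /f.
rewrite -/f subee// ge0_fin_numE; last exact: integral_ge0.
apply: (@le_lt_trans _ _ (\int[normal_prob 0 s]_x (1 + x ^+ 2)%:E)%E).
  apply: ge0_le_integral => //.
  - exact: measurable_funeneg.
  - by apply/measurable_EFinP; apply: measurable_funD => //; exact: measurable_funX.
  by move=> x _; rewrite funenegE /f -EFinN -EFin_max lee_fin ge_max; apply/andP; split; nra.
under eq_integral do rewrite EFinD.
rewrite ge0_integralD//; last 2 first.
- by move=> x _; rewrite lee_fin sqr_ge0.
- by apply/measurable_EFinP; exact: measurable_funX.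
rewrite normal_prob_sqr// integral_cst// mul1e.
by rewrite [X in (X + _)%E](_ : _ = 1%E) ?ltry//; exact: probability_setT.
Qed.

End gaussian.

(** * Smooth test functions *)

Section taylor_class.
Context (R : realType).
Implicit Types (f : R -> R).

(** One step of Taylor's formula by the mean value theorem. The factor 1 / (n + 1) of an exact
    integration is given up, since only the power matters. *)
Lemma mvt_pow (F F' : R -> R) (M : R) (n : nat) :
  (forall h : R, is_derive h 1 F (F' h)) -> F 0 = 0 ->
  (forall h, `|F' h| <= M * `|h| ^+ n) -> forall h, `|F h| <= M * `|h| ^+ n.+1.
Proof.
move=> dF F0 F'le h.
have M0 : 0 <= M.
  by have := F'le 1; rewrite normr1 expr1n mulr1; apply: le_trans.
have cF a b : {within `[a, b], continuous F}.
  apply: derivable_within_continuous => x _.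
  exact: (@ex_derive _ _ _ _ _ _ _ (dF x)).
have key c : `|c| <= `|h| -> `|F' c * h| <= M * `|h| ^+ n.+1.
  move=> ch; rewrite normrM exprSr mulrA ler_wpM2r//.
  apply: (le_trans (F'le c)); rewrite ler_wpM2l//.
  by rewrite lerXn2r// nnegrE.
have [h0|h0|->] := ltgtP h 0; last by rewrite F0 normr0 exprS mul0r mulr0.
- have [c] := @MVT _ F F' h 0 h0 (fun x _ => dF x) (cF _ _).
  rewrite in_itv/= => /andP[hc c0]; rewrite F0 !sub0r => FE.
  have -> : F h = F' c * h by rewrite -[F h]opprK FE; ring.
  by apply: key; rewrite !ltr0_norm// lerN2 ltW.
- have [c] := @MVT _ F F' 0 h h0 (fun x _ => dF x) (cF _ _).
  rewrite in_itv/= => /andP[c0 ch]; rewrite F0 !subr0 => ->.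
  by apply: key; rewrite !gtr0_norm// ltW.
Qed.

(** The size of a second-order Taylor remainder: cubic for small increments, which makes it
    negligible, and quadratic for large ones, which keeps it integrable with two moments only. *)
Definition min23 (h : R) : R := Num.min (h ^+ 2) (`|h| ^+ 3).

Lemma min23_ge0 h : 0 <= min23 h.
Proof. by rewrite le_min sqr_ge0 exprn_ge0. Qed.

Lemma min23_le_sqr h : min23 h <= h ^+ 2.
Proof. by rewrite ge_min lexx. Qed.

Lemma measurable_min23 : measurable_fun [set: R] min23.
Proof.
apply: measurable_minr; first exact: measurable_funX.
by apply: measurable_funX; exact: normr_measurable.
Qed.

(* [f2] plays the role of [f'' / 2]. Keeping [f1] and [f2] abstract makes the
   class stable under averaging without differentiating under the integral. *)
Definition taylor2 (K C : R) (f f1 f2 : R -> R) :=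
  [/\ [/\ measurable_fun [set: R] f, measurable_fun [set: R] f1 &
          measurable_fun [set: R] f2],
      (forall x, [/\ `|f x| <= C, `|f1 x| <= C & `|f2 x| <= C]) &
      forall x h, `|f (x + h) - f x - f1 x * h - f2 x * h ^+ 2| <= K * min23 h].

Lemma taylor2_smooth (g0 g1 g2 g3 : R -> R) (M : R) :
  (forall x : R, is_derive x 1 g0 (g1 x)) ->
  (forall x : R, is_derive x 1 g1 (g2 x)) ->
  (forall x : R, is_derive x 1 g2 (g3 x)) ->
  (forall x, [/\ `|g0 x| <= M, `|g1 x| <= M, `|g2 x| <= M & `|g3 x| <= M]) ->
  taylor2 (2 * M) M g0 g1 (fun x => g2 x / 2).
Proof.
move=> d0 d1 d2 b.
have M0 : 0 <= M by case: (b 0) => H _ _ _; exact: le_trans H.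
have mg (u v : R -> R) : (forall x : R, is_derive x 1 u (v x)) -> measurable_fun [set: R] u.
  move=> du; apply: continuous_measurable_fun => x.
  apply: differentiable_continuous; apply/derivable1_diffP.
  exact: (@ex_derive _ _ _ _ _ _ _ (du x)).
split.
- split; [exact: mg d0|exact: mg d1|].
  by apply: measurable_funM => //; exact: mg d2.
- move=> x; have [b0 b1 b2 _] := b x; split=> //.
  by rewrite normrM [X in _ * X]ger0_norm//; lra.
move=> x h.
have sh (u v : R -> R) : (forall x : R, is_derive x 1 u (v x)) ->
    forall t : R, is_derive t 1 (fun t => u (x + t)) (v (x + t)).
  move=> du t.
  have dxt : is_derive t 1 (fun t : R => x + t) 1.
    by have := is_deriveD (is_derive_cst x t 1) (is_derive_id t 1); rewrite add0r.
  have := @is_derive1_comp _ u (fun t : R => x + t) t _ _ (du (x + t)) dxt.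
  by rewrite mulr1.
pose r0 t := g0 (x + t) - g0 x - g1 x * t - g2 x / 2 * t ^+ 2.
pose r1 t := g1 (x + t) - g1 x - g2 x * t.
pose r2 t := g2 (x + t) - g2 x.
have dr0 (t : R) : is_derive t 1 r0 (r1 t).
  by have s := sh _ _ d0 t; apply: is_derive_eq; rewrite /r1 /GRing.scale/=; field.
have dr1 (t : R) : is_derive t 1 r1 (r2 t).
  have s := sh _ _ d1 t; apply: is_derive_eq; rewrite /r2 /GRing.scale/=; ring.
have dr2 (t : R) : is_derive t 1 r2 (g3 (x + t)).
  have s := sh _ _ d2 t; apply: is_derive_eq; rewrite /GRing.scale/=; ring.
have r00 : r0 0 = 0 by rewrite /r0 addr0; ring.
have r10 : r1 0 = 0 by rewrite /r1 addr0; ring.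
have r20 : r2 0 = 0 by rewrite /r2 addr0; ring.
(* The remainder is bounded twice. Starting from the bound on [g3], three mean value steps give the
   cube. *)
have B2 : forall t, `|r2 t| <= M * `|t| ^+ 1.
  apply: (mvt_pow dr2 r20) => t; rewrite expr0 mulr1.
  by case: (b (x + t)).
have B1 := mvt_pow dr1 r10 B2.
have B0 := mvt_pow dr0 r00 B1.
(* Starting instead from the crude bound 2 M on an increment of [g2], two steps give the square. *)
have B2' : forall t, `|r2 t| <= (2 * M) * `|t| ^+ 0.
  move=> t; rewrite expr0 mulr1; apply: (le_trans (ler_normB _ _)).
  have [_ _ h1 _] := b (x + t); have [_ _ h2 _] := b x; lra.
have B1' := mvt_pow dr1 r10 B2'.
have B0' := mvt_pow dr0 r00 B1'.
rewrite -/(r0 h) /min23; have := B0 h; have := B0' h.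
rewrite real_normK ?num_real// minEle; case: ifP => // _ _ H.
apply: (le_trans H); rewrite ler_wpM2r ?exprn_ge0//; lra.
Qed.

(** For k > 0 this decreases from 1 to 0 and is a smooth substitute for the indicator of x <= a. Its
    derivatives are polynomials in the function itself, hence bounded. *)
Definition logistic (k a x : R) : R := (1 + expR (k * (x - a)))^-1.

Lemma logistic_gt0 k a x : 0 < logistic k a x.
Proof. by rewrite invr_gt0 addr_gt0// expR_gt0. Qed.

Lemma logistic_le1 k a x : logistic k a x <= 1.
Proof. by rewrite invf_le1 ?addr_gt0 ?expR_gt0// lerDl expR_ge0. Qed.

Lemma is_derive_logistic k a (x : R) :
  is_derive x 1 (logistic k a) (k * (logistic k a x ^+ 2 - logistic k a x)).
Proof.
have n0 : 1 + expR (k * (x - a)) != 0 by rewrite gt_eqF// addr_gt0// expR_gt0.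
have dl : is_derive x 1 (fun x => k * (x - a)) k.
  by apply: is_derive_eq; rewrite /GRing.scale/=; ring.
have de : is_derive x 1 (fun x => expR (k * (x - a))) (k * expR (k * (x - a))).
  rewrite [k * expR _]mulrC.
  exact: (@is_derive1_comp _ expR (fun x => k * (x - a)) x _ _ (is_derive_expR _) dl).
have d1 : is_derive x 1 (fun x => 1 + expR (k * (x - a))) (k * expR (k * (x - a))).
  by have := is_deriveD (is_derive_cst (1 : R) x 1) de; rewrite add0r.
have dV := @is_deriveV _ (fun x => 1 + expR (k * (x - a))) x _ 1 n0 d1.
apply: (@is_derive_eq _ _ _ _ _ _ _ _ dV).
by rewrite /GRing.scale/= /logistic; field.
Qed.

Lemma logistic_taylor2 (k a : R) : 0 < k ->
  exists K C f1 f2, taylor2 K C (logistic k a) f1 f2.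
Proof.
move=> k0; pose l := logistic k a.
pose p1 (x : R) : R := k * (l x ^+ 2 - l x).
pose p2 (x : R) : R := k ^+ 2 * ((2 * l x - 1) * (l x ^+ 2 - l x)).
pose p3 (x : R) : R := k ^+ 3 * ((6 * l x ^+ 2 - 6 * l x + 1) * (l x ^+ 2 - l x)).
have dl (x : R) : is_derive x 1 l (p1 x) by exact: is_derive_logistic.
(* Each derivative is a power of [k] times a polynomial that stays in [-1, 1] when [l x] is in
   [0, 1]. *)
pose M : R := 1 + k + k ^+ 2 + k ^+ 3.
exists (2 * M), M, p1, (fun x => p2 x / 2).
apply: (@taylor2_smooth l p1 p2 p3 M dl) => x.
- have s := dl x; rewrite /p1; apply: is_derive_eq.
  by rewrite /p2 /p1 /GRing.scale/=; ring.
- have s := dl x; rewrite /p2; apply: is_derive_eq.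
  by rewrite /p3 /p1 /GRing.scale/=; ring.
- have l0 : 0 < l x := logistic_gt0 k a x.
  have l1 : l x <= 1 := logistic_le1 k a x.
  have k2 : 0 < k ^+ 2 by rewrite exprn_gt0.
  have k3 : 0 < k ^+ 3 by rewrite exprn_gt0.
  have q : `|l x ^+ 2 - l x| <= 1 by rewrite ler_norml; apply/andP; split; nra.
  have q2 : `|2 * l x - 1| <= 1 by rewrite ler_norml; apply/andP; split; lra.
  have q3 : `|6 * l x ^+ 2 - 6 * l x + 1| <= 1.
    by rewrite ler_norml; apply/andP; split; nra.
  split; rewrite ?/p1 ?/p2 ?/p3; rewrite 1?normrM.
  + by rewrite gtr0_norm// /M; lra.
  + rewrite [X in X * _]gtr0_norm//.
    by have : k * `|l x ^+ 2 - l x| <= k * 1; [rewrite ler_pM2l|rewrite /M; lra].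
  + rewrite [X in X * _]gtr0_norm// normrM.
    have : k ^+ 2 * (`|2 * l x - 1| * `|l x ^+ 2 - l x|) <= k ^+ 2 * (1 * 1).
      by rewrite ler_pM2l// ler_pM.
    by rewrite /M; lra.
  + rewrite [X in X * _]gtr0_norm// normrM.
    have : k ^+ 3 * (`|6 * l x ^+ 2 - 6 * l x + 1| * `|l x ^+ 2 - l x|) <= k ^+ 3 * (1 * 1).
      by rewrite ler_pM2l// ler_pM.
    by rewrite /M; lra.
Qed.

End taylor_class.

(** * Lindeberg's central limit theorem *)

Section averaging.
Context (R : realType) d (T : measurableType d) (Q : probability T R).
Implicit Types (f g : R -> R) (xi : T -> R).

(** The operator by which an independent summand with the law of [xi] acts on a test function. *)
Definition avg xi f (x : R) : R := Ex Q (fun w => f (x + xi w)).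

Lemma measurable_comp_add xi f x : measurable_fun [set: T] xi ->
  measurable_fun [set: R] f -> measurable_fun [set: T] (fun w => f (x + xi w)).
Proof. by move=> mxi mf; apply: measurableT_comp => //; exact: measurable_funD. Qed.

Lemma rint_comp_add xi f x (C : R) : measurable_fun [set: T] xi ->
  measurable_fun [set: R] f -> (forall x, `|f x| <= C) ->
  rint Q (fun w => f (x + xi w)).
Proof.
move=> mxi mf fC; apply: (@rint_bounded _ _ _ _ _ C) => [|w]; last exact: fC.
exact: measurable_comp_add.
Qed.

Lemma measurable_avg xi f : measurable_fun [set: T] xi ->
  measurable_fun [set: R] f -> measurable_fun [set: R] (avg xi f).
Proof.
move=> mxi mf.
apply: (@measurable_Ex _ _ (R : measurableType _) T R Q (fun z => f (z.1 + xi z.2))).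
apply: measurableT_comp => //; apply: measurable_funD => //.
exact: measurableT_comp.
Qed.

Lemma avg_bounded xi f (C x : R) : measurable_fun [set: T] xi ->
  measurable_fun [set: R] f -> (forall x, `|f x| <= C) -> `|avg xi f x| <= C.
Proof.
by move=> mxi mf fC; apply: Ex_abs_le_cst => //; exact: measurable_comp_add.
Qed.

(** The Taylor inequality at the points [x + xi w] is integrated over [w]. The constants do not
    grow, so the class survives any number of averagings. *)
Lemma avg_taylor2 xi (K C : R) f f1 f2 : measurable_fun [set: T] xi ->
  taylor2 K C f f1 f2 -> taylor2 K C (avg xi f) (avg xi f1) (avg xi f2).
Proof.
move=> mxi [[mf mf1 mf2] b t].
have b0 x : `|f x| <= C by case: (b x).
have b1 x : `|f1 x| <= C by case: (b x).
have b2 x : `|f2 x| <= C by case: (b x).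
split.
- split; [exact: (measurable_avg mxi mf)|exact: (measurable_avg mxi mf1)|
    exact: (measurable_avg mxi mf2)].
- by move=> x; split; exact: avg_bounded.
move=> x h.
have i0 y := rint_comp_add y mxi mf b0.
have i1 y := rint_comp_add y mxi mf1 b1.
have i2 y := rint_comp_add y mxi mf2 b2.
have -> : avg xi f (x + h) - avg xi f x - avg xi f1 x * h - avg xi f2 x * h ^+ 2 =
    Ex Q (fun w => f (x + h + xi w) - f (x + xi w) - h * f1 (x + xi w)
                   - h ^+ 2 * f2 (x + xi w)).
  rewrite !ExB ?ExZ//; first by rewrite /avg; ring.
  - by exact: rintB.
  - by exact: rintZ.
  - by apply: rintB; [exact: rintB|exact: rintZ].
  - by exact: rintZ.
apply: Ex_abs_le_cst.
  by apply: rint_measurable; apply: rintB; [apply: rintB; [exact: rintB|]|]; exact: rintZ.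
move=> w; have := t (x + xi w) h; rewrite [x + xi w + h]addrAC.
by rewrite [f1 _ * _]mulrC [f2 _ * _]mulrC.
Qed.

(** The mean kills the linear term and the quadratic one sees only the variance, so two centred
    summands of equal variance act alike up to their [min23] errors. *)
Lemma avg_expansion xi (v K C : R) f f1 f2 (x : R) : taylor2 K C f f1 f2 ->
  rint Q xi -> rint Q (fun w => xi w ^+ 2) ->
  Ex Q xi = 0 -> Ex Q (fun w => xi w ^+ 2) = v ->
  `|avg xi f x - f x - f2 x * v| <= K * Ex Q (fun w => min23 (xi w)).
Proof.
move=> [[mf mf1 mf2] b t] rxi rxi2 E1 E2.
have mxi := rint_measurable rxi.
have b0 y : `|f y| <= C by case: (b y).
have i0 := rint_comp_add x mxi mf b0.
have -> : avg xi f x - f x - f2 x * v =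
    Ex Q (fun w => f (x + xi w) - f x - f1 x * xi w - f2 x * xi w ^+ 2).
  rewrite !ExB ?ExZ ?Ex_cst ?E1 ?E2 ?mulr0 ?subr0//; try exact: rintZ.
  - exact: rint_cst.
  - by apply: rintB => //; exact: rint_cst.
  - by apply: rintB; [apply: rintB => //; exact: rint_cst|exact: rintZ].
have rm : rint Q (fun w => min23 (xi w)).
  apply: (rint_dom _ _ rxi2); first exact: (measurableT_comp (@measurable_min23 R)).
  by move=> w; rewrite ger0_norm ?min23_ge0 ?min23_le_sqr.
rewrite -ExZ//; apply: Ex_abs_le.
- apply: rintB; last exact: rintZ.
  by apply: rintB; [apply: rintB => //; exact: rint_cst|exact: rintZ].
- exact: rintZ.
- by move=> w; exact: t.
Qed.

Lemma cvg_invsqrtn : (fun n => (Num.sqrt n%:R)^-1) @ \oo --> (0 : R).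
Proof.
have h : (fun n => Num.sqrt (n%:R^-1)) @ \oo --> (0 : R).
  rewrite -[X in _ --> X](@sqrtr0 R); apply: (continuous_cvg _ (@sqrt_continuous R 0)).
  by apply/gtr0_cvgV0; [exists 1%N => // n /= n0; rewrite ltr0n|exact: cvgr_idn].
by apply: cvg_trans h; apply: near_eq_cvg; near=> n; rewrite sqrtrV.
Unshelve. all: by end_near. Qed.

(* Lindeberg's condition for the triangular array of the [xi / sqrt n]. *)
Lemma lindeberg_cvg0 xi : measurable_fun [set: T] xi ->
  rint Q (fun w => xi w ^+ 2) ->
  (fun n => n%:R * Ex Q (fun w => min23 ((Num.sqrt n%:R)^-1 * xi w))) @ \oo --> (0 : R).
Proof.
move=> mxi r2.
have mu n : measurable_fun [set: T] (fun w => n%:R * min23 ((Num.sqrt n%:R)^-1 * xi w)).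
  apply: measurable_funM => //; apply: (measurableT_comp (@measurable_min23 R)).
  exact: measurable_funM.
(* The quadratic side of [min23] gives the dominating function; the cubic side gives the pointwise
   limit, with a factor 1 / sqrt n. *)
have ub (n : nat) w : `|n%:R * min23 ((Num.sqrt n%:R)^-1 * xi w)| <= xi w ^+ 2.
  rewrite ger0_norm ?mulr_ge0 ?min23_ge0//.
  apply: (@le_trans _ _ (n%:R * ((Num.sqrt n%:R)^-1 * xi w) ^+ 2)).
    by rewrite ler_wpM2l ?min23_le_sqr.
  rewrite exprMn exprVn sqr_sqrtr// mulrA.
  case: n => [|n]; first by rewrite mul0r mul0r sqr_ge0.
  by rewrite divff ?mul1r.
have cv w : (fun n => n%:R * min23 ((Num.sqrt n%:R)^-1 * xi w)) @ \oo --> (0 : R).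
  have sq : \forall n \near \oo, 0 <= n%:R * min23 ((Num.sqrt n%:R)^-1 * xi w) <=
      (Num.sqrt n%:R)^-1 * `|xi w| ^+ 3.
    near=> n; rewrite mulr_ge0 ?min23_ge0//=.
    have n0 : 0 < n%:R :> R by rewrite ltr0n; near: n; exact: nbhs_infty_gt.
    have s0 : 0 < Num.sqrt n%:R :> R by rewrite sqrtr_gt0.
    apply: (@le_trans _ _ (n%:R * `|(Num.sqrt n%:R)^-1 * xi w| ^+ 3)).
      by rewrite ler_wpM2l// /min23 ge_min lexx orbT.
    rewrite normrM gtr0_norm ?invr_gt0// exprMn mulrA ler_wpM2r ?exprn_ge0//.
    rewrite -[X in X * _](@sqr_sqrtr R n%:R)//.
    by rewrite exprVn [_ ^+ 3]exprSr invfM mulrA divff ?mul1r// expf_neq0// gt_eqF.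
  apply: (squeeze_cvgr sq).
  - exact: cvg_cst.
  - rewrite -[X in _ --> X](mul0r (`|xi w| ^+ 3)); apply: cvgM; last exact: cvg_cst.
    exact: cvg_invsqrtn.
have [|//||||_ _] := @dominated_convergence _ T R Q setT measurableT
  (fun n w => (n%:R * min23 ((Num.sqrt n%:R)^-1 * xi w))%:E) (cst 0%E)
  (fun w => (xi w ^+ 2)%:E).
- by move=> n; exact/measurable_EFinP.
- by apply: aeW => w _; apply: cvg_EFin; [near=> n|exact: cv].
- exact: r2.
- by apply: aeW => w n _; rewrite lee_fin.
rewrite integral0 => /fine_cvgP[_]; apply: cvg_trans; apply: near_eq_cvg.
near=> n; rewrite -ExZ//.
apply: (rint_dom _ _ (rintZ ((Num.sqrt n%:R)^-1 ^+ 2) r2)).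
  by apply: (measurableT_comp (@measurable_min23 R)); exact: measurable_funM.
by move=> w; rewrite ger0_norm ?min23_ge0// -exprMn min23_le_sqr.
Unshelve. all: by end_near. Qed.

End averaging.

(** * Averages against centred normal laws *)

Section normal_averaging.
Context (R : realType).
Local Notation N s := (normal_prob 0 s : probability (measurableTypeR R) R).

Definition navg (s : R) (f : R -> R) : R -> R := avg (N s) idfun f.

Lemma measurable_idR : measurable_fun [set: measurableTypeR R] (idfun : R -> R).
Proof. exact: measurable_id. Qed.

Lemma normal_rint_sqr (s : R) : 0 < s -> rint (N s) (fun x => x ^+ 2).
Proof.
move=> s0; apply/integrableP; split.
  by apply/measurable_EFinP; exact: measurable_funX.
under eq_integral do rewrite /= ger0_norm ?sqr_ge0//.
by rewrite normal_prob_sqr// ltry.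
Qed.

Lemma normal_rint_id (s : R) : 0 < s -> rint (N s) idfun.
Proof. by move=> s0; apply: rint_of_sqr (normal_rint_sqr s0); exact: measurable_idR. Qed.

Lemma normal_Ex_id (s : R) : 0 < s -> Ex (N s) idfun = 0.
Proof. by move=> s0; apply: EFin_inj; rewrite ExE ?normal_prob_mean//; exact: normal_rint_id. Qed.

Lemma normal_Ex_sqr (s : R) : 0 < s -> Ex (N s) (fun x => x ^+ 2) = s ^+ 2.
Proof.
by move=> s0; apply: EFin_inj; rewrite ExE ?normal_prob_sqr//; exact: normal_rint_sqr.
Qed.

Lemma normal_Ex_scale (s c : R) (f : R -> R) : 0 < s -> 0 < c ->
  measurable_fun [set: R] f -> (forall x, 0 <= f x) ->
  Ex (N (c * s)) f = Ex (N s) (fun x => f (c * x)).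
Proof.
move=> s0 c0 mf f0; rewrite /Ex /Rintegral ge0_normal_prob_scale//.
exact/measurable_EFinP.
Qed.

Lemma rint_navg (s x : R) (f : R -> R) (C : R) : measurable_fun [set: R] f ->
  (forall x, `|f x| <= C) -> rint (N s) (fun y => f (x + y)).
Proof.
by move=> mf fC; exact: (@rint_comp_add R _ (measurableTypeR R) (N s) idfun f x C measurable_idR mf fC).
Qed.

Lemma navg_convolution (s t x : R) (f : R -> R) : 0 < s -> 0 < t ->
  measurable_fun [set: R] f -> (forall x, 0 <= f x <= 1) ->
  navg s (navg t f) x = navg (Num.sqrt (s ^+ 2 + t ^+ 2)) f x.
Proof.
move=> s0 t0 mf f01.
have b y : `|f y| <= 1 by rewrite ger0_norm; case/andP: (f01 y).
have mfx : measurable_fun [set: R] (fun z => (f (x + z))%:E).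
  by apply/measurable_EFinP; apply: measurableT_comp => //; exact: measurable_funD.
have f0 z : (0 <= (f (x + z))%:E)%E by rewrite lee_fin; case/andP: (f01 (x + z)).
have step : (\int[N s]_y (Ex (N t) (fun z => f (x + y + z)))%:E =
    \int[normal_prob 0 (Num.sqrt (s ^+ 2 + t ^+ 2))]_u (f (x + u))%:E)%E.
  rewrite -(ge0_normal_prob_convolution s0 t0 mfx f0).
  apply: eq_integral => y _; rewrite ExE; last exact: (rint_navg t (x + y) mf b).
  by apply: eq_integral => z _; rewrite addrA.
exact: (congr1 fine step).
Qed.

(** The semigroup property of normal laws. Counting from one avoids the empty iteration, which would
    correspond to a zero deviation. *)
Lemma iter_navg (s : R) (f : R -> R) (k : nat) x : 0 < s ->
  measurable_fun [set: R] f -> (forall x, 0 <= f x <= 1) ->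
  iter k.+1 (navg s) f x = navg (Num.sqrt k.+1%:R * s) f x.
Proof.
move=> s0 mf f01.
elim: k x => [|k IH] x; first by rewrite sqrtr1 mul1r.
set t := Num.sqrt k.+1%:R * s; have t0 : 0 < t by rewrite mulr_gt0// sqrtr_gt0.
have <- : Num.sqrt (s ^+ 2 + t ^+ 2) = Num.sqrt k.+2%:R * s.
  rewrite /t exprMn sqr_sqrtr// -{1}[s ^+ 2]mul1r -mulrDl sqrtrM; last by rewrite addr_ge0.
  by rewrite sqrtr_sqr gtr0_norm// -(natrD _ 1) add1n.
rewrite -(navg_convolution x s0 t0 mf f01).
have -> : navg t f = iter k.+1 (navg s) f by apply/funext => y; rewrite IH.
by [].
Qed.

Lemma navg_taylor2 (s K C : R) (f f1 f2 : R -> R) : taylor2 K C f f1 f2 ->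
  taylor2 K C (navg s f) (navg s f1) (navg s f2).
Proof. exact: (@avg_taylor2 R _ (measurableTypeR R) (N s) idfun K C f f1 f2 measurable_idR). Qed.

Lemma measurable_navg (s : R) (f : R -> R) : measurable_fun [set: R] f ->
  measurable_fun [set: R] (navg s f).
Proof. exact: (@measurable_avg R _ (measurableTypeR R) (N s) idfun f measurable_idR). Qed.

Lemma navg_bounded (s C x : R) (f : R -> R) : measurable_fun [set: R] f ->
  (forall x, `|f x| <= C) -> `|navg s f x| <= C.
Proof. exact: (@avg_bounded R _ (measurableTypeR R) (N s) idfun f C x measurable_idR). Qed.

(** The deviation [s] and the scale [c] are kept apart so that this is an instance of the array in
    [lindeberg_cvg0], with a fixed variable and a shrinking factor. *)
Definition nmin23 (s c : R) : R := Ex (N s) (fun x => min23 (c * x)).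

Lemma navg_expansion (s c K C : R) (f f1 f2 : R -> R) (x : R) : 0 < s -> 0 < c ->
  taylor2 K C f f1 f2 ->
  `|navg (c * s) f x - f x - f2 x * (c * s) ^+ 2| <= K * nmin23 s c.
Proof.
move=> s0 c0 tf; have cs0 : 0 < c * s by rewrite mulr_gt0.
rewrite /nmin23 -(normal_Ex_scale s0 c0 (@measurable_min23 R) (@min23_ge0 R)).
exact: (@avg_expansion R _ (measurableTypeR R) (N (c * s)) idfun _ K C f f1 f2 x tf
  (normal_rint_id cs0) (normal_rint_sqr cs0) (normal_Ex_id cs0) (normal_Ex_sqr cs0)).
Qed.

Lemma nmin23_cvg0 (s : R) : 0 < s ->
  (fun n => n%:R * nmin23 s (Num.sqrt n%:R)^-1) @ \oo --> (0 : R).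
Proof.
move=> s0.
exact: (@lindeberg_cvg0 R _ (measurableTypeR R) (N s) idfun measurable_idR (normal_rint_sqr s0)).
Qed.

End normal_averaging.

(** * The replacement argument *)

Section lindeberg.
Context (R : realType) dS (S : measurableType dS) (Q : probability S R).
Context d (T : measurableType d) (P : probability T R).
Variables (psi : S -> R) (W : nat -> T -> S) (V : R).
Hypothesis mpsi : measurable_fun [set: S] psi.
Hypothesis mW : forall n, measurable_fun [set: T] (W n).
Hypothesis psi2 : rint Q (fun s => psi s ^+ 2).
Hypothesis psi_mean : Ex Q psi = 0.
Hypothesis psi_var : Ex Q (fun s => psi s ^+ 2) = V.
Hypothesis V0 : 0 < V.

Let psum (c : R) k (w : T) := \sum_(i < k) c * psi (W i w).

(** The only form in which independence is used: the next summand may be averaged out against its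
    own law. [psum_indep] supplies it. *)
Hypothesis indep : forall (c : R) k (g : R -> R), measurable_fun [set: R] g ->
  (forall x, `|g x| <= 1) ->
  Ex P (fun w => g (psum c k w + c * psi (W k w))) =
  Ex P (fun w => avg Q (fun s => c * psi s) g (psum c k w)).

Let rpsi : rint Q psi.
Proof. exact: rint_of_sqr. Qed.

Let mpsum c k : measurable_fun [set: T] (psum c k).
Proof.
apply: measurable_sum => i; apply: measurable_funM => //.
exact: measurableT_comp.
Qed.

(** Observations are exchanged for normal summands one at a time. The normal ones still to come are
    hidden in the test function, as iterates of [navg], so each exchange compares two averages of
    one function in the Taylor class. *)
Lemma lindeberg_swap (f f1 f2 : R -> R) (K C c : R) (n : nat) : (0 < n)%N ->
  (forall x, 0 <= f x <= 1) -> taylor2 K C f f1 f2 ->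
  c = (Num.sqrt n%:R)^-1 ->
  `|Ex P (fun w => f (psum c n w)) - navg (Num.sqrt V) f 0| <=
  K * (n%:R * Ex Q (fun x => min23 (c * psi x))
    + n%:R * nmin23 (Num.sqrt V) c).
Proof.
move=> n0 f01 tf cE; set s := Num.sqrt V.
have s0 : 0 < s by rewrite sqrtr_gt0.
have c0 : 0 < c by rewrite cE invr_gt0 sqrtr_gt0 ltr0n.
have cs0 : 0 < c * s by rewrite mulr_gt0.
have mf : measurable_fun [set: R] f by case: tf => -[].
set e := Ex Q _; set e' := nmin23 _ _.
have tg j : taylor2 K C (iter j (navg (c * s)) f) (iter j (navg (c * s)) f1)
    (iter j (navg (c * s)) f2).
  by elim: j => // j IH; exact: navg_taylor2.
have mg j : measurable_fun [set: R] (iter j (navg (c * s)) f).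
  by case: (tg j) => -[].
have bg j x : `|iter j (navg (c * s)) f x| <= 1.
  elim: j x => [x|j IH x]; first by rewrite ger0_norm; case/andP: (f01 x).
  by rewrite iterS; exact: (navg_bounded _ _ (mg j) IH).
(* The hybrid with [k] genuine summands and [n - k] normal ones. *)
pose a k := Ex P (fun w => iter (n - k) (navg (c * s)) f (psum c k w)).
have rcpsi : rint Q (fun x => c * psi x) by exact: rintZ.
have rcpsi2 : rint Q (fun x => (c * psi x) ^+ 2).
  have := rintZ (c ^+ 2) psi2; congr (rint Q _).
  by apply/funext => x; rewrite exprMn.
have step k : (k < n)%N -> `|a k.+1 - a k| <= K * (e + e').
  move=> kn; set g := iter (n - k.+1) (navg (c * s)) f.
  have -> : a k.+1 = Ex P (fun w => avg Q (fun s => c * psi s) g (psum c k w)).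
    rewrite -indep ?/g//; apply: eq_Ex => w.
    by congr (iter _ _ _ _); rewrite /psum big_ord_recr.
  have -> : a k = Ex P (fun w => navg (c * s) g (psum c k w)).
    by rewrite /a -(subnSK kn).
  have mcpsi : measurable_fun [set: S] (fun s => c * psi s) by exact: measurable_funM.
  have m1 := measurable_avg Q mcpsi (mg (n - k.+1)%N).
  have m2 : measurable_fun [set: R] (navg (c * s) g) := measurable_navg _ (mg _).
  have b1 x := @avg_bounded _ _ _ Q _ _ 1 x mcpsi (mg (n - k.+1)%N) (bg _).
  have b2 x : `|navg (c * s) g x| <= 1 := navg_bounded _ _ (mg _) (bg _).
  have r1 : rint P (fun w => avg Q (fun s => c * psi s) g (psum c k w)).
    by apply: (@rint_bounded _ _ _ _ _ 1) => [|w]; [exact: measurableT_comp|exact: b1].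
  have r2 : rint P (fun w => navg (c * s) g (psum c k w)).
    by apply: (@rint_bounded _ _ _ _ _ 1) => [|w];
      [exact: (measurableT_comp m2)|exact: b2].
  rewrite -ExB//; apply: Ex_abs_le_cst; first exact: (rint_measurable (rintB r1 r2)).
  move=> w; set x := psum c k w.
  have vE : Ex Q (fun s => (c * psi s) ^+ 2) = (c * s) ^+ 2.
    rewrite (eq_Ex _ (fun x => exprMn 2 c (psi x))) ExZ// psi_var.
    by rewrite exprMn sqr_sqrtr// ltW.
  have mE : Ex Q (fun s => c * psi s) = 0 by rewrite ExZ// psi_mean mulr0.
  have := avg_expansion x (tg (n - k.+1)%N) rcpsi rcpsi2 mE vE.
  have := navg_expansion x s0 c0 (tg (n - k.+1)%N).
  rewrite -/g -/e -/e' => H1 H2.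
  (* Both averages have the same value and second-order term, by equality of variances; only the two
     remainders are left. *)
  have -> : avg Q (fun s => c * psi s) g x - navg (c * s) g x =
    (avg Q (fun s => c * psi s) g x - g x - iter (n - k.+1) (navg (c * s)) f2 x * (c * s) ^+ 2)
    - (navg (c * s) g x - g x - iter (n - k.+1) (navg (c * s)) f2 x * (c * s) ^+ 2) by ring.
  by apply: (le_trans (ler_normB _ _)); rewrite mulrDr lerD.
have tele m : (m <= n)%N -> `|a m - a 0%N| <= m%:R * (K * (e + e')).
  elim: m => [_|m IH mn]; first by rewrite subrr normr0 mul0r.
  have -> : a m.+1 - a 0%N = (a m.+1 - a m) + (a m - a 0%N) by ring.
  apply: (le_trans (ler_normD _ _)); rewrite -natr1 mulrDl mul1r addrC lerD//.
    by apply: IH; exact: ltnW.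
  exact: step.
have -> : Ex P (fun w => f (psum c n w)) = a n by rewrite /a subnn.
have -> : navg s f 0 = a 0%N.
  rewrite /a subn0 -[RHS](_ : Ex P (fun=> iter n (navg (c * s)) f 0) = _); last first.
    by apply: eq_Ex => w; rewrite /psum big_ord0.
  (* The [n] normal summands of deviation [c * s] merge into one of deviation sqrt n * c * s = s. *)
  have it : iter n (navg (c * s)) f 0 = navg (Num.sqrt n%:R * (c * s)) f 0.
    by rewrite -(prednK n0); exact: iter_navg.
  rewrite Ex_cst it; congr (navg _ f 0).
  by rewrite cE mulrA divff ?mul1r// gt_eqF// sqrtr_gt0 ltr0n.
apply: (le_trans (tele n (leqnn n))).
by rewrite mulrCA mulrDr.
Qed.

Lemma clt_smooth (f f1 f2 : R -> R) (K C : R) :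
  (forall x, 0 <= f x <= 1) -> taylor2 K C f f1 f2 ->
  (fun n => Ex P (fun w => f (psum (Num.sqrt n%:R)^-1 n w))) @ \oo -->
    navg (Num.sqrt V) f 0.
Proof.
move=> f01 tf; have s0 : 0 < Num.sqrt V by rewrite sqrtr_gt0.
have L1 := lindeberg_cvg0 mpsi psi2.
have L2 := nmin23_cvg0 s0.
have L : (fun n => K * (n%:R * Ex Q (fun x => min23 ((Num.sqrt n%:R)^-1 * psi x))
    + n%:R * nmin23 (Num.sqrt V) (Num.sqrt n%:R)^-1)) @ \oo --> (0 : R).
  rewrite -(mulr0 K); apply: cvgM; first exact: cvg_cst.
  by rewrite -(addr0 0); exact: cvgD L1 L2.
apply/cvgrPdist_le => eps eps0.
move/cvgrPdist_le : L => /(_ _ eps0) L; near=> n.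
rewrite distrC; apply: (le_trans (lindeberg_swap _ f01 tf erefl)).
  by near: n; exact: nbhs_infty_gt.
have : `|0 - K * (n%:R * Ex Q (fun x => min23 ((Num.sqrt n%:R)^-1 * psi x))
    + n%:R * nmin23 (Num.sqrt V) (Num.sqrt n%:R)^-1)| <= eps by near: n.
by rewrite sub0r normrN; apply: le_trans; exact: ler_norm.
Unshelve. all: by end_near. Qed.

End lindeberg.

(** * Independent samples *)

Section cylinders.
Context d (S : measurableType d) (n : nat).

(** The sides are indexed by [nat], as in [mutually_independent]. *)
Definition cylinder : set (set (n.-tuple S)) :=
  [set C | exists2 B : nat -> set S, (forall j, measurable (B j)) &
     C = [set z | forall i : 'I_n, B i (tnth z i)]].

Lemma cylinder_setI : setI_closed cylinder.
Proof.
move=> _ _ [B mB ->] [C mC ->]; exists (fun j => B j `&` C j).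
  by move=> j; exact: measurableI.
by apply/seteqP; split => [z [h1 h2] i|z h]; split => //; move=> i; case: (h i).
Qed.

Lemma measurable_cylinder : (@measurable _ (n.-tuple S)) = <<s cylinder >>.
Proof.
apply/seteqP; split.
- apply: smallest_sub; first exact: smallest_sigma_algebra.
  move=> A; rewrite -bigcup_seq => -[i _ [B mB <-]].
  apply: sub_sigma_algebra; exists (fun j => if j == i :> nat then B else setT).
    by move=> j; case: ifP.
  apply/seteqP; split => [z [_ Bz] j|z h].
    by case: eqP => // /val_inj ->.
  by split => //; have := h i; rewrite eqxx.
- apply: smallest_sub; first exact: sigma_algebra_measurable.
  move=> _ [B mB ->].
  rewrite (_ : [set z | _] = \big[setI/setT]_(i < n) ((@tnth n S ^~ i) @^-1` B i)).
    apply: bigsetI_measurable => i _; apply: measurable_preimage => //.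
    exact: measurable_tnth.
  rewrite -bigcap_seq; apply/seteqP; split => [z h i _|z h i]; first exact: h.
  by apply: h; rewrite /= mem_index_enum.
Qed.

End cylinders.

Lemma eq_tuple_law d (S : measurableType d) n (R : realType)
    (m1 m2 : {measure set (n.-tuple S) -> \bar R}) :
  (m1 [set: _] < +oo)%E ->
  (forall C, cylinder C -> m1 C = m2 C) ->
  forall A, measurable A -> m1 A = m2 A.
Proof.
move=> m1oo m12 A mA.
apply: (@measure_unique _ R _ (@cylinder _ S n) (fun=> setT)) => //.
- exact: measurable_cylinder.
- exact: cylinder_setI.
- by move=> _; exists (fun=> setT) => //; apply/seteqP; split.
- by rewrite bigcup_const//; exists 0%N.
Qed.

Section iid.
Context (R : realType) d (T : measurableType d) (P : probability T R).
Context dS (S : measurableType dS) (Q : probability S R).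
Variable W : nat -> T -> S.
Hypothesis mW : forall i, measurable_fun [set: T] (W i).
Hypothesis indepW : mutually_independent P W.
Hypothesis lawW : forall i B, measurable B -> P (W i @^-1` B) = Q B.

Lemma measurable_sample n : measurable_fun [set: T] (sample W n).
Proof.
apply/measurable_fun_tnthP => i.
by rewrite (_ : _ \o _ = W i)//; apply/funext => w; rewrite /= tnth_mktuple.
Qed.

Section leave_one_out.
Variables (n : nat) (i : 'I_n) (s0 : S).

(** Overwriting entry [i] by a constant gives a function of the other observations that is still an
    [n]-tuple, so nothing has to be reindexed. *)
Definition loo_sample (w : T) : n.-tuple S :=
  [tuple if j == i then s0 else W j w | j < n].

Lemma measurable_loo_sample : measurable_fun [set: T] loo_sample.
Proof.
apply/measurable_fun_tnthP => j.
rewrite (_ : _ \o _ = if j == i then cst s0 else W j); first by case: ifP.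
by apply/funext => w; rewrite /= tnth_mktuple; case: ifP.
Qed.

(** Both sides are finite measures in [B], so it suffices to compare them on cylinders, where mutual
    independence applies. *)
Lemma loo_sample_indep B A : measurable B -> measurable A ->
  P (loo_sample @^-1` B `&` W i @^-1` A) = (P (loo_sample @^-1` B) * Q A)%E.
Proof.
move=> mB mA.
have mWA : measurable (W i @^-1` A) by exact: measurable_preimage.
have QAfin : Q A \is a fin_num by exact: fin_num_measure.
have QA0 : 0 <= fine (Q A) by rewrite fine_ge0.
pose m1 := measure_function_pushforward__canonical__measure_function_Measure
  (measure_function_mrestr__canonical__measure_function_Measure P mWA)
  measurable_loo_sample.
pose m2 := measure_function_pushforward__canonical__measure_function_Measure P
  measurable_loo_sample.
have <- : mscale (NngNum QA0) m2 B = (P (loo_sample @^-1` B) * Q A)%E.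
  by rewrite /mscale /= fineK// muleC.
rewrite -[LHS]/(m1 B); apply: eq_tuple_law mB.
  rewrite -[X in (X < _)%E]/(P (loo_sample @^-1` setT `&` W i @^-1` A)).
  rewrite (le_lt_trans (probability_le1 P _)) ?ltry//.
  by rewrite preimage_setT setTI.
move=> _ [C mC ->].
rewrite -[LHS]/(P (loo_sample @^-1` [set z | forall j : 'I_n, C j (tnth z j)] `&` W i @^-1` A)).
rewrite -[RHS]/((fine (Q A))%:E * P (loo_sample @^-1` [set z | forall j : 'I_n, C j (tnth z j)]))%E.
rewrite fineK//.
(* Entry [i] of [loo_sample] is constantly [s0]: if the side [C i] misses it both probabilities
   vanish, otherwise that side imposes nothing. *)
have [s0C|s0C] := pselect (C i s0); last first.
  rewrite (_ : loo_sample @^-1` _ = set0) ?set0I ?measure0 ?mule0//.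
  by apply/seteqP; split => // w /(_ i); rewrite tnth_mktuple eqxx.
(* The indices below [n] other than [i]; the event on observation [i] is then added as one more
   index. *)
pose J := [fset j in [seq j <- iota 0%N n | j != i :> nat]]%fset.
have JP (j : nat) : (j \in J) = (j < n)%N && (j != i).
  by rewrite !inE mem_filter mem_iota add0n andbC.
clearbody J.
have looE : loo_sample @^-1` [set z | forall j : 'I_n, C j (tnth z j)] =
    \bigcap_(j in [set` J]) W j @^-1` C j.
  apply/seteqP; split => [w h j /=|w h j].
    rewrite JP => /andP[jn ji]; have := h (Ordinal jn).
    by rewrite tnth_mktuple -val_eqE /= (negbTE ji).
  rewrite tnth_mktuple; case: eqP => [->//|/eqP ji].
  by apply: (h j); rewrite /= JP ltn_ord.
have iJ : val i \notin J by rewrite JP eqxx andbF.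
rewrite looE (indepW J mC).
pose C' j := if j == i :> nat then A else C j.
have -> : \bigcap_(j in [set` J]) W j @^-1` C j `&` W i @^-1` A =
    \bigcap_(j in [set` (val i |` J)%fset]) W j @^-1` C' j.
  apply/seteqP; split => [w [h1 h2] j /=|w h].
    rewrite !inE /C' => /orP[/eqP ->|jJ]; first by rewrite eqxx.
    have [->|ji] := eqVneq j (val i); first exact: h2.
    exact: (h1 j jJ).
  split => [j /= jJ|]; last first.
    by have := h (val i); rewrite /C' eqxx; apply; rewrite /= !inE eqxx.
  have := h j; rewrite /C' /= !inE jJ orbT => /(_ isT).
  have [ji|//] := eqVneq j (val i).
  by move: jJ iJ; rewrite ji => ->.
rewrite indepW; last by move=> j; rewrite /C'; case: ifP.
rewrite big_fsetU1//= {1}/C' eqxx lawW//; congr (_ * _)%E.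
rewrite !big_seq; apply: eq_bigr => j jJ; rewrite /C'.
have [ji|//] := eqVneq j (val i).
by move: jJ iJ; rewrite ji => ->.
Qed.

Lemma ge0_loo_integral (H : n.-tuple S * S -> \bar R) :
  measurable_fun [set: _] H -> (forall z, 0 <= H z)%E ->
  (\int[P]_w H (loo_sample w, W i w) = \int[P]_w \int[Q]_s H (loo_sample w, s))%E.
Proof.
move=> mH H0.
have mV : measurable_fun [set: T] (fun w => (loo_sample w, W i w)).
  by apply/measurable_fun_pair => //; exact: measurable_loo_sample.
pose L_mixin := isMeasurableFun.Build _ _ _ _ _ measurable_loo_sample.
pose L : {RV P >-> n.-tuple S} := HB.pack loo_sample L_mixin.
pose V_mixin := isMeasurableFun.Build _ _ _ _ _ mV.
pose V : {RV P >-> (n.-tuple S * S)%type} := HB.pack (fun w => (loo_sample w, W i w)) V_mixin.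
transitivity (\int[distribution P V]_z H z)%E.
  by rewrite ge0_integral_distribution.
transitivity (\int[(distribution P L \x Q)]_z H z)%E.
  apply: eq_measure_integral => A mA _; apply/esym.
  apply: product_measure_unique mA => B A' mB mA'.
  exact: loo_sample_indep.
rewrite fubini_tonelli1// ge0_integral_distribution//.
- exact: measurable_fun_fubini_tonelli_F.
- by move=> z; exact: integral_ge0.
Qed.

End leave_one_out.

(** Since [H] ignores entry [i] of the sample, the sample may be replaced by [loo_sample]. This is
    how conditioning on the remaining observations is carried out. *)
Lemma ge0_indep_integral n (i : 'I_n) (H : n.-tuple S * S -> \bar R) :
  measurable_fun [set: _] H -> (forall z, 0 <= H z)%E ->
  (forall z z' s, (forall j, j != i -> tnth z j = tnth z' j) -> H (z, s) = H (z', s)) ->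
  (\int[P]_w H (sample W n w, W i w) = \int[P]_w \int[Q]_s H (sample W n w, s))%E.
Proof.
move=> mH H0 Hi.
(* A point of [T] is needed to have some value of [S] to put in place of entry [i]. *)
have [w0 _] : [set: T] !=set0.
  apply/set0P/eqP => T0; have := probability_setT P; rewrite T0 measure0 => /eqP.
  by rewrite eqe eq_sym oner_eq0.
have E w s : H (sample W n w, s) = H (loo_sample i (W 0%N w0) w, s).
  by apply: Hi => j ji; rewrite !tnth_mktuple (negbTE ji).
under eq_integral do rewrite E.
rewrite (ge0_loo_integral i _ mH H0); apply: eq_integral => w _.
by apply: eq_integral => s _; rewrite E.
Qed.

(** The positive and negative parts have equal slice integrals, hence equal total integrals; joint
    integrability makes these finite, so that they cancel. *)
Lemma indep_Ex0 n (i : 'I_n) (H : n.-tuple S * S -> R) :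
  measurable_fun [set: _] H ->
  (forall z z' s, (forall j, j != i -> tnth z j = tnth z' j) -> H (z, s) = H (z', s)) ->
  rint P (fun w => H (sample W n w, W i w)) ->
  (forall z, rint Q (fun s => H (z, s))) ->
  (forall z, Ex Q (fun s => H (z, s)) = 0) ->
  Ex P (fun w => H (sample W n w, W i w)) = 0.
Proof.
move=> mH Hi rP rQ Q0.
pose Hp (z : n.-tuple S * S) : \bar R := (EFin \o H)^\+%E z.
pose Hn (z : n.-tuple S * S) : \bar R := (EFin \o H)^\-%E z.
have mEH : measurable_fun [set: n.-tuple S * S] (EFin \o H) by exact/measurable_EFinP.
have mHp : measurable_fun [set: n.-tuple S * S] Hp by exact: measurable_funepos.
have mHn : measurable_fun [set: n.-tuple S * S] Hn by exact: measurable_funeneg.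
have eqi z : (\int[Q]_s Hp (z, s) = \int[Q]_s Hn (z, s))%E.
  have : (\int[Q]_s (H (z, s))%:E = 0)%E by rewrite -ExE ?Q0//; exact: rQ.
  rewrite integralE => /eqP; rewrite sube_eq ?add0e//; last first.
    exact: (integrable_pos_fin_num measurableT (rQ z)).
  move=> /eqP; rewrite (eq_integral (fun s => Hp (z, s))); last first.
    by move=> s _; rewrite /Hp !funeposE.
  by rewrite [in X in _ = X -> _](eq_integral (fun s => Hn (z, s)))// => s _; rewrite /Hn !funenegE.
apply: EFin_inj; rewrite ExE// integralE.
rewrite (eq_integral (fun w => Hp (sample W n w, W i w))); last first.
  by move=> s _; rewrite /Hp !funeposE.
rewrite [X in (_ - X)%E](eq_integral (fun w => Hn (sample W n w, W i w))); last first.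
  by move=> s _; rewrite /Hn !funenegE.
have Hn0 z : (0 <= Hn z)%E by exact: funeneg_ge0.
rewrite (ge0_indep_integral (i := i) mHp); last 2 first.
- by move=> z; exact: funepos_ge0.
- by move=> z z' s zz'; rewrite /Hp !funeposE /= (Hi z z').
have nE : (\int[P]_w Hn (sample W n w, W i w) =
    \int[P]_w \int[Q]_s Hn (sample W n w, s))%E.
  rewrite (ge0_indep_integral (i := i) mHn)// => z z' s zz'.
  by rewrite /Hn !funenegE /= (Hi z z').
have -> : (\int[P]_w \int[Q]_s Hp (sample W n w, s) =
    \int[P]_w \int[Q]_s Hn (sample W n w, s))%E.
  by apply: eq_integral => w _; exact: eqi.
rewrite -nE subee//.
have := integrable_neg_fin_num measurableT rP; congr (_ \is a fin_num).
by apply: eq_integral => s _; rewrite /Hn !funenegE.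
Qed.

(** Observation [k] is the last of a sample of size [k.+1], and the partial sum does not involve
    it. *)
Lemma psum_indep (psi : S -> R) : measurable_fun [set: S] psi ->
  forall (c : R) k (g : R -> R), measurable_fun [set: R] g ->
  (forall x, `|g x| <= 1) ->
  Ex P (fun w => g (\sum_(j < k) c * psi (W j w) + c * psi (W k w))) =
  Ex P (fun w => Ex Q (fun s => g (\sum_(j < k) c * psi (W j w) + c * psi s))).
Proof.
move=> mpsi c k g mg g1.
pose i : 'I_k.+1 := ord_max.
pose ps (z : k.+1.-tuple S) : R := \sum_(j < k) c * psi (tnth z (widen_ord (leqnSn k) j)).
pose h (z : k.+1.-tuple S * S) : R := g (ps z.1 + c * psi z.2).
have mps : measurable_fun [set: k.+1.-tuple S] ps.
  apply: measurable_sum => j; apply: measurable_funM => //.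
  by apply: (measurableT_comp mpsi); exact: measurable_tnth.
have mh : measurable_fun [set: k.+1.-tuple S * S] h.
  apply: (measurableT_comp mg); apply: measurable_funD.
    exact: (measurableT_comp mps).
  by apply: measurable_funM => //; exact: (measurableT_comp mpsi).
have psE w : ps (sample W k.+1 w) = \sum_(j < k) c * psi (W j w).
  by apply: eq_bigr => j _; rewrite tnth_mktuple.
(* Adding 1 makes the bounded function nonnegative, as [ge0_indep_integral] requires. *)
pose H z := (h z + 1)%:E.
have H0 z : (0 <= H z)%E by rewrite lee_fin -lerBlDr sub0r; have := g1 (ps z.1 + c * psi z.2); rewrite ler_norml => /andP[].
have mH : measurable_fun [set: k.+1.-tuple S * S] H.
  by apply/measurable_EFinP; exact: measurable_funD.
have Hi z z' s : (forall j, j != i -> tnth z j = tnth z' j) -> H (z, s) = H (z', s).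
  move=> zz'; rewrite /H /h /=; congr (g (_ + _) + 1)%:E; apply: eq_bigr => j _.
  by rewrite zz'// -val_eqE /= ltn_eqF.
have E := ge0_indep_integral mH H0 Hi.
have r1 z : rint Q (fun s => h (z, s)).
  apply: (@rint_bounded _ _ _ _ _ 1) => [|s]; last exact: g1.
  by apply: (measurableT_comp mh); exact: measurable_pair1.
have b2 z : `|Ex Q (fun s => h (z, s))| <= 1.
  by apply: Ex_abs_le_cst => [|s]; [exact: (rint_measurable (r1 z))|exact: g1].
have mS : measurable_fun [set: T] (sample W k.+1) by exact: measurable_sample.
have r2 : rint P (fun w => Ex Q (fun s => h (sample W k.+1 w, s))).
  apply: (@rint_bounded _ _ _ _ _ 1) => [|w]; last exact: b2.
  apply: (measurableT_comp (f := fun z => Ex Q (fun s => h (z, s)))) => //.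
  exact: measurable_Ex.
have r3 : rint P (fun w => h (sample W k.+1 w, W k w)).
  apply: (@rint_bounded _ _ _ _ _ 1) => [|w]; last exact: g1.
  by apply: (measurableT_comp mh); exact/measurable_fun_pair.
transitivity (Ex P (fun w => h (sample W k.+1 w, W k w))).
  by apply: eq_Ex => w; rewrite /h /= psE.
transitivity (Ex P (fun w => Ex Q (fun s => h (sample W k.+1 w, s)))); last first.
  by apply: eq_Ex => w; apply: eq_Ex => s; rewrite /h /= psE.
suff : Ex P (fun w => h (sample W k.+1 w, W k w) + 1) =
    Ex P (fun w => Ex Q (fun s => h (sample W k.+1 w, s)) + 1).
  by rewrite !ExD ?Ex_cst//; [move/addIr|exact: rint_cst..].
apply: EFin_inj; rewrite !ExE; last 2 first.
- by apply: rintD => //; exact: rint_cst.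
- by apply: rintD => //; exact: rint_cst.
rewrite E; apply: eq_integral => w _.
by rewrite -[1 in RHS](Ex_cst Q 1) -ExD ?ExE//; try exact: rint_cst; apply: rintD => //; exact: rint_cst.
Qed.

End iid.

(** * Cross-fitted remainders *)

Section fold_remainder.
Context (R : realType) d (T : measurableType d) (P : probability T R).
Context dS (S : measurableType dS) (Q : probability S R).
Variable W : nat -> T -> S.
Hypothesis mW : forall i, measurable_fun [set: T] (W i).
Hypothesis indepW : mutually_independent P W.
Hypothesis lawW : forall i B, measurable B -> P (W i @^-1` B) = Q B.

Section fixed_fold.
Variables (n : nat) (I : {pred 'I_n}) (D : n.-tuple S * S -> R).
Variables (G : set (n.-tuple S)) (eps : R).
Hypothesis n0 : (0 < n)%N.
Hypothesis mD : measurable_fun [set: _] D.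
Hypothesis mG : measurable G.
Hypothesis DI : forall z z', (forall i, i \notin I -> tnth z i = tnth z' i) ->
  (G z <-> G z') /\ forall s, D (z, s) = D (z', s).
Hypothesis eps0 : 0 <= eps.
Hypothesis rD : forall z, G z -> rint Q (fun s => D (z, s) ^+ 2).
Hypothesis D2 : forall z, G z -> Ex Q (fun s => D (z, s) ^+ 2) <= eps.

Let b z := Ex Q (fun s => D (z, s)).
(** The indicator makes the moment bounds valid for every training sample. As [G] depends only on
    entries outside [I], the variable stays centred given those entries. *)
Let Y (zs : n.-tuple S * S) : R := \1_G zs.1 * (D zs - b zs.1).
Let U (i : 'I_n) z := Y (z, tnth z i).

Definition fold_sum (z : n.-tuple S) : R :=
  (Num.sqrt n%:R)^-1 * \sum_(i | i \in I) (D (z, tnth z i) - b z).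

Let mb : measurable_fun [set: n.-tuple S] b.
Proof. exact: measurable_Ex. Qed.

Let mY : measurable_fun [set: n.-tuple S * S] Y.
Proof.
have m1 : measurable_fun [set: n.-tuple S] (\1_G : _ -> R) by exact: measurable_indic.
apply: measurable_funM; first exact: (measurableT_comp m1).
apply: measurable_funB => //; exact: (measurableT_comp mb).
Qed.

Let mU i : measurable_fun [set: n.-tuple S] (U i).
Proof.
apply: (measurableT_comp mY); apply/measurable_fun_pair => //.
exact: measurable_tnth.
Qed.

Let rDz z : G z -> rint Q (fun s => D (z, s)).
Proof.
move=> Gz; apply: rint_of_sqr (rD Gz).
by apply: (measurableT_comp mD); exact: measurable_pair1.
Qed.

Let rYz z : rint Q (fun s => Y (z, s)).
Proof.
have [Gz|Gz] := pselect (G z).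
  by rewrite /Y /=; apply: rintZ; apply: rintB; [exact: rDz|exact: rint_cst].
rewrite (_ : (fun s => _) = fun=> 0); first exact: rint_cst.
by apply/funext => s; rewrite /Y /= indicE memNset// mul0r.
Qed.

Let Y0 z : Ex Q (fun s => Y (z, s)) = 0.
Proof.
have [Gz|Gz] := pselect (G z).
  rewrite /Y /= ExZ; last by apply: rintB; [exact: rDz|exact: rint_cst].
  by rewrite ExB ?Ex_cst ?subrr ?mulr0//; [exact: rDz|exact: rint_cst].
rewrite -[RHS](Ex_cst Q 0); apply: eq_Ex => s.
by rewrite /Y /= indicE memNset// mul0r.
Qed.

Let rY2 z : rint Q (fun s => Y (z, s) ^+ 2).
Proof.
have [Gz|Gz] := pselect (G z).
  apply: (rint_dom _ _ (rintD (rintZ 2 (rD Gz)) (rint_cst Q (2 * b z ^+ 2)))).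
    by apply: measurable_funX; exact: rint_measurable (rYz z).
  move=> s; rewrite ger0_norm ?sqr_ge0// /Y /= indicE mem_set// mul1r.
  by have := sqr_ge0 (D (z, s) + b z); lra.
rewrite (_ : (fun s => _) = fun=> 0); first exact: rint_cst.
by apply/funext => s; rewrite /Y /= indicE memNset// mul0r expr0n.
Qed.

Let ExY2 z : Ex Q (fun s => Y (z, s) ^+ 2) <= eps.
Proof.
have [Gz|Gz] := pselect (G z); last first.
  rewrite (_ : (fun s => _) = fun=> 0); first by rewrite Ex_cst.
  by apply/funext => s; rewrite /Y /= indicE memNset// mul0r expr0n.
apply: le_trans (D2 Gz).
rewrite (eq_Ex _ (g := fun s => D (z, s) ^+ 2 - (2 * b z) * D (z, s) + b z ^+ 2)); last first.
  by move=> s; rewrite /Y /= indicE mem_set// mul1r; ring.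
rewrite ExD; last 2 first.
- by apply: rintB; [exact: rD|apply: rintZ; exact: rDz].
- exact: rint_cst.
rewrite ExB; [|exact: rD|by apply: rintZ; exact: rDz].
rewrite ExZ ?Ex_cst; last exact: rDz.
by rewrite -/(b z); have := sqr_ge0 (b z); nra.
Qed.

Let YI z z' s i : i \in I -> (forall j, j != i -> tnth z j = tnth z' j) ->
  Y (z, s) = Y (z', s).
Proof.
move=> iI zz'.
have [GG DD] : (G z <-> G z') /\ forall s, D (z, s) = D (z', s).
  by apply: DI => j jI; apply: zz'; apply: contraNneq jI => ->.
rewrite /Y /= DD /b (eq_Ex _ DD) !indicE; congr ((_ : bool)%:R * _).
by apply/idP/idP; rewrite !inE => /GG.
Qed.

Let rU2 i : i \in I ->
  rint P (fun w => U i (sample W n w) ^+ 2) /\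
  Ex P (fun w => U i (sample W n w) ^+ 2) <= eps.
Proof.
move=> iI.
have mY2 : measurable_fun [set: n.-tuple S * S] (fun zs => (Y zs ^+ 2)%:E).
  by apply/measurable_EFinP; exact: measurable_funX.
have H0 zs : (0 <= (Y zs ^+ 2)%:E)%E by rewrite lee_fin sqr_ge0.
have H1 z z' s : (forall j, j != i -> tnth z j = tnth z' j) ->
    (Y (z, s) ^+ 2)%:E = (Y (z', s) ^+ 2)%:E by move=> /(YI s iI) ->.
have E := ge0_indep_integral mW indepW lawW mY2 H0 H1.
have le : (\int[P]_w (U i (sample W n w) ^+ 2)%:E <= eps%:E)%E.
  rewrite (eq_integral (fun w => (Y (sample W n w, W i w) ^+ 2)%:E)); last first.
    by move=> w _; rewrite /U tnth_mktuple.
  rewrite E; apply: (@le_trans _ _ (\int[P]_w eps%:E)%E); last first.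
    by rewrite integral_cst// [X in (_ * X)%E](_ : _ = 1%E) ?mule1//; exact: probability_setT.
  apply: ge0_le_integral => //.
  - by move=> w _; apply: integral_ge0 => s _.
  - have mF := measurable_fun_fubini_tonelli_F (m2 := Q) _ mY2 H0.
    by apply: (measurableT_comp mF); exact: measurable_sample.
  - move=> w _; have rY2w := rY2 (sample W n w).
    by rewrite -(ExE rY2w) lee_fin ExY2.
have r : rint P (fun w => U i (sample W n w) ^+ 2).
  apply/integrableP; split.
    apply/measurable_EFinP; apply: measurable_funX.
    by apply: (measurableT_comp (mU i)); exact: measurable_sample.
  under eq_integral do rewrite /= ger0_norm ?sqr_ge0//.
  by rewrite (le_lt_trans le)// ltry.
by split => //; rewrite -lee_fin ExE.
Qed.

Let mUs i : measurable_fun [set: T] (fun w => U i (sample W n w)).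
Proof. by apply: (measurableT_comp (mU i)); exact: measurable_sample. Qed.

Let rUU i j : i \in I -> j \in I ->
  rint P (fun w => U i (sample W n w) * U j (sample W n w)).
Proof.
move=> iI jI; apply: (rint_dom _ _ (rintD (rU2 iI).1 (rU2 jI).1)).
  exact: measurable_funM.
by move=> w; rewrite ler_norml; apply/andP; split; nra.
Qed.

(** Once observation [i] is singled out, the term of [j] is fixed: it depends on observation [j] and
    on entries outside [I]. The term of [i] is then centred. *)
Let ExUU i j : i \in I -> j \in I -> i != j ->
  Ex P (fun w => U i (sample W n w) * U j (sample W n w)) = 0.
Proof.
move=> iI jI ij.
pose H (zs : n.-tuple S * S) := U j zs.1 * Y zs.
have HE w : U i (sample W n w) * U j (sample W n w) = H (sample W n w, W i w).
  by rewrite /H /= mulrC [U i _]/U tnth_mktuple.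
rewrite (eq_Ex _ HE); apply: (@indep_Ex0 _ _ _ P _ _ Q W mW indepW lawW n i H).
- by apply: measurable_funM => //; exact: (measurableT_comp (mU j)).
- move=> z z' s zz'; rewrite /H /= (YI s iI zz') /U.
  by rewrite (YI (tnth z j) iI zz') (zz' j)// eq_sym.
- by rewrite -(funext HE); exact: rUU.
- by move=> z; rewrite /H /=; apply: rintZ; exact: rYz.
- by move=> z; rewrite /H /= ExZ ?Y0 ?mulr0//; exact: rYz.
Qed.

(** Only the diagonal survives, with at most [n] terms of size at most [eps]; the factor 1 / n
    absorbs their number. *)
Lemma fold_sum_sqr :
  rint P (fun w => (\1_G (sample W n w) * fold_sum (sample W n w)) ^+ 2) /\
  Ex P (fun w => (\1_G (sample W n w) * fold_sum (sample W n w)) ^+ 2) <= eps.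
Proof.
have n0' : 0 < n%:R :> R by rewrite ltr0n.
have E w : (\1_G (sample W n w) * fold_sum (sample W n w)) ^+ 2 =
    n%:R^-1 * \sum_(i | i \in I) \sum_(j | j \in I)
      U i (sample W n w) * U j (sample W n w).
  rewrite /fold_sum mulrCA mulr_sumr exprMn exprVn sqr_sqrtr ?ltW//.
  by rewrite expr2 mulr_suml; congr (_ * _); apply: eq_bigr => i _; rewrite mulr_sumr.
have rs i : i \in I -> rint P (fun w => \sum_(j | j \in I)
      U i (sample W n w) * U j (sample W n w)).
  by move=> iI; apply: rint_sum => j jI; exact: rUU.
have rss : rint P (fun w => \sum_(i | i \in I) \sum_(j | j \in I)
      U i (sample W n w) * U j (sample W n w)) by exact: rint_sum.
rewrite (funext E); split; first exact: rintZ.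
rewrite ExZ// Ex_sum// ler_pdivrMl//.
apply: (@le_trans _ _ (\sum_(i | i \in I) eps)); last first.
  rewrite sumr_const -[leLHS]mulr_natl ler_wpM2r// ler_nat.
  by rewrite (leq_trans (max_card _))// card_ord.
apply: ler_sum => i iI; rewrite Ex_sum => [|j jI]; last exact: rUU.
rewrite (bigD1 i)//= big1 ?addr0 => [|j /andP[jI ji]].
  by rewrite -(eq_Ex _ (fun w => expr2 (U i (sample W n w)))); exact: (rU2 iI).2.
by rewrite ExUU// eq_sym.
Qed.

Lemma fold_sum_chebyshev (eta : R) : 0 < eta ->
  (P (sample W n @^-1` (G `&` [set z | (eta < `|fold_sum z|)%R])) <= (eps / eta ^+ 2)%:E)%E.
Proof.
move=> eta0; have [r le] := fold_sum_sqr.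
have mfs : measurable_fun [set: n.-tuple S] fold_sum.
  apply: measurable_funM => //.
  rewrite (_ : (fun z => _) = fun z => \sum_(i < n)
      if i \in I then D (z, tnth z i) - b z else 0); last first.
    by apply/funext => z; rewrite big_mkcond.
  apply: measurable_sum => i; have [iI|//] := boolP (i \in I).
  apply: measurable_funB => //; apply: (measurableT_comp mD).
  by apply/measurable_fun_pair => //; exact: measurable_tnth.
have mA : measurable (G `&` [set z | (eta < `|fold_sum z|)%R]).
  by apply: measurableI => //; exact: measurable_abs_gt.
have mSA : measurable (sample W n @^-1` (G `&` [set z | (eta < `|fold_sum z|)%R])).
  by apply: measurable_preimage => //; exact: measurable_sample.
have eta20 : 0 < eta ^+ 2 by rewrite exprn_gt0.
rewrite -[X in P X]setIT -integral_indic//.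
apply: (@le_trans _ _ (\int[P]_w ((eta ^+ 2)^-1 *
    (\1_G (sample W n w) * fold_sum (sample W n w)) ^+ 2)%:E)%E); last first.
  rewrite -ExE; last exact: rintZ.
  rewrite (ExZ _ r) lee_fin [leRHS]mulrC.
  by apply: ler_wpM2l => //; rewrite invr_ge0 ltW.
apply: ge0_le_integral => //.
- by apply/measurable_EFinP; exact: measurable_indic.
- exact/measurable_EFinP/(rint_measurable (rintZ _ r)).
- move=> w _; rewrite lee_fin indicE; case: (boolP (_ \in _)) => [|_]; last first.
    by rewrite mulr_ge0 ?sqr_ge0 ?invr_ge0 ?ltW.
  rewrite inE => -[Gw h]; rewrite indicE mem_set// mul1r ler_pdivlMl// mulr1.
  by rewrite -[leRHS]real_normK ?num_real// lerXn2r ?nnegrE ?ltW// (lt_trans eta0).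
Qed.

End fixed_fold.
End fold_remainder.

(** * Probabilities tending to zero and union bounds *)

Section ereal_cvg0.
Context (R : realType).

Lemma ereal_cvg0 (u : nat -> \bar R) : (forall n, 0 <= u n)%E ->
  (forall e : R, 0 < e -> \forall n \near \oo, (u n <= e%:E)%E) -> u @ \oo --> 0%E.
Proof.
move=> u0 ue; apply/fine_cvgP; split.
  near=> n; rewrite ge0_fin_numE//; apply: (@le_lt_trans _ _ 1%:E); last exact: ltry.
  by near: n; exact: ue.
apply/cvgrPdist_le => e e0; near=> n; rewrite sub0r normrN /=.
have un : (u n <= e%:E)%E by near: n; exact: ue.
have uf : u n \is a fin_num by rewrite ge0_fin_numE// (le_lt_trans un)// ltry.
by rewrite ger0_norm ?fine_ge0// -lee_fin fineK.
Unshelve. all: by end_near. Qed.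

Lemma ereal_cvg0_near (u : nat -> \bar R) (e : R) : u @ \oo --> 0%E -> 0 < e ->
  \forall n \near \oo, (u n <= e%:E)%E.
Proof.
move=> /fine_cvgP[uf /cvgrPdist_le u0] e0.
have {}u0 := u0 _ e0; near=> n.
have ufn : u n \is a fin_num by near: n.
have : `|0 - fine (u n)| <= e by near: n.
rewrite sub0r normrN => /(le_trans (ler_norm _)); rewrite -lee_fin fineK//.
Unshelve. all: by end_near. Qed.

End ereal_cvg0.

Section union_bound.
Context (R : realType) d (T : measurableType d) (P : probability T R).

Lemma le_measure_sum (I : finType) (A B : set T) (C : I -> set T) :
  measurable A -> measurable B -> (forall i, measurable (C i)) ->
  (forall w, A w -> B w \/ exists i, C i w) ->
  (P A <= P B + \sum_i P (C i))%E.
Proof.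
move=> mA mB mC ABC.
have PE (E : set T) : measurable E -> P E = (\int[P]_w (\1_E w)%:E)%E.
  by move=> mE; rewrite integral_indic// setIT.
have mi (E : set T) : measurable E -> measurable_fun [set: T] (fun w => (\1_E w : R)%:E).
  by move=> mE; apply/measurable_EFinP; exact: measurable_indic.
rewrite (PE A)// (PE B)// (eq_bigr (fun i => (\int[P]_w (\1_(C i) w)%:E)%E)); last first.
  by move=> i _; exact: PE.
rewrite -ge0_integral_sum//; last first.
- by move=> i; exact: mi.
rewrite -ge0_integralD//; last 3 first.
- exact: mi.
- by move=> w _; apply: sume_ge0 => i _; rewrite lee_fin.
- by apply: emeasurable_sum => i; exact: mi.
apply: ge0_le_integral => //.
- exact: mi.
- apply: emeasurable_funD; first exact: mi.
  by apply: emeasurable_sum => i; exact: mi.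
move=> w _; rewrite sumEFin -EFinD lee_fin indicE.
have s0 : 0 <= \sum_i \1_(C i) w :> R by apply: sumr_ge0.
have b0 : 0 <= \1_B w :> R by [].
case: (boolP (w \in A)) => [|_]; last by rewrite addr_ge0.
rewrite inE => /ABC[Bw|[i Ci]]; first by rewrite [\1_B w]indicE mem_set//= lerDl.
rewrite (bigD1 i)//= [\1_(C i) w]indicE mem_set//= addrCA lerDl addr_ge0// sumr_ge0//.
Qed.

Lemma sum_probability_fibers (I : finType) (F : T -> I) :
  (forall i, measurable [set w | F w = i]) ->
  (\sum_i P [set w | F w = i] = 1)%E.
Proof.
move=> mF.
rewrite (eq_bigr (fun i => (\int[P]_w (\1_[set w | F w = i] w)%:E)%E)); last first.
  by move=> i _; rewrite integral_indic// setIT.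
rewrite -ge0_integral_sum//; last first.
- by move=> i; apply/measurable_EFinP; exact: measurable_indic.
rewrite -[RHS](probability_setT P) -[X in P X](setIT setT) -integral_indic//.
apply: eq_integral => w _; rewrite sumEFin (bigD1 (F w))//= big1 ?addr0.
  by rewrite !indicE !mem_set.
by move=> i iF; rewrite indicE memNset//= => /eqP; rewrite eq_sym (negbTE iF).
Qed.

End union_bound.

Section cross_fitted_remainder.
Context (R : realType) d (T : measurableType d) (P : probability T R).
Context dS (S : measurableType dS) (Q : probability S R).
Variable W : nat -> T -> S.
Hypothesis mW : forall i, measurable_fun [set: T] (W i).
Hypothesis indepW : mutually_independent P W.
Hypothesis lawW : forall i B, measurable B -> P (W i @^-1` B) = Q B.
Variables (L : nat) (F : forall n, T -> {ffun 'I_n -> 'I_L}).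
Hypothesis mF : forall n (f : {ffun 'I_n -> 'I_L}), measurable [set w | F n w = f].
Hypothesis indepF : forall n (f : {ffun 'I_n -> 'I_L}) (B : set (n.-tuple S)),
  measurable B ->
  P ([set w | F n w = f] `&` sample W n @^-1` B) =
  (P [set w | F n w = f] * P (sample W n @^-1` B))%E.
Variables (l : 'I_L) (D : forall n, {ffun 'I_n -> 'I_L} -> n.-tuple S * S -> R).
Hypothesis mD : forall n f, measurable_fun [set: n.-tuple S * S] (@D n f).
Hypothesis DI : forall n (f : {ffun 'I_n -> 'I_L}) z z',
  (forall i, f i != l -> tnth z i = tnth z' i) ->
  forall s, D f (z, s) = D f (z', s).

Definition fold_remainder n w : R := (Num.sqrt n%:R)^-1 *
  \sum_(i < n | F n w i == l) D (F n w) (sample W n w, W i w).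

(** The fold assignment takes finitely many values on measurable events, so a quantity depending on
    it is a finite sum of pieces with a fixed assignment. *)
Lemma measurable_by_fibers n (g : {ffun 'I_n -> 'I_L} -> T -> R) :
  (forall f, measurable_fun [set: T] (g f)) ->
  measurable_fun [set: T] (fun w => g (F n w) w).
Proof.
move=> mg; rewrite (_ : (fun w => _) =
    fun w => \sum_(f : {ffun 'I_n -> 'I_L}) \1_[set w | F n w = f] w * g f w).
  by apply: measurable_sum => f; apply: measurable_funM => //; exact: measurable_indic.
apply/funext => w; rewrite (bigD1 (F n w))//= big1 ?addr0.
  by rewrite indicE mem_set//= mul1r.
by move=> f fF; rewrite indicE memNset ?mul0r//= => /eqP; rewrite eq_sym (negbTE fF).
Qed.

Lemma measurable_fitted_set n (A : {ffun 'I_n -> 'I_L} -> set (n.-tuple S)) :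
  (forall f, measurable (A f)) -> measurable [set w | A (F n w) (sample W n w)].
Proof.
move=> mA; rewrite (_ : [set w | _] =
    (fun w => \1_(A (F n w)) (sample W n w) : R) @^-1` [set 1]); last first.
  apply/seteqP; split => w /=; rewrite indicE; first by move=> Aw; rewrite mem_set.
  by case: (boolP (_ \in _)) => [|_ /eqP]; [rewrite inE|rewrite eq_sym oner_eq0].
apply: measurable_preimage => //.
apply: (@measurable_by_fibers n (fun f w => \1_(A f) (sample W n w))) => f.
have m1 : measurable_fun [set: n.-tuple S] (\1_(A f) : _ -> R) by exact: measurable_indic.
by apply: (measurableT_comp m1); exact: measurable_sample.
Qed.

Lemma measurable_fold_remainder n : measurable_fun [set: T] (fold_remainder n).
Proof.
apply: measurable_funM => //.
apply: (@measurable_by_fibers n (fun f w => \sum_(i < n | f i == l) D f (sample W n w, W i w))) => f.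
rewrite (_ : (fun w => _) = fun w => \sum_(i < n)
    if f i == l then D f (sample W n w, W i w) else 0); last first.
  by apply/funext => z; rewrite big_mkcond.
apply: measurable_sum => i; have [_|//] := eqVneq (f i) l.
apply: (measurableT_comp (@mD n f)); apply/measurable_fun_pair => //.
exact: measurable_sample.
Qed.

(** The sets [G n f] collect the good training samples. Their complement costs a vanishing
    probability; on them the remainder is a centred sum, handled by Chebyshev, plus a drift.
    Independence of folds and data lets the bound for a fixed assignment be averaged over all
    assignments. *)
Lemma fold_remainder_negligible :
  (forall eps : R, 0 < eps -> exists G : forall n, {ffun 'I_n -> 'I_L} -> set (n.-tuple S),
    [/\ forall n f, measurable (G n f),
        forall n (f : {ffun 'I_n -> 'I_L}) z z',
          (forall i, f i != l -> tnth z i = tnth z' i) -> G n f z -> G n f z',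
        forall n f z, (0 < n)%N -> G n f z ->
          [/\ rint Q (fun s => D f (z, s) ^+ 2),
             Ex Q (fun s => D f (z, s) ^+ 2) <= eps &
             `|Ex Q (fun s => D f (z, s))| <= eps / Num.sqrt n%:R] &
        P [set w | ~ G n (F n w) (sample W n w)] @[n --> \oo] --> 0%E]) ->
  forall eta : R, 0 < eta ->
    P [set w | eta < `|fold_remainder n w|] @[n --> \oo] --> 0%E.
Proof.
move=> H eta eta0; apply: ereal_cvg0 => // e e0.
pose h := eta / 2; have h0 : 0 < h by rewrite divr_gt0.
(* The first bound keeps the drift below [h], the second makes Chebyshev's bound eps / h^2 at most e
   / 2. *)
pose eps := Num.min h (e / 2 * h ^+ 2).
have eps0 : 0 < eps by rewrite lt_min h0 mulr_gt0 ?divr_gt0 ?exprn_gt0.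
have [G [mG GI HG badG]] := H _ eps0.
have e20 : 0 < e / 2 by rewrite divr_gt0.
have bad := ereal_cvg0_near badG e20.
near=> n.
have n0 : (0 < n)%N by near: n; exact: nbhs_infty_gt.
have badn : (P [set w | ~ G n (F n w) (sample W n w)] <= (e / 2)%:E)%E by near: n.
have sn0 : 0 < Num.sqrt n%:R :> R by rewrite sqrtr_gt0 ltr0n.
pose fs (f : {ffun 'I_n -> 'I_L}) := @fold_sum R _ _ Q n [pred i | f i == l] (@D n f).
pose C (f : {ffun 'I_n -> 'I_L}) := sample W n @^-1` (G n f `&` [set z | h < `|fs f z|]).
have mfs f : measurable_fun [set: n.-tuple S] (fs f).
  apply: measurable_funM => //.
  rewrite (_ : (fun z => _) = fun z => \sum_(i < n)
      if f i == l then D f (z, tnth z i) - Ex Q (fun s => D f (z, s)) else 0); last first.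
    by apply/funext => z; rewrite big_mkcond.
  apply: measurable_sum => i; have [_|//] := eqVneq (f i) l.
  apply: measurable_funB; last exact: (measurable_Ex Q (@mD n f)).
  apply: (measurableT_comp (@mD n f)); apply/measurable_fun_pair => //.
  exact: measurable_tnth.
have mGh f : measurable (G n f `&` [set z | h < `|fs f z|]).
  by apply: measurableI => //; exact: measurable_abs_gt.
have PC f : (P (C f) <= (e / 2)%:E)%E.
  apply: (@le_trans _ _ (eps / h ^+ 2)%:E).
    apply: (@fold_sum_chebyshev R _ T P _ S Q W mW indepW lawW n [pred i | f i == l]
      (@D n f) (G n f) eps n0 (@mD n f) (mG n f)) => //.
    - move=> z z' zz'; split; last exact: DI.
      by split; apply: GI => i fi; [|symmetry]; exact: zz'.
    - exact: ltW.
    - by move=> z Gz; case: (HG n f z n0 Gz).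
    - by move=> z Gz; case: (HG n f z n0 Gz).
  by rewrite lee_fin ler_pdivrMr ?exprn_gt0// /eps ge_min lexx orbT.
have mbad : measurable [set w | ~ G n (F n w) (sample W n w)].
  by apply: (@measurable_fitted_set n (fun f => ~` G n f)) => f; apply: measurableC; exact: mG.
have mA : measurable [set w | eta < `|fold_remainder n w|].
  by apply: measurable_abs_gt; exact: measurable_fold_remainder.
apply: (@le_trans _ _ (P [set w | ~ G n (F n w) (sample W n w)] +
  \sum_(f : {ffun 'I_n -> 'I_L}) P ([set w | F n w = f] `&` C f))%E).
  apply: le_measure_sum => //.
    by move=> f; apply: measurableI => //; apply: measurable_preimage => //; exact: measurable_sample.
  move=> w /= etaw; have [Gw|nGw] := pselect (G n (F n w) (sample W n w)); last by left.
  right; exists (F n w); split => //; split => //=.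
  set f := F n w; set z := sample W n w.
  have [_ _ bl] := HG n f z n0 Gw.
  have RE : fold_remainder n w = fs f z +
      (Num.sqrt n%:R)^-1 * \sum_(i < n | f i == l) Ex Q (fun s => D f (z, s)).
    rewrite /fold_remainder /fs /fold_sum -mulrDr -big_split/=; congr (_ * _).
    by apply: eq_bigr => i _; rewrite subrK tnth_mktuple.
  have bs : `|(Num.sqrt n%:R)^-1 * \sum_(i < n | f i == l) Ex Q (fun s => D f (z, s))| <= h.
    apply: (@le_trans _ _ eps); last by rewrite /eps ge_min lexx.
    rewrite normrM gtr0_norm ?invr_gt0// ler_pdivrMl//.
    apply: (le_trans (ler_norm_sum _ _ _)).
    apply: (@le_trans _ _ (\sum_(i < n | f i == l) (eps / Num.sqrt n%:R))).
      by apply: ler_sum => i _.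
    (* At most [n] terms of size eps / sqrt n, once divided by sqrt n, leave at most [eps]. *)
    rewrite sumr_const -[leLHS]mulr_natl.
    apply: (@le_trans _ _ (n%:R * (eps / Num.sqrt n%:R))).
      apply: ler_wpM2r; first by rewrite divr_ge0 ?ltW.
      by rewrite ler_nat (leq_trans (max_card _))// card_ord.
    rewrite -[X in X * _](@sqr_sqrtr R n%:R)// expr2 -mulrA [eps / _]mulrC mulrA.
    by rewrite mulrA mulfK ?gt_eqF.
  move: etaw; rewrite RE => etaw.
  have := lt_le_trans etaw (ler_normD _ _); rewrite /h in bs *; lra.
rewrite [e]splitr EFinD leeD//.
apply: (@le_trans _ _ (\sum_(f : {ffun 'I_n -> 'I_L}) P [set w | F n w = f] * (e / 2)%:E)%E).
  apply: lee_sum => f _; rewrite indepF//; apply: lee_pmul => //; exact: PC.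
by rewrite -ge0_sume_distrl// (sum_probability_fibers P (@mF n)) mul1e.
Unshelve. all: by end_near. Qed.

End cross_fitted_remainder.

(** * From smooth test functions to distribution functions *)

Section slutsky.
Context (R : realType).

(** With k = 1 / (eta r) the exponential reaches 1 + 1 / eta at distance [r] from the centre. The
    slope does not depend on the centre [a], so one [k] serves both sides of the limit point. *)
Lemma logistic_approx (eta r : R) : 0 < eta -> 0 < r ->
  exists2 k : R, 0 < k & forall a s : R,
    (s <= a - r -> 1 - eta <= logistic k a s) /\ (a + r <= s -> logistic k a s <= eta).
Proof.
move=> eta0 r0; pose k := (eta * r)^-1; have k0 : 0 < k by rewrite invr_gt0 mulr_gt0.
have kr : eta^-1 <= expR (k * r).
  rewrite (_ : k * r = eta^-1); last by rewrite /k; field; rewrite !gt_eqF.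
  by apply: le_trans (expR_ge1Dx _); rewrite lerDr.
exists k => // a s; split => [sa|as_].
- have e1 : expR (k * (s - a)) <= eta.
    apply: (@le_trans _ _ (expR (- (k * r)))).
      by rewrite ler_expR -mulrN; apply: ler_wpM2l; [exact: ltW|lra].
    by rewrite expRN -[leRHS]invrK lef_pV2 ?posrE ?expR_gt0 ?invr_gt0.
  apply: (@le_trans _ _ (1 + eta)^-1).
    by rewrite -[leRHS]mul1r ler_pdivlMr ?addr_gt0//; nra.
  by rewrite /logistic lef_pV2 ?posrE ?addr_gt0 ?expR_gt0// lerD2l.
- rewrite /logistic -[leRHS]invrK lef_pV2 ?posrE ?addr_gt0 ?expR_gt0 ?invr_gt0//.
  apply: (le_trans kr); apply: (@le_trans _ _ (expR (k * (s - a)))).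
    by rewrite ler_expR; apply: ler_wpM2l; [exact: ltW|lra].
  by rewrite lerDr.
Qed.

Lemma Ex_indic d (T : measurableType d) (P : probability T R) (A : set T) :
  measurable A -> Ex P \1_A = fine (P A).
Proof. by move=> mA; rewrite /Ex /Rintegral integral_indic// setIT. Qed.

Lemma rint_indic d (T : measurableType d) (P : probability T R) (A : set T) :
  measurable A -> rint P (\1_A : T -> R).
Proof.
move=> mA; apply: (@rint_bounded _ _ _ _ _ 1); first exact: measurable_indic.
by move=> x; rewrite indicE; case: (_ \in _); rewrite ?normr1 ?normr0.
Qed.

Lemma measurable_logistic (k a : R) : measurable_fun [set: R] (logistic k a).
Proof.
apply: continuous_measurable_fun => x.
apply: differentiable_continuous; apply/derivable1_diffP.
exact: (@ex_derive _ _ _ _ _ _ _ (is_derive_logistic k a x)).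
Qed.

Lemma logistic_norm_le1 (k a x : R) : `|logistic k a x| <= 1.
Proof. by rewrite gtr0_norm ?logistic_gt0// logistic_le1. Qed.

(** The arithmetic of [slutsky_cdf]: [p] is the probability sought, [q] that of a large
    perturbation, [f1] and [f2] the logistic expectations and [g1] and [g2] their limits, [c] the
    limiting distribution function with neighbouring values [cu] and [cl]. *)
Lemma slutsky_bound (p q f1 f2 g1 g2 c cu cl e : R) :
  p <= q + f1 + e -> f2 <= p + q + e -> g1 <= cu + e -> cl <= g2 + e ->
  `|c - cu| <= e -> `|c - cl| <= e -> q <= e -> `|g1 - f1| <= e -> `|g2 - f2| <= e ->
  `|c - p| <= 5 * e.
Proof.
move=> h1 h2 h3 h4; rewrite !ler_norml.
move=> /andP[a1 a2] /andP[b1 b2] q1 /andP[c1 c2] /andP[d1 d2].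
by apply/andP; split; lra.
Qed.

Context d (T : measurableType d) (P : probability T R).
Variable nu : probability (measurableTypeR R) R.
Variables X Y : nat -> T -> R.
Hypothesis mX : forall n, measurable_fun [set: T] (X n).
Hypothesis mY : forall n, measurable_fun [set: T] (Y n).
Hypothesis Y0 : forall eta : R, 0 < eta ->
  P [set w | eta < `|Y n w|] @[n --> \oo] --> 0%E.
Hypothesis Xnu : forall k a : R, 0 < k ->
  (fun n => Ex P (fun w => logistic k a (X n w))) @ \oo --> Ex nu (logistic k a).

Lemma slutsky_cdf (x : R) :
  {for x, continuous (fun y : R => nu `]-oo, y]%classic)} ->
  P ((fun w => X n w + Y n w) @^-1` `]-oo, x]%classic) @[n --> \oo]
    --> nu `]-oo, x]%classic.
Proof.
pose c y := fine (nu `]-oo, y]%classic).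
have mItv y : measurable (`]-oo, y]%classic : set (measurableTypeR R)) by [].
have cx : nu `]-oo, x]%classic = (c x)%:E by rewrite fineK// fin_num_measure.
rewrite /prop_for /continuous_at cx => /fine_cvgP[_ /cvgrPdist_le cnu].
have cE y : c y = Ex nu \1_(`]-oo, y]%classic) by rewrite Ex_indic.
have mZ n : measurable_fun [set: T] (fun w => X n w + Y n w) by exact: measurable_funD.
have mA n : measurable ((fun w => X n w + Y n w) @^-1` `]-oo, x]%classic).
  exact: measurable_preimage.
have mB n (eta : R) : measurable [set w | eta < `|Y n w|].
  exact: measurable_abs_gt.
apply/fine_cvgP; split; first by apply: nearW => n; exact: fin_num_measure.
apply/cvgrPdist_le => e' e'0; pose e := e' / 5; have e0 : 0 < e by rewrite divr_gt0.
have [del del0 cdel] : exists2 del : R, 0 < del & forall y, `|x - y| <= 2 * del -> `|c x - c y| <= e.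
  have [r /= r0 rc] := cnu e e0; exists (r / 4); first by rewrite divr_gt0.
  by move=> y xy; apply: rc => /=; apply: (le_lt_trans xy); lra.
have del20 : 0 < del / 2 by rewrite divr_gt0.
(* Logistic functions centred at x + 3/2 del and x - 3/2 del, each with transition width del on the
   whole, leave room [del] for the perturbation and stay within 2 del of x, where the limiting
   distribution function varies by at most [e]. *)
have [k k0 kl] := logistic_approx e0 del20.
have rl (a : R) n : rint P (fun w => logistic k a (X n w)).
  apply: (@rint_bounded _ _ _ _ _ 1) => [|w]; last exact: logistic_norm_le1.
  exact: (measurableT_comp (measurable_logistic k a)).
have rln (a : R) : rint nu (logistic k a).
  apply: (@rint_bounded _ _ _ _ _ 1) => [|w]; last exact: logistic_norm_le1.
  exact: measurable_logistic.
have up n : fine (P ((fun w => X n w + Y n w) @^-1` `]-oo, x]%classic)) <=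
    fine (P [set w | del < `|Y n w|]) +
    Ex P (fun w => logistic k (x + del * 3 / 2) (X n w)) + e.
  rewrite -!Ex_indic// -[X in _ <= _ + X](Ex_cst P e) -!ExD ?rint_indic//; last 2 first.
  - by apply: rintD => //; exact: rint_indic.
  - exact: rint_cst.
  apply: Ex_le; first exact: rint_indic.
    by apply: rintD; [apply: rintD => //; exact: rint_indic|exact: rint_cst].
  move=> w; have l0 := logistic_gt0 k (x + del * 3 / 2) (X n w).
  have i0 : 0 <= \1_[set w | del < `|Y n w|] w :> R by [].
  rewrite [X in X <= _]indicE; case: (boolP (_ \in _)) => [|_]; last by rewrite /=; lra.
  rewrite inE /= in_itv/= => XY.
  have [Yd|Yd] := ltP del `|Y n w|.
    by rewrite indicE mem_set//=; lra.
  have [+ _] := kl (x + del * 3 / 2) (X n w).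
  move: Yd; rewrite ler_norml => /andP[Y1 Y2] H.
  by have := H ltac:(lra); rewrite /=; lra.
have lo n : Ex P (fun w => logistic k (x - del * 3 / 2) (X n w)) <=
    fine (P ((fun w => X n w + Y n w) @^-1` `]-oo, x]%classic)) +
    fine (P [set w | del < `|Y n w|]) + e.
  rewrite -!Ex_indic// -[X in _ <= _ + X](Ex_cst P e) -!ExD ?rint_indic//; last 2 first.
  - by apply: rintD; exact: rint_indic.
  - exact: rint_cst.
  apply: Ex_le => //.
    by apply: rintD; [apply: rintD; exact: rint_indic|exact: rint_cst].
  move=> w; have l1 := logistic_le1 k (x - del * 3 / 2) (X n w).
  have i0 : 0 <= \1_[set w | del < `|Y n w|] w :> R by [].
  rewrite [X in _ <= X + _ + _]indicE; case: (boolP (_ \in _)) => [_|].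
    by rewrite /=; lra.
  rewrite notin_setE /= in_itv/= => /negP; rewrite -ltNge => XY; rewrite add0r.
  have [Yd|Yd] := ltP del `|Y n w|.
    by rewrite indicE mem_set//=; lra.
  have [_] := kl (x - del * 3 / 2) (X n w).
  move: Yd; rewrite ler_norml => /andP[Y1 Y2] H.
  by have := H ltac:(lra); lra.
have upn : Ex nu (logistic k (x + del * 3 / 2)) <= c (x + 2 * del) + e.
  rewrite cE -[X in _ <= _ + X](Ex_cst nu e) -ExD ?rint_indic//; last exact: rint_cst.
  apply: Ex_le => //; first by apply: rintD; [exact: rint_indic|exact: rint_cst].
  move=> y; rewrite indicE; case: (boolP (_ \in _)) => [_|].
    by have := logistic_le1 k (x + del * 3 / 2) y; rewrite /=; lra.
  rewrite notin_setE /= in_itv/= => /negP; rewrite -ltNge => yy; rewrite add0r.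
  by have [_] := kl (x + del * 3 / 2) y; apply; lra.
have lon : c (x - 2 * del) <= Ex nu (logistic k (x - del * 3 / 2)) + e.
  rewrite cE -[X in _ <= _ + X](Ex_cst nu e) -ExD ?rint_indic//; last exact: rint_cst.
  apply: Ex_le; first exact: rint_indic.
    by apply: rintD => //; exact: rint_cst.
  move=> y; rewrite indicE; case: (boolP (_ \in _)) => [|_]; last first.
    by have := logistic_gt0 k (x - del * 3 / 2) y; rewrite /=; lra.
  rewrite inE /= in_itv/= => yy.
  have [+ _] := kl (x - del * 3 / 2) y; move=> H.
  by have := H ltac:(lra); lra.
have cu : `|c x - c (x + 2 * del)| <= e.
  by apply: cdel; rewrite opprD addrA subrr sub0r normrN gtr0_norm// mulr_gt0.
have cl : `|c x - c (x - 2 * del)| <= e.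
  by apply: cdel; rewrite opprD addrA subrr sub0r opprK gtr0_norm// mulr_gt0.
have Xk a : Ex P (fun w => logistic k a (X n w)) @[n --> \oo] --> Ex nu (logistic k a).
  exact: Xnu.
have Ye := ereal_cvg0_near (Y0 del0) e0.
have /cvgrPdist_le/(_ _ e0) Xu := Xk (x + del * 3 / 2).

have /cvgrPdist_le/(_ _ e0) Xl := Xk (x - del * 3 / 2).
apply: filterS3 Ye Xu Xl => n Yn Xun Xln; rewrite (_ : e' = 5 * e); last by rewrite /e; field.
apply: (slutsky_bound (up n) (lo n) upn lon cu cl _ Xun Xln).
by rewrite -lee_fin fineK ?fin_num_measure.
Qed.

End slutsky.

(** * Conditional expectation *)

Section almost_everywhere.
Context (R : realType) d (T : measurableType d) (P : probability T R).
Implicit Types f g : T -> R.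

Lemma rint_dom_ae f g : measurable_fun [set: T] f ->
  {ae P, forall x, `|f x| <= g x} -> rint P g -> rint P f.
Proof.
move=> mf fg /[dup] rg /integrableP[mg ig]; apply/integrableP; split.
  exact/measurable_EFinP.
apply: le_lt_trans ig.
apply: ae_ge0_le_integral => //.
- by apply/measurable_EFinP; exact: measurableT_comp.
- by apply: measurableT_comp.
- by apply: filterS fg => x fgx _; rewrite lee_fin (le_trans fgx)// ler_norm.
Qed.

Lemma Ex_ge0_ae f : measurable_fun [set: T] f -> {ae P, forall x, 0 <= f x} ->
  0 <= Ex P f.
Proof.
move=> mf f0; rewrite fine_ge0//.
rewrite (@ae_eq_integral _ _ _ P setT (fun x => `|f x|%:E)) //.
- by apply: integral_ge0 => x _; rewrite lee_fin.
- exact/measurable_EFinP.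
- by apply/measurable_EFinP; exact: measurableT_comp.
- by apply: filterS f0 => x fx _ /=; rewrite ger0_norm.
Qed.

Lemma Ex_le_ae f g : rint P f -> rint P g -> {ae P, forall x, f x <= g x} ->
  Ex P f <= Ex P g.
Proof.
move=> rf rg fg; rewrite -subr_ge0 -ExB//; apply: Ex_ge0_ae.
  exact: rint_measurable (rintB rg rf).
by apply: filterS fg => x; rewrite subr_ge0.
Qed.

Lemma Ex_eq_ae f g : rint P f -> rint P g -> {ae P, forall x, f x = g x} ->
  Ex P f = Ex P g.
Proof.
by move=> rf rg fg; apply: le_anti; rewrite !Ex_le_ae//; apply: filterS fg => x ->.
Qed.

Lemma Ex_eq0_ae f : rint P f -> (forall x, 0 <= f x) -> Ex P f = 0 ->
  {ae P, forall x, f x = 0}.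
Proof.
move=> rf f0 E0.
have : (\int[P]_x `|(f x)%:E| = 0)%E.
  rewrite -[RHS](congr1 EFin E0) ExE//; apply: eq_integral => x _.
  by rewrite /= ger0_norm.
have mf : measurable_fun [set: T] (EFin \o f) by exact/measurable_EFinP/(rint_measurable rf).
move=> /(ae_eq_integral_abs P measurableT mf); apply: filterS => x /(_ I) [].
by [].
Qed.

End almost_everywhere.

Section density_measure.
Context (R : realType) d (T : measurableType d) (P : probability T R).
Variable Z : T -> R.
Hypotheses (rZ : rint P Z) (Z0 : forall x, 0 <= Z x).

(* The hypotheses are arguments so that the measure instance can depend on them. *)
Definition density_measure (_ : rint P Z) (_ : forall x, 0 <= Z x) : set T -> \bar R :=
  fun A => (\int[P]_(x in A) (Z x)%:E)%E.

Let nu0 : density_measure rZ Z0 set0 = 0%E. Proof. exact: integral_set0. Qed.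

Let nu_ge0 A : (0 <= density_measure rZ Z0 A)%E.
Proof. by apply: integral_ge0 => x _; rewrite lee_fin. Qed.

Let nu_sigma : semi_sigma_additive (density_measure rZ Z0).
Proof.
apply: semi_sigma_additive_nng_induced; first exact/measurable_EFinP/(rint_measurable rZ).
by move=> x; rewrite lee_fin.
Qed.

HB.instance Definition _ := isMeasure.Build _ _ _ (density_measure rZ Z0) nu0 nu_ge0 nu_sigma.

Let nu_fin : fin_num_fun (density_measure rZ Z0).
Proof.
by move=> A mA; apply: integrable_fin_num => //; exact: integrableS rZ.
Qed.

HB.instance Definition _ := Measure_isFinite.Build _ _ _ (density_measure rZ Z0) nu_fin.

End density_measure.

Section conditional_transfer.
Context (R : realType) d (T : measurableType d) (P : probability T R).
Context dE (E : measurableType dE) (X : T -> E).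
Hypothesis mX : measurable_fun [set: T] X.

(** The two densities induce the same measure on the values of [X], and both sides are the integral
    of [h] against it. *)
Lemma ge0_integral_transfer (Z1 Z2 : T -> R) (h : E -> \bar R) :
  rint P Z1 -> (forall x, 0 <= Z1 x) -> rint P Z2 -> (forall x, 0 <= Z2 x) ->
  (forall A, measurable A -> (\int[P]_(x in X @^-1` A) (Z1 x)%:E =
     \int[P]_(x in X @^-1` A) (Z2 x)%:E)%E) ->
  measurable_fun [set: E] h -> (forall e, 0 <= h e)%E ->
  (\int[P]_x (h (X x) * (Z1 x)%:E) = \int[P]_x (h (X x) * (Z2 x)%:E))%E.
Proof.
move=> m1 Z10 m2 Z20 Z12 mh h0.
have mhX : measurable_fun [set: T] (h \o X) by exact: measurableT_comp.
have step (Z : T -> R) (rZ : rint P Z) (Z0 : forall x, 0 <= Z x) :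
    (\int[P]_x (h (X x) * (Z x)%:E) =
     \int[pushforward (density_measure rZ Z0) X]_e h e)%E.
  rewrite ge0_integral_pushforward// preimage_setT.
  symmetry; apply: (ge0_integral_density (P := P)
    (nu := density_measure rZ Z0 : {finite_measure set T -> \bar R})) => // [|x].
    exact: rint_measurable rZ.
  exact: h0.
rewrite (step Z1 m1 Z10) (step Z2 m2 Z20).
by apply: eq_measure_integral => A mA _; exact: Z12.
Qed.

(** The relation E[Z | X] = 0, expressed through the events of [X]. *)
Definition cmean0 (Z : T -> R) :=
  rint P Z /\ forall A, measurable A -> Ex P (fun x => \1_A (X x) * Z x) = 0.

Lemma rint_indicM (A : set E) (Z : T -> R) : measurable A -> rint P Z ->
  rint P (fun x => \1_A (X x) * Z x).
Proof.
move=> mA rZ; apply: (rint_dom _ _ (rint_norm rZ)).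
  apply: measurable_funM; last exact: rint_measurable rZ.
  have m1 : measurable_fun [set: E] (\1_A : _ -> R) by exact: measurable_indic.
  exact: (measurableT_comp m1).
by move=> x; rewrite normrM indicE; case: (_ \in _); rewrite ?normr1 ?mul1r// normr0 mul0r.
Qed.

Lemma integral_preimage (A : set E) (Z : T -> R) : measurable A -> rint P Z ->
  (\int[P]_(x in X @^-1` A) (Z x)%:E = (Ex P (fun x => \1_A (X x) * Z x))%:E)%E.
Proof.
move=> mA rZ; rewrite ExE; last exact: rint_indicM.
rewrite integral_mkcond; apply: eq_integral => x _.
rewrite patchE indicE; have -> : (x \in X @^-1` A) = (X x \in A) by apply/idP/idP; rewrite !inE.
by case: (_ \in _); rewrite ?mul1r ?mul0r.
Qed.

(** The parts [Zp] and [Zn] have equal integrals over events of [X], which [ge0_integral_transfer]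
    extends to nonnegative multipliers. Splitting [h] as well gives four integrable products that
    cancel in pairs. *)
Lemma cmean0_mul (Z : T -> R) (h : E -> R) : cmean0 Z -> measurable_fun [set: E] h ->
  rint P (fun x => h (X x) * Z x) -> Ex P (fun x => h (X x) * Z x) = 0.
Proof.
move=> [rZ Z0] mh rhZ.
have mZ := rint_measurable rZ.
have mhX : measurable_fun [set: T] (h \o X) by exact: measurableT_comp.
pose Zp x := Num.max (Z x) 0; pose Zn x := Num.max (- Z x) 0.
pose hp x := Num.max (h x) 0; pose hn x := Num.max (- h x) 0.
have mZp : measurable_fun [set: T] Zp by exact: measurable_maxr.
have mZn : measurable_fun [set: T] Zn.
  by apply: measurable_maxr => //; exact: measurableT_comp.
have mhp : measurable_fun [set: E] hp by exact: measurable_maxr.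
have mhn : measurable_fun [set: E] hn.
  by apply: measurable_maxr => //; exact: measurableT_comp.
have Zp0 x : 0 <= Zp x by rewrite le_max lexx orbT.
have Zn0 x : 0 <= Zn x by rewrite le_max lexx orbT.
have hp0 x : 0 <= hp x by rewrite le_max lexx orbT.
have hn0 x : 0 <= hn x by rewrite le_max lexx orbT.
have maxb (u : R) : Num.max u 0 <= `|u| by rewrite ge_max ler_norm normr_ge0.
have rZp : rint P Zp.
  by apply: (rint_dom _ _ (rint_norm rZ)) => // x; rewrite ger0_norm//; exact: maxb.
have rZn : rint P Zn.
  apply: (rint_dom _ _ (rint_norm rZ)) => // x; rewrite ger0_norm// -[leRHS]normrN.
  exact: maxb.
have ZE x : Z x = Zp x - Zn x.
  by rewrite /Zp /Zn /Num.max; case: ifP; case: ifP; rewrite ?oppr_lt0; lra.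
have hE x : h x = hp x - hn x.
  by rewrite /hp /hn /Num.max; case: ifP; case: ifP; rewrite ?oppr_lt0; lra.
have eqA A : measurable A -> (\int[P]_(x in X @^-1` A) (Zp x)%:E =
     \int[P]_(x in X @^-1` A) (Zn x)%:E)%E.
  move=> mA; rewrite !integral_preimage//; congr EFin.
  apply/eqP; rewrite -subr_eq0 -ExB; [|exact: rint_indicM..].
  by rewrite -(Z0 A mA); apply/eqP; apply: eq_Ex => x; rewrite ZE mulrBr.
have key (k : E -> R) : measurable_fun [set: E] k -> (forall e, 0 <= k e) ->
    (forall e, k e <= `|h e|) ->
    rint P (fun x => k (X x) * Zp x) /\ rint P (fun x => k (X x) * Zn x) /\
    Ex P (fun x => k (X x) * Zp x) = Ex P (fun x => k (X x) * Zn x).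
  move=> mk k0 kh.
  have mkX : measurable_fun [set: T] (k \o X) by exact: measurableT_comp.
  have rp : rint P (fun x => k (X x) * Zp x).
    apply: (rint_dom _ _ (rint_norm rhZ)); first exact: measurable_funM.
    by move=> x; rewrite ger0_norm ?mulr_ge0// normrM ler_pM//; exact: maxb.
  have rn : rint P (fun x => k (X x) * Zn x).
    apply: (rint_dom _ _ (rint_norm rhZ)); first exact: measurable_funM.
    move=> x; rewrite ger0_norm ?mulr_ge0// normrM ler_pM//.
    by rewrite -[leRHS]normrN; exact: maxb.
  split=> //; split=> //; apply: EFin_inj; rewrite !ExE//.
  under eq_integral do rewrite EFinM.
  under [RHS]eq_integral do rewrite EFinM.
  apply: (@ge0_integral_transfer Zp Zn (EFin \o k)) => //.
  exact/measurable_EFinP.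
have hph e : hp e <= `|h e| by exact: maxb.
have hnh e : hn e <= `|h e| by rewrite -[leRHS]normrN; exact: maxb.
have [r1 [r2 e1]] := key hp mhp hp0 hph.
have [r3 [r4 e2]] := key hn mhn hn0 hnh.
rewrite (eq_Ex P (g := fun x => (hp (X x) * Zp x - hp (X x) * Zn x)
    - (hn (X x) * Zp x - hn (X x) * Zn x))); last first.
  by move=> x; rewrite hE ZE; ring.
by rewrite !ExB//; [rewrite e1 e2; ring|exact: rintB|exact: rintB].
Qed.

Lemma cmean0D (Z1 Z2 : T -> R) : cmean0 Z1 -> cmean0 Z2 -> cmean0 (fun x => Z1 x + Z2 x).
Proof.
move=> [r1 h1] [r2 h2]; split; first exact: rintD.
move=> A mA; rewrite (eq_Ex P (g := fun x => \1_A (X x) * Z1 x + \1_A (X x) * Z2 x)).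
  by rewrite ExD ?h1 ?h2 ?addr0//; exact: rint_indicM.
by move=> x; rewrite mulrDr.
Qed.

Lemma cmean0_mulX (Z : T -> R) (h : E -> R) : cmean0 Z -> measurable_fun [set: E] h ->
  rint P (fun x => h (X x) * Z x) -> cmean0 (fun x => h (X x) * Z x).
Proof.
move=> cZ mh rh; split => // A mA.
rewrite (eq_Ex P (g := fun x => (\1_A \* h) (X x) * Z x)); last by move=> x; rewrite mulrA.
apply: cmean0_mul => //.
  by apply: measurable_funM => //; exact: measurable_indic.
rewrite (_ : (fun x => _) = (fun x => \1_A (X x) * (h (X x) * Z x))).
  exact: rint_indicM.
by apply/funext => x; rewrite /= mulrA.
Qed.

(** Testing against the sign of [q] turns the centering into a vanishing absolute moment. *)
Lemma cmean0_ae_eq0 (q : E -> R) : measurable_fun [set: E] q ->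
  cmean0 (q \o X) -> {ae P, forall x, q (X x) = 0}.
Proof.
move=> mq cq; pose s e : R := if 0 <= q e then 1 else -1.
have ms : measurable_fun [set: E] s.
  apply: measurable_fun_ifT => //; exact: measurable_fun_ler.
have sE x : s (X x) * q (X x) = `|q (X x)|.
  by rewrite /s; case: ifP => [h|/negbT]; [rewrite mul1r ger0_norm|
    rewrite -ltNge => h; rewrite mulN1r ltr0_norm].
have r : rint P (fun x => `|q (X x)|) by apply: rint_norm; case: cq.
have E0 : Ex P (fun x => `|q (X x)|) = 0.
  rewrite -(eq_Ex P sE); apply: cmean0_mul => //.
  by rewrite (funext sE).
have := Ex_eq0_ae r (fun x => normr_ge0 _) E0.
by apply: filterS => x /eqP; rewrite normr_eq0 => /eqP.
Qed.

End conditional_transfer.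

(** * Conditional probabilities and conditional independence *)

Section joint_measure.
Context (R : realType) d (T : measurableType d) (P : probability T R).
Context dE (E : measurableType dE) (X : {RV P >-> E}) (B : set T).
Hypothesis mB : measurable B.

Definition joint_measure (_ : measurable B) : set E -> \bar R :=
  fun A => P (B `&` X @^-1` A).

Let mpre A : measurable A -> measurable (X @^-1` A).
Proof. exact/measurable_preimage/measurable_funPT. Qed.

Let nu0 : joint_measure mB set0 = 0%E.
Proof. by rewrite /joint_measure preimage_set0 setI0 measure0. Qed.

Let nu_ge0 A : (0 <= joint_measure mB A)%E.
Proof. exact: measure_ge0. Qed.

Let nu_sigma : semi_sigma_additive (joint_measure mB).
Proof.
move=> F mF tF mUF; rewrite /joint_measure preimage_bigcup setI_bigcupr.
apply: measure_semi_sigma_additive.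
- by move=> k; apply: measurableI => //; exact: mpre.
- apply/trivIsetP => /= i j _ _ ij; rewrite setIACA -preimage_setI.
  by move/trivIsetP : tF => /(_ _ _ _ _ ij) ->//; rewrite preimage_set0 setI0.
- by rewrite -setI_bigcupr -preimage_bigcup; apply: measurableI => //; exact: mpre.
Qed.

HB.instance Definition _ := isMeasure.Build _ _ _ (joint_measure mB) nu0 nu_ge0 nu_sigma.

Let nu_fin : fin_num_fun (joint_measure mB).
Proof. by move=> A mA; apply: fin_num_measure; apply: measurableI => //; exact: mpre. Qed.

HB.instance Definition _ := Measure_isFinite.Build _ _ _ (joint_measure mB) nu_fin.

(** A Radon-Nikodym derivative with respect to the law of [X]. [cond_independent] speaks about given
    versions of the conditional probabilities, so using it requires one to exist. *)
Lemma cond_probability_exists :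
  exists2 q : E -> R, (forall e, 0 <= q e) & is_cond_probability P X [set: T] B q.
Proof.
have dom : joint_measure mB `<< distribution P X.
  apply/null_content_dominatesP => A mA; rewrite /distribution /pushforward => PA0.
  apply/eqP; rewrite eq_le measure_ge0 andbT -PA0; apply: le_measure.
  - by rewrite inE; apply: measurableI => //; exact: mpre.
  - by rewrite inE; exact: mpre.
  - by move=> w [].
have [f [f0 ffin fint fE]] := radon_nikodym_sigma_finite dom.
have mf : measurable_fun [set: E] f by exact: measurable_int fint.
have fK e : (fine (f e))%:E = f e by rewrite fineK.
exists (fine \o f); first by move=> e; rewrite /= fine_ge0.
have push A : measurable A ->
    (\int[P]_(w in X @^-1` A) f (X w) = P (B `&` X @^-1` A))%E.
  move=> mA; rewrite -[RHS]/(joint_measure mB A) fE//.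
  rewrite -(ge0_integral_pushforward (measurable_funPT X)) => //; last by apply: measurable_funTS.
have mfX : measurable_fun [set: T] (f \o X) by exact: measurableT_comp.
split.
- by apply: measurableT_comp => //; exact: fine_measurable.
- rewrite (_ : EFin \o _ = f \o X); last by apply/funext => w /=; rewrite fK.
  apply/integrableP; split => //.
  rewrite (eq_integral (f \o X)); last by move=> w _; rewrite /= gee0_abs.
  have := push setT measurableT; rewrite preimage_setT /= => ->.
  by rewrite setIT; apply: (le_lt_trans (probability_le1 P mB)); exact: ltry.
- move=> A mA; rewrite setTI.
  rewrite (eq_integral (f \o X)); last by move=> w _; rewrite /= fK.
  rewrite push//.
  by rewrite integral_indic//; exact: mpre.
Qed.

End joint_measure.

Section conditional_expectation.
Context (R : realType) d (T : measurableType d) (P : probability T R).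
Context dE (E : measurableType dE) (X : {RV P >-> E}).

Lemma rint_indic_mul (B : set T) (Z : T -> R) : measurable B -> rint P Z ->
  rint P (fun w => \1_B w * Z w).
Proof.
move=> mB rZ; apply: (rint_dom _ _ (rint_norm rZ)).
  apply: measurable_funM; last exact: rint_measurable rZ.
  exact: measurable_indic.
by move=> x; rewrite normrM indicE; case: (_ \in _); rewrite ?normr1 ?mul1r// normr0 mul0r.
Qed.

Lemma integral_Ex (B : set T) (Z : T -> R) : measurable B ->
  rint P (fun w => \1_B w * Z w) ->
  (\int[P]_(w in B) (Z w)%:E = (Ex P (fun w => \1_B w * Z w))%:E)%E.
Proof.
move=> mB rZ; rewrite ExE// integral_mkcond; apply: eq_integral => x _.
by rewrite patchE indicE; case: (_ \in _); rewrite ?mul1r ?mul0r.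
Qed.

Lemma cond_expectation_cmean0 (B : set T) (Z : T -> R) (m : E -> R) :
  measurable B -> rint P (fun w => \1_B w * Z w) -> is_cond_expectation P X B Z m ->
  rint P (fun w => \1_B w * m (X w)) /\
  cmean0 P X (fun w => \1_B w * Z w - \1_B w * m (X w)).
Proof.
move=> mB rZ [mm rm eqA].
have rBm : rint P (fun w => \1_B w * m (X w)).
  move: rm => /(integrable_mkcond _ mB).1.
  rewrite /rint; congr (P.-integrable _ _); apply/funext => w.
  by rewrite patchE /= indicE; case: (_ \in _); rewrite ?mul1r ?mul0r.
split=> //; split; first exact: rintB.
move=> A mA; have mXA := measurable_preimage (measurable_funPT X) mA.
have indE (f : T -> R) w : \1_A (X w) * (\1_B w * f w) = \1_(B `&` X @^-1` A) w * f w.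
  by rewrite indicI /= mulrA [X in X * _]mulrC.
have rI (f : T -> R) : rint P (fun w => \1_B w * f w) ->
    rint P (fun w => \1_(B `&` X @^-1` A) w * f w).
  move=> /(rint_indic_mul mXA); rewrite /rint; congr (P.-integrable _ _).
  by apply/funext => w; rewrite /= -indE.
rewrite (eq_Ex P (g := fun w => \1_(B `&` X @^-1` A) w * Z w -
    \1_(B `&` X @^-1` A) w * m (X w))); last first.
  by move=> w; rewrite mulrBr (indE Z) (indE (m \o X)).
rewrite ExB; [|exact: rI..]; apply/eqP; rewrite subr_eq0; apply/eqP; apply: EFin_inj.
have mBA : measurable (B `&` X @^-1` A) by exact: measurableI.
by rewrite -integral_Ex//; [rewrite -integral_Ex//; [rewrite -eqA|exact: rI]|exact: rI].
Qed.

Lemma cond_probability_cmean0 (B : set T) (q : E -> R) : measurable B ->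
  is_cond_probability P X [set: T] B q ->
  rint P (q \o X) /\ cmean0 P X (fun w => \1_B w - q (X w)).
Proof.
move=> mB /(cond_expectation_cmean0 measurableT); case.
  by apply: rint_indic_mul => //; exact: rint_indic.
rewrite /= => rq cq; split; first by move: rq; congr rint; apply/funext => w; rewrite indicT mul1r.
by move: cq; congr cmean0; apply/funext => w; rewrite indicT !mul1r.
Qed.

Context d1 d2 (S1 : measurableType d1) (S2 : measurableType d2).
Variables (U : T -> S1) (V : T -> S2) (C : set S2) (r : E -> R).
Hypotheses (mU : measurable_fun [set: T] U) (mV : measurable_fun [set: T] V).
Hypothesis mC : measurable C.
Hypothesis UV : cond_independent P X U V.
Hypothesis rC : is_cond_probability P X [set: T] (V @^-1` C) r.
Hypothesis r0 : forall w, 0 <= r (X w).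

(** Conditional independence passes from events of [U] to functions of [U], without naming
    E[u(U) | X]. The roles are exchanged: for a fixed event of [X], the indicator of [C] and its
    probability [r] have the same integrals over events of [U], so their difference is centred given
    [U] and may be multiplied by [u]. *)
Lemma cond_independent_cmean0 (u : S1 -> R) : measurable_fun [set: S1] u ->
  rint P (u \o U) ->
  rint P (fun w => r (X w) * u (U w)) /\
  cmean0 P X (fun w => \1_(V @^-1` C) w * u (U w) - r (X w) * u (U w)).
Proof.
move=> mu ru.
have mVC := measurable_preimage mV mC.
have [rr _] := cond_probability_cmean0 mVC rC.
have mr : measurable_fun [set: E] r by case: rC.
pose Z A w : R := \1_A (X w) * \1_(V @^-1` C) w.
pose Z' A w : R := \1_A (X w) * r (X w).
have mX := measurable_funPT X.
have rZ A : measurable A -> rint P (Z A).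
  by move=> mA; apply: rint_indicM => //; exact: rint_indic.
have rZ' A : measurable A -> rint P (Z' A) by move=> mA; exact: rint_indicM.
have key A B : measurable A -> measurable B ->
    Ex P (fun w => \1_B (U w) * Z A w) = Ex P (fun w => \1_B (U w) * Z' A w).
  move=> mA mB; have mUB := measurable_preimage mU mB.
  have [q q0 qB] := cond_probability_exists X mUB.
  have := UV mB mC qB rC.
  have mUC := measurableI _ _ mUB mVC.
  move=> /(cond_probability_cmean0 mUC) [rqr [_ /(_ A mA)]].
  have [rq [_ qA]] := cond_probability_cmean0 mUB qB.
  have mq : measurable_fun [set: E] q by case: qB.
  have rI (D : set T) : measurable D -> rint P (fun w => \1_A (X w) * \1_D w : R).
    by move=> mD; apply: rint_indicM => //; exact: rint_indic.
  rewrite (eq_Ex P (g := fun w => \1_A (X w) * \1_(U @^-1` B `&` V @^-1` C) w -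
    \1_A (X w) * (q \* r) (X w))); last by move=> w; rewrite mulrBr.
  rewrite ExB; [|exact: rI|exact: rint_indicM] => /eqP; rewrite subr_eq0 => /eqP e1.
  rewrite (eq_Ex P (g := fun w => \1_A (X w) * \1_(U @^-1` B `&` V @^-1` C) w)); last first.
    by move=> w; rewrite indicI /= /Z mulrCA.
  rewrite e1; pose r' e := Num.max (r e) 0.
  have r'E w : r' (X w) = r (X w) by rewrite /r' max_l.
  have mr' : measurable_fun [set: E] r' by exact: measurable_maxr.
  have r'0 e : 0 <= r' e by rewrite le_max lexx orbT.
  have mA1 : measurable_fun [set: E] (\1_A : E -> R) by exact: measurable_indic.
  have rBZ' : rint P (fun w => \1_B (U w) * Z' A w) by apply: rint_indicM => //; exact: rZ'.
  have := @ge0_integral_transfer R _ T P _ E X mX \1_(U @^-1` B) (q \o X)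
    (fun e => (r' e * \1_A e)%:E).
  have rAqr : rint P (fun w => \1_A (X w) * (q \* r) (X w)) by exact: rint_indicM.
  move=> H; apply: EFin_inj; rewrite !ExE//.
  transitivity (\int[P]_w ((r' (X w) * \1_A (X w))%:E * (q (X w))%:E))%E.
    by apply: eq_integral => w _; rewrite -EFinM r'E /=; congr EFin; ring.
  rewrite -H.
  - by apply: eq_integral => w _; rewrite -EFinM r'E /Z'; congr EFin; rewrite mulrC [r _ * _]mulrC.
  - exact: rint_indic.
  - by [].
  - exact: rq.
  - by move=> w; exact: q0.
  - move=> A' mA'; rewrite !integral_preimage//; last exact: rint_indic.
    congr EFin; apply/eqP; rewrite -subr_eq0 -ExB; [|by apply: rint_indicM => //; exact: rint_indic|exact: rint_indicM].
    by rewrite -(qA A' mA'); apply/eqP; apply: eq_Ex => w; rewrite mulrBr.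
  - by apply/measurable_EFinP; exact: measurable_funM.
  - by move=> e; rewrite lee_fin mulr_ge0.
have cZ A : measurable A -> cmean0 P U (fun w => Z A w - Z' A w).
  move=> mA; split; first by apply: rintB; [exact: rZ|exact: rZ'].
  move=> B mB; rewrite (eq_Ex P (g := fun w => \1_B (U w) * Z A w - \1_B (U w) * Z' A w)).
    by rewrite ExB ?key ?subrr//; apply: rint_indicM => //; [exact: rZ|exact: rZ'].
  by move=> w; rewrite mulrBr.
have mrX : measurable_fun [set: T] (r \o X) by exact: measurableT_comp.
have muU : measurable_fun [set: T] (u \o U) by exact: measurableT_comp.
(* With |u| as multiplier, the weight [r] is transferred to the indicator of [C], which is at most
   1. *)
have rru : rint P (fun w => r (X w) * u (U w)).
  have rZT := rZ setT measurableT; have rZ'T := rZ' setT measurableT.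
  have mZT : measurable_fun [set: T] (Z setT) := rint_measurable rZT.
  have ZT0 w : 0 <= Z setT w by rewrite /Z mulr_ge0.
  have Z'T0 w : 0 <= Z' setT w by rewrite /Z' mulr_ge0.
  have mZ'T : measurable_fun [set: T] (Z' setT) := rint_measurable rZ'T.
  have := @ge0_integral_transfer R _ T P _ S1 U mU (Z setT) (Z' setT) (fun s => `|u s|%:E).
  move=> H; apply/integrableP; split; first by apply/measurable_EFinP; exact: measurable_funM.
  apply: (@le_lt_trans _ _ (\int[P]_w ((`|u (U w)|)%:E * (Z' setT w)%:E))%E).
    apply: ge0_le_integral => //.
    - by apply/measurable_EFinP; apply: measurableT_comp => //; exact: measurable_funM.
    - by apply/measurable_EFinP; apply: measurable_funM => //; exact: measurableT_comp.
    - by move=> w _; rewrite -EFinM lee_fin /Z' indicT mul1r normrM (ger0_norm (r0 w)) mulrC.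
  rewrite -H //.
  - apply: le_lt_trans (integrableP _ _ _ ru).2; apply: ge0_le_integral => //.
    - by move=> w _; rewrite -EFinM lee_fin; apply: mulr_ge0.
    - by apply/measurable_EFinP; apply: measurable_funM => //; exact: measurableT_comp.
    - by apply: measurableT_comp => //; apply/measurable_EFinP.
    - by move=> w _; rewrite -EFinM lee_fin /Z indicT mul1r ler_piMr.
  - move=> B mB; rewrite !integral_preimage ?key//; first [exact: rZ'|exact: rZ].
  - by apply/measurable_EFinP; exact: measurableT_comp.
split=> //; split; first by apply: rintB => //; exact: rint_indic_mul.
move=> A mA; rewrite (eq_Ex P (g := fun w => u (U w) * (Z A w - Z' A w))); last first.
  by move=> w; rewrite /Z /Z'; ring.
apply: (cmean0_mul mU (cZ A mA)) => //.
rewrite (_ : (fun w => _) = fun w => \1_A (X w) * (\1_(V @^-1` C) w * u (U w) - r (X w) * u (U w))).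
  by apply: rint_indicM => //; apply: rintB => //; exact: rint_indic_mul.
by apply/funext => w; rewrite /Z /Z'; ring.
Qed.

End conditional_expectation.

(** * Error of one arm of the score *)

Lemma measurable_inv (R : realType) : measurable_fun [set: R] (@GRing.inv R).
Proof.
rewrite -(setUv [set (0 : R)]); apply/measurable_funU => //; first exact: measurableC.
split; first exact: measurable_fun_set1.
have o0 : open (~` [set (0 : R)]) by rewrite openC; exact: closed_eq.
apply: open_continuous_measurable_fun => //; apply/in_setP => x /eqP x0.
exact: inv_continuous.
Qed.

Lemma measurable_funV d (T : measurableType d) (R : realType) (f : T -> R) :
  measurable_fun [set: T] f -> measurable_fun [set: T] (fun x => (f x)^-1).
Proof. by move=> mf; exact: measurableT_comp (@measurable_inv R) mf. Qed.

Section integral_inequalities.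
Context (R : realType) d (T : measurableType d) (P : probability T R).
Implicit Types f g : T -> R.

Lemma rint_mul_sqr f g : measurable_fun [set: T] f -> measurable_fun [set: T] g ->
  rint P (fun x => f x ^+ 2) -> rint P (fun x => g x ^+ 2) -> rint P (fun x => f x * g x).
Proof.
move=> mf mg rf rg; apply: (rint_dom _ _ (rintD rf rg)); first exact: measurable_funM.
by move=> x; rewrite ler_norml; apply/andP; split; nra.
Qed.

(** The quadratic polynomial E (t |f| - |g|)^2 is nonnegative; its value at t = C / A gives the
    claim when A > 0. *)
Lemma Ex_cauchy_schwarz f g : measurable_fun [set: T] f -> measurable_fun [set: T] g ->
  rint P (fun x => f x ^+ 2) -> rint P (fun x => g x ^+ 2) ->
  Ex P (fun x => `|f x| * `|g x|) ^+ 2 <=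
  Ex P (fun x => f x ^+ 2) * Ex P (fun x => g x ^+ 2).
Proof.
move=> mf mg rf rg.
have rfg : rint P (fun x => `|f x| * `|g x|).
  apply: rint_mul_sqr => //; [exact: measurableT_comp|exact: measurableT_comp| |].
  - by under eq_fun do rewrite real_normK ?num_real//.
  - by under eq_fun do rewrite real_normK ?num_real//.
set A := Ex P (fun x => f x ^+ 2); set B := Ex P (fun x => g x ^+ 2); set C := Ex P _.
have A0 : 0 <= A by apply: Ex_ge0 => x; exact: sqr_ge0.
have C0 : 0 <= C by apply: Ex_ge0 => x; exact: mulr_ge0.
have key t : 0 <= A * t ^+ 2 - 2 * C * t + B.
  have -> : A * t ^+ 2 - 2 * C * t + B = Ex P (fun x => t ^+ 2 * f x ^+ 2 -
      (2 * t) * (`|f x| * `|g x|) + g x ^+ 2).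
    rewrite ExD//; last by apply: rintB; exact: rintZ.
    by rewrite ExB ?ExZ//; [rewrite -/A -/B -/C; ring|exact: rintZ|exact: rintZ].
  apply: Ex_ge0 => x; rewrite -[f x ^+ 2]real_normK ?num_real// -[g x ^+ 2]real_normK ?num_real//.
  rewrite (_ : _ + _ = (t * `|f x| - `|g x|) ^+ 2); first exact: sqr_ge0.
  by ring.
have [A_gt0|] := ltP 0 A.
  have := key (C / A).
  rewrite (_ : _ + _ = (A * B - C ^+ 2) / A); last by field; rewrite gt_eqF.
  by rewrite pmulr_lge0 ?invr_gt0// subr_ge0.
move=> A_le0; have A00 : A = 0 by apply: le_anti; rewrite A_le0.
have [C_gt0|] := ltP 0 C.
  (* When A = 0 the polynomial is affine in t and would equal -1 at this point, so C vanishes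
     too. *)
  have := key ((B + 1) / (2 * C)); rewrite A00 mul0r sub0r.
  rewrite (_ : - _ + _ = - 1); first by rewrite oppr_ge0 ler10.
  by field; rewrite gt_eqF.
by move=> C_le0; rewrite A00 mul0r (_ : C = 0) ?expr0n//; apply: le_anti; rewrite C_le0.
Qed.

Lemma Ex_tail (f : T -> R) (eps : R) : rint P f -> (forall x, 0 <= f x) -> 0 < eps ->
  exists2 M : R, 0 <= M & Ex P (fun x => \1_[set y | M < f y] x * f x) <= eps.
Proof.
move=> rf f0 eps0; have mf := rint_measurable rf.
have mB (M : R) : measurable [set y | M < f y].
  exact: measurable_set_lt.
have rM (M : R) : rint P (fun x => \1_[set y | M < f y] x * f x) by exact: rint_indic_mul.
have [|||||_ _] := @dominated_convergence _ T R P setT measurableT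
  (fun n => EFin \o (fun x => \1_[set y | n%:R < f y] x * f x)) (cst 0%E) (EFin \o f).
- by move=> n; exact: measurable_int (rM _).
- exact: measurable_cst.
- apply: aeW => x _; apply: cvg_near_cst.
  near=> n; rewrite /= indicE memNset ?mul0r//= => nf.
  have : f x < n%:R by near: n; exact: nbhs_infty_gtr.
  by move=> fn; have := lt_trans nf fn; rewrite ltxx.
- exact: rf.
- apply: aeW => x n _ /=; rewrite lee_fin ger0_norm ?mulr_ge0// ler_piMl//.
rewrite integral0 => /ereal_cvg0_near/(_ eps0) [n _ /(_ n (leqnn n)) H].
by exists n%:R => //; rewrite -lee_fin ExE.
Unshelve. all: by end_near. Qed.

End integral_inequalities.

Section one_arm.
Context (R : realType).

Lemma weight_ratio_bound (o ph c' : R) : 0 < c' -> c' <= ph -> 0 <= o <= 1 ->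
  `|o / ph - 1| <= c'^-1 + 1.
Proof.
move=> c0 cph /andP[ o0 o1]; have ph0 : 0 < ph := lt_le_trans c0 cph.
apply: (le_trans (ler_normB _ _)); rewrite normr1 lerD2r normrM normfV.
rewrite (ger0_norm o0) (gtr0_norm ph0); apply: (@le_trans _ _ ph^-1).
  by rewrite ler_piMl// invr_ge0 ltW.
by rewrite lef_pV2 ?posrE.
Qed.

Lemma ratio_sub1 (p ph c' : R) : 0 < c' -> c' <= ph -> `|p / ph - 1| <= `|p - ph| / c'.
Proof.
move=> c0 cph; have ph0 : 0 < ph := lt_le_trans c0 cph.
rewrite (_ : p / ph - 1 = (p - ph) / ph); last by field; rewrite gt_eqF.
rewrite normrM normfV (gtr0_norm ph0); apply: ler_wpM2l => //.
by rewrite lef_pV2 ?posrE.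
Qed.

Lemma sqrrD_le (a b : R) : (a + b) ^+ 2 <= 2 * a ^+ 2 + 2 * b ^+ 2.
Proof. by have := sqr_ge0 (a - b); nra. Qed.

Lemma ler_sqr_norm (a b : R) : `|a| <= b -> a ^+ 2 <= b ^+ 2.
Proof. by move=> ab; rewrite -real_normK ?num_real// lerXn2r// nnegrE (le_trans _ ab). Qed.

(** The factor p / ph - 1 has two bounds: a constant, used where U^2 exceeds [M], and a multiple of
    |p - ph|, used where U^2 is at most [M]. Neither alone would do for a [U] with only two
    moments. *)
Lemma arm_sqr_bound (U p ph kap e o C c' M : R) : 0 < c' -> c' <= ph ->
  0 < p <= 1 -> `|kap| <= C -> 0 <= o <= 1 -> 0 <= M ->
  (U * (p / ph - 1) + kap * e * (o / ph - 1)) ^+ 2 <=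
  2 * (c'^-1 + 1) ^+ 2 * ((M < U ^+ 2)%R%:R * U ^+ 2) + 2 * M / c' ^+ 2 * (p - ph) ^+ 2 +
  2 * C ^+ 2 * (c'^-1 + 1) ^+ 2 * e ^+ 2.
Proof.
move=> c0 cph /andP[p0 p1] kC o01 M0; apply: (le_trans (sqrrD_le _ _)); apply: lerD.
- rewrite exprMn; have a1 : (p / ph - 1) ^+ 2 <= (c'^-1 + 1) ^+ 2.
    by apply: ler_sqr_norm; apply: weight_ratio_bound => //; rewrite (ltW p0).
  have a2 : (p / ph - 1) ^+ 2 <= (p - ph) ^+ 2 / c' ^+ 2.
    rewrite -exprVn -exprMn -[X in _ <= X]real_normK ?num_real//; apply: ler_sqr_norm.
    by rewrite normrM normfV (gtr0_norm c0); exact: ratio_sub1.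
  have a3 : 0 <= 2 * M / c' ^+ 2 * (p - ph) ^+ 2.
    by rewrite mulr_ge0 ?sqr_ge0// divr_ge0 ?sqr_ge0// mulr_ge0.
  case: ltP => UM; rewrite /= ?mul1r ?mul0r ?mulr0 ?add0r.
    rewrite -[leLHS]addr0; apply: lerD => //.
    rewrite -[leRHS]mulrA; apply: ler_wpM2l => //; rewrite mulrC.
    by apply: ler_wpM2r => //; exact: sqr_ge0.
  have -> : 2 * M / c' ^+ 2 * (p - ph) ^+ 2 = 2 * (M * ((p - ph) ^+ 2 / c' ^+ 2)) by ring.
  by apply: ler_wpM2l => //; apply: ler_pM => //; exact: sqr_ge0.
- have -> : 2 * C ^+ 2 * (c'^-1 + 1) ^+ 2 * e ^+ 2 = 2 * (C ^+ 2 * (c'^-1 + 1) ^+ 2 * e ^+ 2) by ring.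
  have -> : (kap * e * (o / ph - 1)) ^+ 2 = kap ^+ 2 * (o / ph - 1) ^+ 2 * e ^+ 2 by ring.
  apply: ler_wpM2l => //; apply: ler_wpM2r; first exact: sqr_ge0.
  apply: ler_pM; rewrite ?sqr_ge0//; first exact: ler_sqr_norm.
  by apply: ler_sqr_norm; apply: weight_ratio_bound.
Qed.

Context d (T : measurableType d) (P : probability T R).
Context dE (E : measurableType dE) (X : T -> E).
Hypothesis mX : measurable_fun [set: T] X.
Variables (o N : T -> R) (p kap : E -> R) (c C : R).
Hypothesis mo : measurable_fun [set: T] o.
Hypothesis o01 : forall w, 0 <= o w <= 1.
Hypotheses (mp : measurable_fun [set: E] p) (mkap : measurable_fun [set: E] kap).
Hypothesis cN : cmean0 P X N.
Hypothesis cop : cmean0 P X (fun w => o w - p (X w)).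
Let U w := kap (X w) / p (X w) * N w.
Hypothesis rU : rint P (fun w => U w ^+ 2).
Hypotheses (c0 : 0 < c) (C0 : 0 <= C).
Hypothesis p01 : {ae P, forall w, c <= p (X w) <= 1}.
Hypothesis kapC : {ae P, forall w, `|kap (X w)| <= C}.

(* With N = o (Y - m) and e = m - mh, this is the arm kap o (Y - mh) / ph + kap mh
   at the fitted functions ph, mh, minus the same arm at p, m. *)
Definition arm_error (ph e : E -> R) w :=
  U w * (p (X w) / ph (X w) - 1) + kap (X w) * e (X w) * (o w / ph (X w) - 1).

Lemma measurable_arm_U : measurable_fun [set: T] U.
Proof.
apply: measurable_funM; last by case: cN => /rint_measurable.
apply: measurable_funM; first exact: measurableT_comp.
by apply: measurable_funV; exact: measurableT_comp.
Qed.

Section estimates.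
Variables (ph e : E -> R) (c' : R).
Hypotheses (mph : measurable_fun [set: E] ph) (me : measurable_fun [set: E] e).
Hypothesis c'0 : 0 < c'.
Hypothesis ph_ge : {ae P, forall w, c' <= ph (X w)}.
Hypothesis re : rint P (fun w => e (X w) ^+ 2).
Hypothesis rd : rint P (fun w => (p (X w) - ph (X w)) ^+ 2).
Let K0 : R := c'^-1 + 1.
Let mpX : measurable_fun [set: T] (p \o X). Proof. exact: measurableT_comp. Qed.
Let mphX : measurable_fun [set: T] (ph \o X). Proof. exact: measurableT_comp. Qed.
Let mkX : measurable_fun [set: T] (kap \o X). Proof. exact: measurableT_comp. Qed.
Let meX : measurable_fun [set: T] (e \o X). Proof. exact: measurableT_comp. Qed.
Let K00 : 0 <= K0. Proof. by rewrite addr_ge0// invr_ge0 ltW. Qed.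
Let mphV : measurable_fun [set: T] (fun w => (ph (X w))^-1). Proof. exact: measurable_funV. Qed.

Lemma measurable_arm_error : measurable_fun [set: T] (arm_error ph e).
Proof.
apply: measurable_funD; apply: measurable_funM.
- exact: measurable_arm_U.
- by apply: measurable_funB => //; exact: measurable_funM.
- exact: measurable_funM.
- by apply: measurable_funB => //; exact: measurable_funM.
Qed.

Lemma arm_error_sqr (M : R) : 0 <= M -> rint P (fun w => arm_error ph e w ^+ 2) /\
  Ex P (fun w => arm_error ph e w ^+ 2) <=
  2 * K0 ^+ 2 * Ex P (fun w => \1_[set v | M < U v ^+ 2] w * U w ^+ 2) +
  2 * M / c' ^+ 2 * Ex P (fun w => (p (X w) - ph (X w)) ^+ 2) +
  2 * C ^+ 2 * K0 ^+ 2 * Ex P (fun w => e (X w) ^+ 2).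
Proof.
move=> M0; have mU := measurable_arm_U.
have mUM : measurable [set v | M < U v ^+ 2].
  by apply: measurable_set_lt => //; exact: measurable_funX.
have rUM : rint P (fun w => \1_[set v | M < U v ^+ 2] w * U w ^+ 2) by exact: rint_indic_mul.
pose B w := 2 * K0 ^+ 2 * (\1_[set v | M < U v ^+ 2] w * U w ^+ 2) +
  2 * M / c' ^+ 2 * (p (X w) - ph (X w)) ^+ 2 + 2 * C ^+ 2 * K0 ^+ 2 * e (X w) ^+ 2.
have rB : rint P B by apply: rintD; [apply: rintD|]; exact: rintZ.
have msq : measurable_fun [set: T] (fun w => arm_error ph e w ^+ 2).
  by apply: measurable_funX; exact: measurable_arm_error.
have bnd : {ae P, forall w, arm_error ph e w ^+ 2 <= B w}.
  apply: filterS3 p01 kapC ph_ge => w /andP[p0 p1] kw phw.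
  rewrite /B (_ : \1_[set v | M < U v ^+ 2] w = (M < U w ^+ 2)%R%:R).
    by apply: arm_sqr_bound => //; rewrite p1 (lt_le_trans c0).
  by rewrite indicE; congr (nat_of_bool _)%:R; apply/idP/idP; rewrite inE.
have rsq : rint P (fun w => arm_error ph e w ^+ 2).
  apply: (rint_dom_ae msq _ rB); apply: filterS bnd => w.
  by rewrite ger0_norm ?sqr_ge0.
split=> //; apply: (le_trans (Ex_le_ae rsq rB bnd)).
by rewrite ExD ?ExD ?ExZ//; [exact: rintZ|exact: rintZ|apply: rintD|]; exact: rintZ.
Qed.

Lemma rint_arm_error : rint P (arm_error ph e).
Proof.
apply: rint_of_sqr; first exact: measurable_arm_error.
by case: (arm_error_sqr (lexx 0)).
Qed.

(** The error is a function of [X] times [N], plus a function of [X] times [o - p], plus a product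
    of the two nuisance errors. The first two have mean zero, which leaves the product. *)
Lemma arm_error_mean : `|Ex P (arm_error ph e)| <=
  C / c' * Ex P (fun w => `|e (X w)| * `|p (X w) - ph (X w)|).
Proof.
have [rN _] := cN; have mU := measurable_arm_U.
have red : rint P (fun w => `|e (X w)| * `|p (X w) - ph (X w)|).
  apply: rint_mul_sqr.
  - exact: measurableT_comp.
  - by apply: measurableT_comp => //; exact: measurable_funB.
  - by under eq_fun do rewrite real_normK ?num_real//.
  - by under eq_fun do rewrite real_normK ?num_real//.
(* Writing o / ph - 1 = (o - p) / ph + (p / ph - 1) separates [h2] from [h3]. *)
pose h1 x := kap x / p x * (p x / ph x - 1).
pose h2 x := kap x * e x / ph x.
pose h3 x := kap x * e x * (p x / ph x - 1).
have mpV : measurable_fun [set: E] (fun x => (p x)^-1) by exact: measurable_funV.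
have mphV' : measurable_fun [set: E] (fun x => (ph x)^-1) by exact: measurable_funV.
have mr : measurable_fun [set: E] (fun x => p x / ph x - 1).
  by apply: measurable_funB => //; exact: measurable_funM.
have mke : measurable_fun [set: E] (fun x => kap x * e x) by exact: measurable_funM.
have mh1 : measurable_fun [set: E] h1.
  by apply: measurable_funM => //; exact: measurable_funM.
have mh2 : measurable_fun [set: E] h2 by exact: measurable_funM.
have mh3 : measurable_fun [set: E] h3 by exact: measurable_funM.
have meX' : rint P (fun w => `|e (X w)|).
  by apply/rint_norm/rint_of_sqr.
have rUabs : rint P (fun w => `|U w|) by apply/rint_norm/rint_of_sqr.
have r1 : rint P (fun w => h1 (X w) * N w).
  apply: (rint_dom_ae (g := fun w => K0 * `|U w|)); last exact: rintZ.
    apply: measurable_funM; first exact: measurableT_comp.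
    exact: rint_measurable rN.
  apply: filterS2 p01 ph_ge => w /andP[pc p1] phw.
  rewrite (_ : h1 _ * _ = U w * (p (X w) / ph (X w) - 1)); last by rewrite /h1 /U; ring.
  rewrite normrM mulrC; apply: ler_wpM2r => //; apply: weight_ratio_bound => //.
  by rewrite p1 andbT ltW// (lt_le_trans c0).
have r2 : rint P (fun w => h2 (X w) * (o w - p (X w))).
  apply: (rint_dom_ae (g := fun w => (C / c' * 2) * `|e (X w)|)); last exact: rintZ.
    apply: measurable_funM; first exact: measurableT_comp.
    by apply: measurable_funB.
  apply: filterS3 p01 ph_ge kapC => w /andP[pc p1] phw kw.
  have ph0 := lt_le_trans c'0 phw; have p0 := lt_le_trans c0 pc.
  have -> : h2 (X w) * (o w - p (X w)) = kap (X w) / ph (X w) * (o w - p (X w)) * e (X w).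
    by rewrite /h2; ring.
  rewrite normrM; apply: ler_wpM2r => //; rewrite normrM; apply: ler_pM => //.
    rewrite normrM normfV (gtr0_norm ph0); apply: ler_pM => //.
      by rewrite invr_ge0 ltW.
    by rewrite lef_pV2 ?posrE.
  have /andP[ o0 o1] := o01 w.
  by rewrite ler_norml; apply/andP; split; lra.
have b3 : {ae P, forall w, `|h3 (X w)| <= C / c' * (`|e (X w)| * `|p (X w) - ph (X w)|)}.
  apply: filterS2 ph_ge kapC => w phw kw.
  rewrite /h3 !normrM -mulrA [leRHS](_ : _ = C * (`|e (X w)| * (`|p (X w) - ph (X w)| / c'))).
    apply: ler_pM => //; rewrite ?mulr_ge0//; apply: ler_wpM2l => //.
    exact: ratio_sub1.
  by ring.
have r3 : rint P (fun w => h3 (X w)).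
  apply: (rint_dom_ae _ b3); last exact: rintZ.
  exact: measurableT_comp.
have DE : {ae P, forall w, arm_error ph e w = h1 (X w) * N w + h2 (X w) * (o w - p (X w)) + h3 (X w)}.
  apply: filterS ph_ge => w phw; rewrite /arm_error /U /h1 /h2 /h3.
  have : ph (X w) != 0 by rewrite gt_eqF// (lt_le_trans c'0).
  by move=> ?; ring.
rewrite (Ex_eq_ae rint_arm_error _ DE); last by apply: rintD => //; exact: rintD.
rewrite ExD//; last exact: rintD.
rewrite ExD// (cmean0_mul mX cN mh1 r1) (cmean0_mul mX cop mh2 r2) !add0r.
apply: (@le_trans _ _ (Ex P (fun w => `|h3 (X w)|))).
  by apply: Ex_abs_le => //; exact: rint_norm.
rewrite -ExZ//; apply: Ex_le_ae => //; [exact: rint_norm|exact: rintZ].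
Qed.

End estimates.

(** The threshold [del] is chosen before the fitted functions, so it can define an event of training
    samples. The mean has its own parameter [k], because the rate concerns the product of the two
    errors. *)
Lemma arm_error_bounds (c' eps : R) : 0 < c' -> 0 < eps -> exists2 del : R, 0 < del &
  forall (ph e : E -> R) (k : R), measurable_fun [set: E] ph -> measurable_fun [set: E] e ->
  {ae P, forall w, c' <= ph (X w)} -> rint P (fun w => e (X w) ^+ 2) ->
  rint P (fun w => (p (X w) - ph (X w)) ^+ 2) -> Ex P (fun w => e (X w) ^+ 2) <= del ->
  Ex P (fun w => (p (X w) - ph (X w)) ^+ 2) <= del -> 0 <= k ->
  Ex P (fun w => (p (X w) - ph (X w)) ^+ 2) * Ex P (fun w => e (X w) ^+ 2) <= k ^+ 2 ->
  [/\ rint P (arm_error ph e), rint P (fun w => arm_error ph e w ^+ 2),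
      Ex P (fun w => arm_error ph e w ^+ 2) <= eps & `|Ex P (arm_error ph e)| <= C / c' * k].
Proof.
move=> c'0 eps0; pose K0 := c'^-1 + 1.
have K00 : 0 < K0 by rewrite addr_gt0// invr_gt0.
have t0 : 0 < eps / 2 / (2 * K0 ^+ 2) by rewrite !divr_gt0// mulr_gt0// exprn_gt0.
(* The truncation level makes the tail of U^2 cost eps / 2; [del], which depends on [M], makes the
   two other terms cost eps / 2 together. *)
have [M M0 tail] := Ex_tail rU (fun w => sqr_ge0 (U w)) t0.
pose a := 2 * M / c' ^+ 2; pose b := 2 * C ^+ 2 * K0 ^+ 2.
have a0 : 0 <= a by rewrite divr_ge0 ?sqr_ge0// mulr_ge0.
have b0 : 0 <= b by rewrite mulr_ge0 ?sqr_ge0// mulr_ge0 ?sqr_ge0.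
have ab0 : 0 < a + b + 1 by rewrite ltr_wpDl// addr_ge0.
exists (eps / 2 / (a + b + 1)); first by rewrite !divr_gt0.
move=> ph e k mph me phc re rd ed dd k0 kk.
have [rsq lesq] := arm_error_sqr mph me c'0 phc re rd M0.
split; [exact: (rint_arm_error mph me c'0)|exact: rsq| |].
- apply: (le_trans lesq); rewrite -/K0 -/a -/b [leRHS]splitr -addrA; apply: lerD.
    by rewrite mulrC -ler_pdivlMr// mulr_gt0// exprn_gt0.
  apply: (@le_trans _ _ ((a + b) * (eps / 2 / (a + b + 1)))).
    by rewrite mulrDl; apply: lerD; apply: ler_wpM2l.
  rewrite mulrA ler_pdivrMr// mulrC; apply: ler_wpM2l; first by rewrite divr_ge0// ltW.
  by rewrite lerDl.
- apply: (le_trans (arm_error_mean mph me c'0 phc re rd)).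
  apply: ler_wpM2l; first by rewrite divr_ge0// ltW.
  rewrite -(@ler_pXn2r _ 2)// ?nnegrE//; last by apply: Ex_ge0 => w; exact: mulr_ge0.
  have meX := measurableT_comp me mX.
  have mdX : measurable_fun [set: T] (fun w => p (X w) - ph (X w)).
    by apply: measurable_funB; exact: measurableT_comp.
  by apply: (le_trans (Ex_cauchy_schwarz meX mdX re rd)); rewrite mulrC.
Qed.

End one_arm.

(** * The L2 distance *)

Section l2_distance.
Context (R : realType) d (T : measurableType d) (P : probability T R).
Context dE (E : measurableType dE) (X : {RV P >-> E}).

(** Kept as an extended real, since a fitted function need not be square integrable; without the
    root, it is measurable in the training sample directly by Tonelli. *)
Definition l2_sqr (f h : E -> R) : \bar R := (\int[P]_w ((f (X w) - h (X w)) ^+ 2)%:E)%E.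

Lemma l2_sqr_ge0 f h : (0 <= l2_sqr f h)%E.
Proof. by apply: integral_ge0 => w _; rewrite lee_fin sqr_ge0. Qed.

Lemma l2_dist_sqrte f h : measurable_fun [set: E] f -> measurable_fun [set: E] h ->
  l2_dist X f h = sqrte (l2_sqr f h).
Proof.
move=> mf mh; rewrite /l2_dist unlock poweR12_sqrt; last first.
  by apply: integral_ge0 => x _; exact: poweR_ge0.
congr sqrte; rewrite /distribution ge0_integral_pushforward //.
- rewrite preimage_setT; apply: eq_integral => w _ /=.
  by rewrite powR_mulrn// real_normK// num_real.
- have mfh : measurable_fun [set: E] (fun e => (f e - h e) ^+ 2).
    by apply: measurable_funX; exact: measurable_funB.
  rewrite (_ : (fun e => _) = EFin \o (fun e => (f e - h e) ^+ 2)); first exact/measurable_EFinP.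
  by apply/funext => e /=; rewrite powR_mulrn// real_normK// num_real.
- by move=> e _; exact: poweR_ge0.
Qed.

Lemma sqrte_gtE (r : R) (x : \bar R) : 0 <= r -> (0 <= x)%E ->
  (r%:E < `|sqrte x|)%E = ((r ^+ 2)%:E < x)%E.
Proof.
move=> r0 x0; rewrite gee0_abs ?sqrte_ge0//.
have -> : r%:E = sqrte (r ^+ 2)%:E by rewrite /= sqrtr_sqr ger0_norm.
by rewrite !ltNge lee_sqrt// lee_fin sqr_ge0.
Qed.

Lemma l2_dist_gtE (r : R) f h : 0 <= r -> measurable_fun [set: E] f ->
  measurable_fun [set: E] h ->
  (r%:E < `|l2_dist X f h|)%E = ((r ^+ 2)%:E < l2_sqr f h)%E.
Proof. by move=> r0 mf mh; rewrite l2_dist_sqrte// sqrte_gtE// l2_sqr_ge0. Qed.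

Lemma l2_dist_mul_gtE (r : R) f h f' h' : 0 <= r -> measurable_fun [set: E] f ->
  measurable_fun [set: E] h -> measurable_fun [set: E] f' -> measurable_fun [set: E] h' ->
  (r%:E < `|l2_dist X f h * l2_dist X f' h'|)%E =
  ((r ^+ 2)%:E < l2_sqr f h * l2_sqr f' h')%E.
Proof.
move=> r0 mf mh mf' mh'; rewrite !l2_dist_sqrte// -sqrteM ?l2_sqr_ge0// sqrte_gtE//.
by rewrite mule_ge0// l2_sqr_ge0.
Qed.

Lemma l2_sqr_le_rint (r : R) f h : measurable_fun [set: E] f ->
  measurable_fun [set: E] h -> (l2_sqr f h <= r%:E)%E ->
  rint P (fun w => (f (X w) - h (X w)) ^+ 2) /\
  l2_sqr f h = (Ex P (fun w => (f (X w) - h (X w)) ^+ 2))%:E.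
Proof.
move=> mf mh lr; have mX := measurable_funPT X.
have rs : rint P (fun w => (f (X w) - h (X w)) ^+ 2).
  apply/integrableP; split.
    apply/measurable_EFinP; apply: measurable_funX.
    by apply: measurable_funB; exact: measurableT_comp.
  rewrite (_ : (\int[P]_w _)%E = l2_sqr f h); first by apply: (le_lt_trans lr); exact: ltry.
  by apply: eq_integral => w _; rewrite /= ger0_norm// sqr_ge0.
by split=> //; rewrite ExE.
Qed.

Lemma measurable_l2_sqr d1 (T1 : measurableType d1) (f : E -> R) (h : T1 * E -> R) :
  measurable_fun [set: E] f -> measurable_fun [set: T1 * E] h ->
  measurable_fun [set: T1] (fun z => l2_sqr f (fun e => h (z, e))).
Proof.
move=> mf mh.
have mX := measurable_funPT X.
apply: (@measurable_fun_fubini_tonelli_F _ _ T1 T R P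
  (fun zw => ((f (X zw.2) - h (zw.1, X zw.2)) ^+ 2)%:E)) => //.
- apply/measurable_EFinP; apply: measurable_funX; apply: measurable_funB.
    apply: measurableT_comp => //; apply: measurableT_comp => //; exact: measurable_snd.
  apply: (measurableT_comp mh); apply/measurable_fun_pair; first exact: measurable_fst.
  by apply: measurableT_comp => //; exact: measurable_snd.
- by move=> z; rewrite lee_fin sqr_ge0.
Qed.

Lemma measurable_probability_lt d1 (T1 : measurableType d1) (h : T1 * E -> R) (c : R) :
  measurable_fun [set: T1 * E] h ->
  measurable_fun [set: T1] (fun z => P [set w | h (z, X w) < c]).
Proof.
move=> mh; have mX := measurable_funPT X.
pose A := [set zw : T1 * T | h (zw.1, X zw.2) < c].
have mhX : measurable_fun [set: T1 * T] (fun zw => h (zw.1, X zw.2)).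
  apply: (measurableT_comp mh); apply/measurable_fun_pair; first exact: measurable_fst.
  by apply: measurableT_comp => //; exact: measurable_snd.
have mA : measurable A by exact: measurable_set_lt.
have := measurable_fun_xsection P mA; congr measurable_fun; apply/funext => z /=.
by congr (P _); apply/seteqP; split => w; rewrite /xsection /= inE.
Qed.

End l2_distance.

Section distribution_expectation.
Context (R : realType) d (T : measurableType d) (P : probability T R).
Context dS (S : measurableType dS) (Z : {RV P >-> S}).

Lemma rint_distribution (h : S -> R) : measurable_fun [set: S] h ->
  rint P (h \o Z) -> rint (distribution P Z) h.
Proof.
move=> mh /integrableP[_ ih]; apply/integrableP; split; first exact/measurable_EFinP.
rewrite ge0_integral_pushforward//.
by apply: measurableT_comp => //; exact/measurable_EFinP.
Qed.

Lemma Ex_distribution (h : S -> R) : measurable_fun [set: S] h ->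
  rint P (h \o Z) -> Ex (distribution P Z) h = Ex P (h \o Z).
Proof.
move=> mh rh; rewrite /Ex /Rintegral; congr fine.
by rewrite integral_pushforward//; exact/measurable_EFinP.
Qed.

End distribution_expectation.

(** The parameter in [T1] is the training sample: the score must be measurable jointly in the sample
    and the observation for Tonelli to apply. *)
Lemma measurable_Scens (R : realType) d1 (T1 : measurableType d1) dE (E : measurableType dE)
    (mu nu : T1 * E -> R) (pi g : bool -> T1 * E -> R) :
  measurable_fun [set: T1 * E] mu -> measurable_fun [set: T1 * E] nu ->
  (forall a, measurable_fun [set: T1 * E] (pi a)) ->
  (forall a, measurable_fun [set: T1 * E] (g a)) ->
  measurable_fun [set: T1 * (E * bool * R)] (fun zs => Scens (fun e => mu (zs.1, e))
    (fun e => nu (zs.1, e)) (fun a e => pi a (zs.1, e)) (fun a e => g a (zs.1, e)) zs.2).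
Proof.
move=> mmu mnu mpi mg.
pose j (zs : T1 * (E * bool * R)) : T1 * E := (zs.1, zs.2.1.1).
have mj : measurable_fun [set: T1 * (E * bool * R)] j.
  apply/measurable_fun_pair; first exact: measurable_fst.
  apply: (measurableT_comp (@measurable_fst _ _ E bool)).
  apply: (measurableT_comp (@measurable_fst _ _ (E * bool)%type R)).
  exact: measurable_snd.
have mO (o : bool) : measurable_fun [set: T1 * (E * bool * R)]
    (fun zs => (zs.2.1.2 == o)%:R : R).
  rewrite (_ : (fun zs => _) = (fun b : bool => (b == o)%:R : R) \o (fun zs => zs.2.1.2))//.
  apply: measurableT_comp => //.
  apply: (measurableT_comp (@measurable_snd _ _ E bool)).
  apply: (measurableT_comp (@measurable_fst _ _ (E * bool)%type R)).
  exact: measurable_snd.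
have mY : measurable_fun [set: T1 * (E * bool * R)] (fun zs => zs.2.2 : R).
  apply: (measurableT_comp (@measurable_snd _ _ (E * bool)%type R)).
  exact: measurable_snd.
have mc (f : T1 * E -> R) : measurable_fun [set: T1 * E] f ->
   measurable_fun [set: T1 * (E * bool * R)] (f \o j) by move=> mf; exact: measurableT_comp.
rewrite (_ : (fun zs => _) = fun zs =>
  (zs.2.1.2 == true)%:R * (zs.2.2 - (mu \o j) zs) * ((pi true \o j) zs)^-1
  - (zs.2.1.2 == false)%:R * (zs.2.2 - (nu \o j) zs) *
    ((g false \o j) zs * (pi false \o j) zs)^-1
  + (g true \o j) zs * (zs.2.1.2 == true)%:R * (zs.2.2 - (mu \o j) zs) *
    ((g false \o j) zs * (pi true \o j) zs)^-1
  + (mu \o j) zs - ((g false \o j) zs)^-1 * (nu \o j) zs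
  + (g true \o j) zs * ((g false \o j) zs)^-1 * (mu \o j) zs); last first.
  by apply/funext => -[z [[x o] y]].
have mdiff (f : T1 * E -> R) : measurable_fun [set: T1 * E] f ->
   measurable_fun [set: T1 * (E * bool * R)] (fun zs => zs.2.2 - (f \o j) zs).
  by move=> mf; apply: measurable_funB => //; exact: mc.
have mgp a : measurable_fun [set: T1 * (E * bool * R)]
    (fun zs => ((g false \o j) zs * (pi a \o j) zs)^-1).
  by apply: measurable_funV; apply: measurable_funM; exact: mc.
have mgV : measurable_fun [set: T1 * (E * bool * R)] (fun zs => ((g false \o j) zs)^-1).
  by apply: measurable_funV; exact: mc.
apply: measurable_funD; last first.
  apply: measurable_funM; last exact: mc.
  by apply: measurable_funM => //; exact: mc.
apply: measurable_funB; last by apply: measurable_funM => //; exact: mc.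
apply: measurable_funD; last exact: mc.
apply: measurable_funD; last first.
  apply: measurable_funM; last exact: mgp.
  apply: measurable_funM; last exact: mdiff.
  by apply: measurable_funM; [exact: mc|exact: mO].
apply: measurable_funB.
  apply: measurable_funM; last by apply: measurable_funV; exact: mc.
  by apply: measurable_funM; [exact: mO|exact: mdiff].
apply: measurable_funM; last exact: mgp.
by apply: measurable_funM; [exact: mO|exact: mdiff].
Qed.

(** * The population *)

Section bounded_weights.
Context (R : realType) d (T : measurableType d) (P : probability T R).
Context dE (E : measurableType dE) (X : {RV P >-> E}).

Lemma rint_mulX (h : E -> R) (Z : T -> R) (B : R) : measurable_fun [set: E] h ->
  {ae P, forall w, `|h (X w)| <= B} -> rint P Z -> rint P (fun w => h (X w) * Z w).
Proof.
move=> mh hB rZ; apply: (rint_dom_ae (g := fun w => B * `|Z w|)).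
- apply: measurable_funM; last exact: rint_measurable rZ.
  exact: measurableT_comp.
- by apply: filterS hB => w hw; rewrite normrM; apply: ler_wpM2r.
- by apply: rintZ; exact: rint_norm.
Qed.

(** A centering that only concerns the stratum weighted by [i] forces [q] to vanish there. As the
    stratum has conditional probability at least [c] everywhere, no set of values of [X] with
    positive probability escapes it. *)
Lemma cmean0_eq0_on (i : T -> R) (pf q : E -> R) (c : R) : 0 < c ->
  (forall w, 0 <= i w) -> (forall w, c < pf (X w)) -> measurable_fun [set: E] pf ->
  cmean0 P X (fun w => i w - pf (X w)) -> rint P i ->
  measurable_fun [set: E] q -> cmean0 P X (fun w => i w * q (X w)) ->
  {ae P, forall w, q (X w) = 0}.
Proof.
move=> c0 i0 pfc mpf cip ri mq cq; have mX := measurable_funPT X.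
pose s e : R := if 0 <= q e then 1 else -1.
have ms : measurable_fun [set: E] s.
  by apply: measurable_fun_ifT => //; exact: measurable_fun_ler.
have sE w : s (X w) * (i w * q (X w)) = i w * `|q (X w)|.
  rewrite /s; case: ifP => [h|/negbT]; first by rewrite mul1r ger0_norm.
  by rewrite -ltNge => h; rewrite mulN1r ltr0_norm// mulrN.
have rq : rint P (fun w => i w * `|q (X w)|).
  rewrite -(funext sE); apply: (rint_mulX (B := 1) ms); last by case: cq.
  by apply: aeW => w; rewrite /s; case: ifP; rewrite ?normrN normr1.
have E0 : Ex P (fun w => i w * `|q (X w)|) = 0.
  by rewrite -(eq_Ex P sE); apply: cmean0_mul => //; rewrite (funext sE).
have iq0 : {ae P, forall w, i w * `|q (X w)| = 0}.
  by apply: Ex_eq0_ae => // w; exact: mulr_ge0.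
pose A := [set e | q e != 0].
have mA : measurable A.
  rewrite (_ : A = q @^-1` (~` [set 0])); last first.
    by apply/seteqP; split => e /= /eqP.
  by apply: measurable_preimage => //; exact: measurableC.
have rA : rint P (fun w => \1_A (X w) * i w) by exact: rint_indicM.
have rpf : rint P (pf \o X).
  have := rintB ri (cip.1); congr rint; apply/funext => w /=; ring.
have rAp : rint P (fun w => \1_A (X w) * pf (X w)) by exact: rint_indicM.
have EA : Ex P (fun w => \1_A (X w) * pf (X w)) = 0.
  have [_ /(_ A mA)] := cip.
  rewrite (eq_Ex P (g := fun w => \1_A (X w) * i w - \1_A (X w) * pf (X w))); last first.
    by move=> w; rewrite mulrBr.
  rewrite ExB// (_ : Ex P (fun w => \1_A (X w) * i w) = 0); first by move/eqP; rewrite sub0r oppr_eq0 => /eqP.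
  rewrite -[RHS](Ex_cst P 0); apply: Ex_eq_ae => //; first exact: rint_cst.
  apply: filterS iq0 => w /eqP; rewrite mulf_eq0 => /orP[/eqP->|]; first by rewrite mulr0.
  by rewrite normr_eq0 => /eqP qw; rewrite indicE memNset ?mul0r//= /A /= qw eqxx.
have := Ex_eq0_ae rAp _ EA.
have h w : 0 <= \1_A (X w) * pf (X w) by rewrite mulr_ge0// ltW// (lt_trans c0).
move=> /(_ h); apply: filterS => w /eqP; rewrite mulf_eq0 => /orP[|].
  rewrite indicE pnatr_eq0 eqb0 notin_setE /A /= => /negP; rewrite negbK => /eqP //.
by rewrite gt_eqF// (lt_trans c0).
Qed.

Lemma cmean0_cond_probability (B : set T) (q : E -> R) : measurable B ->
  measurable_fun [set: E] q -> cmean0 P X (fun w => \1_B w - q (X w)) ->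
  is_cond_probability P X [set: T] B q.
Proof.
move=> mB mq cq; have rB : rint P (\1_B : T -> R) by exact: rint_indic.
have rq : rint P (q \o X).
  have := rintB rB cq.1; congr rint; apply/funext => w /=; ring.
split => // A mA; have mX := measurable_funPT X; rewrite setTI !integral_preimage//.
congr EFin; apply/esym/eqP; rewrite -subr_eq0 -ExB; [|exact: rint_indicM..].
rewrite -(cq.2 A mA); apply/eqP; apply: eq_Ex => w; by rewrite mulrBr.
Qed.

(** Monotone convergence. It allows a square moment to be bounded by an argument that multiplies by
    truncations of [f] only. *)
Lemma rint_sqr_of_truncations (f : T -> R) (B : R) : measurable_fun [set: T] f ->
  (forall k : nat, Ex P (fun w => \1_[set v | `|f v| <= k%:R] w * f w ^+ 2) <= B) ->
  rint P (fun w => f w ^+ 2).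
Proof.
move=> mf fB; pose h k w : R := \1_[set v | `|f v| <= k%:R] w * f w ^+ 2.
have mh k : measurable_fun [set: T] (h k).
  apply: measurable_funM; last exact: measurable_funX.
  by apply: measurable_indic; exact: measurable_abs_le.
have h0 k w : 0 <= h k w by rewrite mulr_ge0// sqr_ge0.
have rh k : rint P (h k).
  apply: (@rint_bounded _ _ _ _ _ (k%:R ^+ 2)) => // w.
  rewrite ger0_norm// /h indicE; case: (boolP (_ \in _)) => [|_]; last by rewrite mul0r sqr_ge0.
  by rewrite inE /= mul1r => fk; exact: ler_sqr_norm.
apply/integrableP; split; first by apply/measurable_EFinP; exact: measurable_funX.
apply: (@le_lt_trans _ _ B%:E); last exact: ltry.
have nd w : nondecreasing_seq ((fun k => (h k w)%:E)).
  move=> a b ab; rewrite lee_fin /h; apply: ler_wpM2r; first exact: sqr_ge0.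
  rewrite !indicE ler_nat; case: (boolP (_ \in [set v | `|f v| <= a%:R])) => //; rewrite inE /= => fa.
  by rewrite mem_set//= (le_trans fa)// ler_nat.
have -> : (\int[P]_w `|(EFin \o (fun w => (f w ^+ 2)%R)) w| = \int[P]_w limn (fun k => (h k w)%:E))%E.
  apply: eq_integral => w _; apply/esym/cvg_lim => //.
  apply: cvg_near_cst; near=> k; rewrite /= ger0_norm ?sqr_ge0// /h indicE mem_set ?mul1r//=.
  by apply/ltW; near: k; exact: nbhs_infty_gtr.
have mc : (\int[P]_w (h k w)%:E)%E @[k --> \oo] --> (\int[P]_w limn (fun k => (h k w)%:E))%E.
  apply: cvg_monotone_convergence => //.
  - by move=> k; exact/measurable_EFinP.
  - by move=> k w _; rewrite lee_fin.
rewrite -(cvg_lim _ mc)//; apply: lime_le; first by apply/cvg_ex; eexists; exact: mc.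
by apply: nearW => k; rewrite -ExE// lee_fin; exact: fB.
Unshelve. all: by end_near. Qed.

End bounded_weights.

Section population.
Context (R : realType) d (T : measurableType d) (P : probability T R).
Context dE (E : measurableType dE) (X : {RV P >-> E}).
Variables (O D : {RV P >-> bool}) (Y1 Y0 : {RV P >-> R}).
Variables (mu nu : E -> R) (pi g : bool -> E -> R) (c : R).
Hypotheses (rY1 : rint P Y1) (rY0 : rint P Y0).
Hypothesis Hpi : forall o, is_cond_probability P X [set: T] [set w | O w = o] (pi o).
Hypothesis Hg : forall a, is_cond_probability P X [set w | O w = false] [set w | D w = a] (g a).
Hypothesis Hmu : is_cond_expectation P X [set: T] Y1 mu.
Hypothesis Hnu : is_cond_expectation P X [set w | O w = false] (Ytilde D Y1 Y0) nu.
Hypothesis UV : cond_independent P X (fun w => (Y1 w, Y0 w)) (fun w => (O w, D w)).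
Hypothesis c0 : 0 < c.
Hypothesis pic : forall o w, c < pi o (X w).
Hypothesis gc : forall a w, c < g a (X w).

Let mX : measurable_fun [set: T] X := measurable_funPT X.
Let iO o : T -> R := \1_[set w | O w = o].
Let iD a : T -> R := \1_[set w | D w = a].

Let mO o : measurable [set w | O w = o].
Proof. exact: (measurable_preimage (measurable_funPT O) (A := [set o])). Qed.
Let mD a : measurable [set w | D w = a].
Proof. exact: (measurable_preimage (measurable_funPT D) (A := [set a])). Qed.
Let rio o : rint P (iO o). Proof. exact: rint_indic. Qed.
Let mpi o : measurable_fun [set: E] (pi o). Proof. by case: (Hpi o). Qed.
Let mg a : measurable_fun [set: E] (g a). Proof. by case: (Hg a). Qed.
Let mmu : measurable_fun [set: E] mu. Proof. by case: Hmu. Qed.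
Let mnu : measurable_fun [set: E] nu. Proof. by case: Hnu. Qed.

Let ioE o w : iO o w = (O w == o)%:R.
Proof.
rewrite /iO indicE; congr (nat_of_bool _)%:R; apply/idP/eqP; rewrite inE//.
Qed.
Let idE a w : iD a w = (D w == a)%:R.
Proof.
rewrite /iD indicE; congr (nat_of_bool _)%:R; apply/idP/eqP; rewrite inE//.
Qed.
Let io_sum w : iO true w + iO false w = 1.
Proof. by rewrite !ioE; case: (O w); rewrite ?addr0 ?add0r. Qed.
Let id_sum w : iD true w + iD false w = 1.
Proof. by rewrite !idE; case: (D w); rewrite ?addr0 ?add0r. Qed.
Let io01 o w : 0 <= iO o w <= 1.
Proof. by rewrite ioE; case: (_ == _); rewrite ?lexx ?ler01. Qed.

Let cpi o : cmean0 P X (fun w => iO o w - pi o (X w)).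
Proof. by case: (cond_probability_cmean0 (mO o) (Hpi o)). Qed.
Let cg a : cmean0 P X (fun w => iO false w * iD a w - iO false w * g a (X w)).
Proof.
by case: (cond_expectation_cmean0 (mO false) _ (Hg a)) => //; apply: rint_indic_mul => //; exact: rint_indic.
Qed.
Let cmu : cmean0 P X (fun w => Y1 w - mu (X w)).
Proof.
have [] := cond_expectation_cmean0 measurableT _ Hmu; first exact: rint_indic_mul.
by move=> _; congr cmean0; apply/funext => w; rewrite indicT !mul1r.
Qed.
Let rmu : rint P (mu \o X).
Proof. have := rintB rY1 cmu.1; congr rint; apply/funext => w /=; ring. Qed.

Lemma propensity_le1 o : {ae P, forall w, c <= pi o (X w) <= 1}.
Proof.
have : {ae P, forall w, 1 - pi true (X w) - pi false (X w) = 0}.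
  apply: (@cmean0_ae_eq0 R _ T P _ E X mX (fun e => 1 - pi true e - pi false e)).
    by apply: measurable_funB => //; exact: measurable_funB.
  have := cmean0D mX (cpi true) (cpi false); congr cmean0; apply/funext => w /=.
  by rewrite -(io_sum w); ring.
apply: filterS => w h; have p1 := pic true w; have p2 := pic false w.
by case: o; apply/andP; split; move: h p1 p2 c0; lra.
Qed.

(** That both values of [g] sum to 1 is known on the stratum O = 0 only; [cmean0_eq0_on] extends it
    to almost all values of [X]. *)
Lemma treatment_probability_le1 a : {ae P, forall w, c <= g a (X w) <= 1}.
Proof.
have : {ae P, forall w, 1 - g true (X w) - g false (X w) = 0}.
  apply: (@cmean0_eq0_on R _ T P _ E X (iO false) (pi false) (fun e => 1 - g true e - g false e) c) => //.
    by apply: measurable_funB => //; exact: measurable_funB.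
  have := cmean0D mX (cg true) (cg false); congr cmean0; apply/funext => w /=.
  by rewrite -[X in _ = _ * (X - _ - _)](id_sum w); ring.
apply: filterS => w h; have p1 := gc true w; have p2 := gc false w.
by case: a; apply/andP; split; move: h p1 p2 c0; lra.
Qed.

(** Almost surely both weights equal 1 / g(0 | X). The form of [weight1] is what results from
    collecting the terms in [mu] of the score. *)
Definition weight1 e := 1 + g true e / g false e.
Definition weight0 e := (g false e)^-1.
Definition residual1 w := iO true w * (Y1 w - mu (X w)).
Definition residual0 w := iO false w * (Ytilde D Y1 Y0 w - nu (X w)).

Lemma measurable_weight1 : measurable_fun [set: E] weight1.
Proof.
by apply: measurable_funD => //; apply: measurable_funM => //; exact: measurable_funV.
Qed.

Lemma measurable_weight0 : measurable_fun [set: E] weight0.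
Proof. exact: measurable_funV. Qed.

Lemma weight1_le : {ae P, forall w, `|weight1 (X w)| <= 1 + c^-1}.
Proof.
apply: filterS (treatment_probability_le1 true) => w /andP[h1 h2].
have gf := gc false w; have gf0 := lt_trans c0 gf.
rewrite ger0_norm; last by rewrite addr_ge0// divr_ge0 ?ltW// (lt_trans c0).
rewrite lerD2l; apply: (@le_trans _ _ (g false (X w))^-1).
  by rewrite ler_piMl// invr_ge0 ltW.
by rewrite lef_pV2 ?posrE// ltW.
Qed.

Lemma weight0_le : {ae P, forall w, `|weight0 (X w)| <= 1 + c^-1}.
Proof.
apply: aeW => w; have gf := gc false w; have gf0 := lt_trans c0 gf.
rewrite ger0_norm; last by rewrite invr_ge0 ltW.
apply: (@le_trans _ _ c^-1); last by rewrite lerDr.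
by rewrite lef_pV2 ?posrE// ltW.
Qed.

Lemma inv_propensity_le o : {ae P, forall w, `|(pi o (X w))^-1| <= c^-1}.
Proof.
apply: aeW => w; have h := pic o w; have h0 := lt_trans c0 h.
by rewrite gtr0_norm ?invr_gt0// lef_pV2 ?posrE// ltW.
Qed.

Let rYtl : rint P (Ytilde D Y1 Y0).
Proof.
have := rintD (rint_indic_mul (mD true) rY1) (rint_indic_mul (mD false) rY0).
congr rint; apply/funext => w; rewrite -/(iD true) -/(iD false) !idE /Ytilde.
by case: (D w); rewrite !(mul1r, mul0r, addr0, add0r).
Qed.

Lemma cmean0_residual0 : cmean0 P X residual0.
Proof.
have [] := cond_expectation_cmean0 (mO false) _ Hnu; first exact: rint_indic_mul.
by move=> _; congr cmean0; apply/funext => w; rewrite /residual0 mulrBr.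
Qed.

(** With [i] the indicator of O = 1, i (Y1 - mu) is the sum of i Y1 - pi Y1, centred by
    unconfoundedness, of pi (Y1 - mu), centred by definition of [mu], and of - mu (i - pi), centred
    by definition of [pi]. *)
Lemma cmean0_residual1 : cmean0 P X residual1.
Proof.
have mV : measurable_fun [set: T] (fun w => (O w, D w)).
  by apply/measurable_fun_pair => //; exact: measurable_funPT.
have mU : measurable_fun [set: T] (fun w => (Y1 w, Y0 w)).
  by apply/measurable_fun_pair => //; exact: measurable_funPT.
have mC : measurable (fst @^-1` [set true] : set (bool * bool)).
  exact: measurable_preimage.
have VC : (fun w => (O w, D w)) @^-1` (fst @^-1` [set true]) = [set w | O w = true] by [].
have := cond_independent_cmean0 mU mV mC UV (r := pi true) _ _ (u := fst).
rewrite VC => /(_ (Hpi true)) [].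
- by move=> w; rewrite ltW// (lt_trans c0).
- exact: measurable_fst.
- exact: rY1.
move=> rpY cY.
have bpi : {ae P, forall w, `|pi true (X w)| <= 1}.
  by apply: filterS (propensity_le1 true) => w /andP[h1 h2]; rewrite ger0_norm// (le_trans (ltW c0)).
have c2 := cmean0_mulX mX cmu (mpi true) (rint_mulX (mpi true) bpi cmu.1).
have rmio : rint P (fun w => - mu (X w) * (iO true w - pi true (X w))).
  have -> : (fun w => - mu (X w) * (iO true w - pi true (X w))) =
      fun w => pi true (X w) * mu (X w) - iO true w * mu (X w).
    by apply/funext => w; ring.
  apply: rintB; first exact: (rint_mulX (mpi true) bpi rmu).
  exact: rint_indic_mul.
have mmuN : measurable_fun [set: E] (fun e => - mu e) by exact: measurableT_comp.
have c3 := cmean0_mulX mX (cpi true) mmuN rmio.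
have := cmean0D mX cY (cmean0D mX c2 c3); congr cmean0; apply/funext => w /=.
by rewrite /residual1 -/(iO true); ring.
Qed.

Definition arm1 w := weight1 (X w) / pi true (X w) * residual1 w.
Definition arm0 w := weight0 (X w) / pi false (X w) * residual0 w.
Definition score_mean e := weight1 e * mu e - weight0 e * nu e.
Definition score w := arm1 w - arm0 w + score_mean (X w).

Lemma score_E w : score w = Scens mu nu pi g (X w, O w, Yobs O D Y1 Y0 w).
Proof.
rewrite /score /arm1 /arm0 /score_mean /residual1 /residual0 /weight1 /weight0 /Scens /Yobs !ioE.
have g0 : g false (X w) != 0 by rewrite gt_eqF// (lt_trans c0).
have p1 : pi true (X w) != 0 by rewrite gt_eqF// (lt_trans c0).
have p0 : pi false (X w) != 0 by rewrite gt_eqF// (lt_trans c0).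
by case: (O w); rewrite /=; field; rewrite g0 p0 p1.
Qed.

Lemma measurable_score_mean : measurable_fun [set: E] score_mean.
Proof.
apply: measurable_funB; apply: measurable_funM => //.
  exact: measurable_weight1.
exact: measurable_weight0.
Qed.

Lemma rint_arm1 : rint P arm1.
Proof.
have mw : measurable_fun [set: E] (fun e => weight1 e / pi true e).
  by apply: measurable_funM; [exact: measurable_weight1|exact: measurable_funV].
apply: (rint_mulX (B := (1 + c^-1) * c^-1) mw); last by case: cmean0_residual1.
apply: filterS2 weight1_le (inv_propensity_le true) => w h1 h2.
by rewrite normrM; apply: ler_pM.
Qed.

Lemma rint_arm0 : rint P arm0.
Proof.
have mw : measurable_fun [set: E] (fun e => weight0 e / pi false e).
  by apply: measurable_funM; [exact: measurable_weight0|exact: measurable_funV].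
apply: (rint_mulX (B := (1 + c^-1) * c^-1) mw); last by case: cmean0_residual0.
apply: filterS2 weight0_le (inv_propensity_le false) => w h1 h2.
by rewrite normrM; apply: ler_pM.
Qed.

Lemma cmean0_arm1 : cmean0 P X arm1.
Proof.
have mw : measurable_fun [set: E] (fun e => weight1 e / pi true e).
  by apply: measurable_funM; [exact: measurable_weight1|exact: measurable_funV].
exact: (cmean0_mulX mX cmean0_residual1 mw rint_arm1).
Qed.

Lemma cmean0_arm0 : cmean0 P X arm0.
Proof.
have mw : measurable_fun [set: E] (fun e => weight0 e / pi false e).
  by apply: measurable_funM; [exact: measurable_weight0|exact: measurable_funV].
exact: (cmean0_mulX mX cmean0_residual0 mw rint_arm0).
Qed.

(** * Consequences of a finite variance of the score *)

Section square_integrable_score.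
Hypothesis rS : rint P (fun w => score w ^+ 2).

Let mscore : measurable_fun [set: T] score.
Proof.
apply: measurable_funD; last exact: measurableT_comp measurable_score_mean mX.
by apply: measurable_funB; [exact: rint_measurable rint_arm1|exact: rint_measurable rint_arm0].
Qed.

(** For a truncation h of the projection, the arms being centred, E[h S] = E[h^2]; with 2 h S <= h^2
    + S^2 this gives E[h^2] <= E[S^2], uniformly in the truncation. *)
Lemma rint_score_mean_sqr : rint P (fun w => score_mean (X w) ^+ 2).
Proof.
have mm := measurable_score_mean.
have mmX : measurable_fun [set: T] (score_mean \o X) by exact: measurableT_comp.
apply: (@rint_sqr_of_truncations _ _ _ P (score_mean \o X) (Ex P (fun w => score w ^+ 2))) => // k.
pose A := [set e | `|score_mean e| <= k%:R].
have mA : measurable A by exact: measurable_abs_le.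
pose h e : R := \1_A e * score_mean e.
have mh : measurable_fun [set: E] h by apply: measurable_funM => //; exact: measurable_indic.
have hk e : `|h e| <= k%:R.
  rewrite /h indicE; case: (boolP (_ \in _)) => [|_]; last by rewrite mul0r normr0.
  by rewrite inE mul1r.
have hb : {ae P, forall w, `|h (X w)| <= k%:R} by apply: aeW => w; exact: hk.
have r1 := rint_mulX mh hb rint_arm1; have r0 := rint_mulX mh hb rint_arm0.
have rs : rint P (fun w => h (X w) * score w).
  by apply: (rint_mulX mh hb); apply: rint_of_sqr.
have h2E e : h e * score_mean e = h e ^+ 2.
  by rewrite /h indicE; case: (_ \in _); rewrite ?mul1r ?mul0r ?expr0n// expr2.
have rh2 : rint P (fun w => h (X w) ^+ 2).
  apply: (@rint_bounded _ _ _ _ _ (k%:R ^+ 2)) => [|w].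
    by apply: measurable_funX; exact: measurableT_comp.
  by rewrite ger0_norm ?sqr_ge0//; exact: ler_sqr_norm.
have e1 : Ex P (fun w => h (X w) * score w) = Ex P (fun w => h (X w) ^+ 2).
  rewrite (eq_Ex P (g := fun w => h (X w) * arm1 w - h (X w) * arm0 w + h (X w) ^+ 2)); last first.
    by move=> w; rewrite -h2E /score; ring.
  rewrite ExD//; last exact: rintB.
  rewrite ExB// (cmean0_mul mX cmean0_arm1 mh r1) (cmean0_mul mX cmean0_arm0 mh r0).
  by rewrite subrr add0r.
have -> : Ex P (fun w => \1_[set v | `|(score_mean \o X) v| <= k%:R] w * (score_mean \o X) w ^+ 2) =
    Ex P (fun w => h (X w) ^+ 2).
  apply: eq_Ex => w; rewrite -h2E /h -mulrA -expr2; congr (_ * _).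
have : Ex P (fun w => 2 * (h (X w) * score w)) <= Ex P (fun w => h (X w) ^+ 2 + score w ^+ 2).
  apply: Ex_le; [exact: rintZ|exact: rintD|] => w.
  by have := sqr_ge0 (h (X w) - score w); nra.
by rewrite ExZ// ExD// e1; lra.
Qed.

Lemma rint_centered_score_sqr : rint P (fun w => (score w - score_mean (X w)) ^+ 2).
Proof.
have rr := rintD (rintZ 2 rS) (rintZ 2 rint_score_mean_sqr).
apply: (rint_dom _ _ rr).
  apply: measurable_funX; apply: measurable_funB => //.
  exact: measurableT_comp measurable_score_mean mX.
by move=> w; rewrite ger0_norm ?sqr_ge0//; have := sqrrD_le (score w) (- score_mean (X w)); rewrite sqrrN.
Qed.

Lemma rint_arm1_sqr : rint P (fun w => arm1 w ^+ 2).
Proof.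
apply: (rint_dom _ _ rint_centered_score_sqr).
  by apply: measurable_funX; exact: rint_measurable rint_arm1.
move=> w; rewrite ger0_norm ?sqr_ge0// /score addrK /arm1 /arm0 /residual1 /residual0 !ioE.
by case: (O w); rewrite /= !(mul1r, mul0r, mulr0, subr0, sub0r, expr0n, lexx, sqrrN)//= sqr_ge0.
Qed.

Lemma rint_arm0_sqr : rint P (fun w => arm0 w ^+ 2).
Proof.
apply: (rint_dom _ _ rint_centered_score_sqr).
  by apply: measurable_funX; exact: rint_measurable rint_arm0.
move=> w; rewrite ger0_norm ?sqr_ge0// /score addrK /arm1 /arm0 /residual1 /residual0 !ioE.
by case: (O w); rewrite /= !(mul1r, mul0r, mulr0, subr0, sub0r, expr0n, lexx, sqrrN)//= sqr_ge0.
Qed.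

(** The chain rule P(O = 0, D = a | X) = pi(0 | X) g(a | X), which lets unconfoundedness be applied
    to the strata of the pair (O, D). *)
Lemma cmean0_stratum a : cmean0 P X
  (fun w => iO false w * iD a w - pi false (X w) * g a (X w)).
Proof.
have bg : {ae P, forall w, `|g a (X w)| <= 1}.
  apply: filterS (treatment_probability_le1 a) => w /andP[h1 h2].
  by rewrite ger0_norm// (le_trans (ltW c0)).
have c2 := cmean0_mulX mX (cpi false) (mg a) (rint_mulX (mg a) bg (cpi false).1).
have := cmean0D mX (cg a) c2; congr cmean0; apply/funext => w /=; ring.
Qed.

Lemma cmean0_stratum_outcome a (Y : T -> R) (u : R * R -> R) :
  Y = (fun w => u (Y1 w, Y0 w)) -> measurable_fun [set: R * R] u -> rint P Y ->
  cmean0 P X (fun w => iO false w * iD a w * Y w - pi false (X w) * g a (X w) * Y w).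
Proof.
move=> YE mu' rY.
have mV : measurable_fun [set: T] (fun w => (O w, D w)).
  by apply/measurable_fun_pair => //; exact: measurable_funPT.
have mU : measurable_fun [set: T] (fun w => (Y1 w, Y0 w)).
  by apply/measurable_fun_pair => //; exact: measurable_funPT.
have mC : measurable ([set false] `*` [set a] : set (bool * bool)) by exact: measurableX.
have VC : (fun w => (O w, D w)) @^-1` ([set false] `*` [set a]) =
   [set w | O w = false] `&` [set w | D w = a] by [].
have mr : measurable_fun [set: E] (fun e => pi false e * g a e) by exact: measurable_funM.
have iE w : \1_([set w | O w = false] `&` [set w | D w = a]) w = iO false w * iD a w :> R.
  by rewrite indicI.
have := cond_independent_cmean0 mU mV mC UV (r := fun e => pi false e * g a e) _ _ (u := u).
rewrite VC => h.
have [] := h _ _ mu'.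
- apply: cmean0_cond_probability => //; first exact: measurableI.
  by have := cmean0_stratum a; congr cmean0; apply/funext => w; rewrite iE.
- by move=> w; rewrite mulr_ge0// ltW// (lt_trans c0).
- by move: rY; rewrite YE.
by move=> _; congr cmean0; apply/funext => w; rewrite iE YE.
Qed.

(** The mean of weight1 mu is that of Y1 + (g1 / g0) Y1. The term in [nu] is carried to the stratum
    O = 0, where [nu] may be replaced by the outcome; splitting by treatment gives (g1 / g0) Y1 +
    Y0, and the ratio terms cancel. *)
Lemma Ex_score : Ex P score = Ex P (fun w => Y1 w - Y0 w).
Proof.
have mw1 := measurable_weight1; have mw0 := measurable_weight0.
have rm : rint P (fun w => score_mean (X w)).
  apply: rint_of_sqr; last exact: rint_score_mean_sqr.
  exact: measurableT_comp measurable_score_mean mX.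
have rwmu : rint P (fun w => weight1 (X w) * mu (X w)) := rint_mulX mw1 weight1_le rmu.
have rwY : rint P (fun w => weight1 (X w) * Y1 w) := rint_mulX mw1 weight1_le rY1.
have rwnu : rint P (fun w => weight0 (X w) * nu (X w)).
  by have := rintB rwmu rm; congr rint; apply/funext => w; rewrite /score_mean; ring.
have e1 : Ex P score = Ex P (fun w => score_mean (X w)).
  have rA := rintB rint_arm1 rint_arm0.
  rewrite /score ExD// ExB; [|exact: rint_arm1|exact: rint_arm0].
  have z0 (Z : T -> R) : cmean0 P X Z -> Ex P Z = 0.
    by case=> rZ /(_ setT measurableT) <-; apply: eq_Ex => w; rewrite indicT mul1r.
  by rewrite (z0 _ cmean0_arm1) (z0 _ cmean0_arm0) subrr add0r.
rewrite e1 /score_mean [LHS]ExB// [RHS]ExB//.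
have e2 : Ex P (fun w => weight1 (X w) * mu (X w)) = Ex P (fun w => weight1 (X w) * Y1 w).
  apply/eqP; rewrite eq_sym -subr_eq0 -ExB//; apply/eqP.
  rewrite -(cmean0_mul mX cmu mw1 (rint_mulX mw1 weight1_le cmu.1)).
  by apply: eq_Ex => w; ring.
(* Division by pi(0 | X) compensates for the restriction to O = 0. *)
pose q e := weight0 e / pi false e.
have mq : measurable_fun [set: E] q by apply: measurable_funM => //; exact: measurable_funV.
have bq : {ae P, forall w, `|q (X w)| <= (1 + c^-1) * c^-1}.
  apply: filterS2 weight0_le (inv_propensity_le false) => w h1 h2.
  by rewrite normrM; apply: ler_pM.
have p0 w : pi false (X w) != 0 by rewrite gt_eqF// (lt_trans c0).
have g0 w : g false (X w) != 0 by rewrite gt_eqF// (lt_trans c0).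
have rioY := rint_indic_mul (mO false) rYtl.
have rion : rint P (fun w => iO false w * nu (X w)).
  by case: (cond_expectation_cmean0 (mO false) rioY Hnu).
have rqn : rint P (fun w => q (X w) * (iO false w * nu (X w))) := rint_mulX mq bq rion.
have rqY : rint P (fun w => q (X w) * (iO false w * Ytilde D Y1 Y0 w)) := rint_mulX mq bq rioY.
have e3 : Ex P (fun w => weight0 (X w) * nu (X w)) =
    Ex P (fun w => q (X w) * (iO false w * nu (X w))).
  apply/eqP; rewrite eq_sym -subr_eq0 -ExB//; apply/eqP.
  have qE w : q (X w) * (iO false w * nu (X w)) - weight0 (X w) * nu (X w) =
      q (X w) * nu (X w) * (iO false w - pi false (X w)).
    by rewrite /q; field; exact: p0.
  rewrite (eq_Ex P qE); apply: (cmean0_mul mX (cpi false) (h := fun e => q e * nu e)).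
    exact: measurable_funM.
  by rewrite -(funext qE); exact: rintB.
have e4 : Ex P (fun w => q (X w) * (iO false w * nu (X w))) =
    Ex P (fun w => q (X w) * (iO false w * Ytilde D Y1 Y0 w)).
  apply/eqP; rewrite eq_sym -subr_eq0 -ExB//; apply/eqP.
  have c4 := cmean0_residual0.
  rewrite -(cmean0_mul mX c4 mq (rint_mulX mq bq c4.1)).
  by apply: eq_Ex => w; rewrite /residual0; ring.
have strat a (Y : T -> R) (u : R * R -> R) : Y = (fun w => u (Y1 w, Y0 w)) ->
    measurable_fun [set: R * R] u -> rint P Y ->
    [/\ rint P (fun w => q (X w) * (iO false w * iD a w * Y w)),
      rint P (fun w => g a (X w) / g false (X w) * Y w) &
      Ex P (fun w => q (X w) * (iO false w * iD a w * Y w)) =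
      Ex P (fun w => g a (X w) / g false (X w) * Y w)].
  move=> YE mu' rY; have c5 := cmean0_stratum_outcome a YE mu' rY.
  have rioY' : rint P (fun w => iO false w * iD a w * Y w).
    have := rint_indic_mul (mO false) (rint_indic_mul (mD a) rY).
    by congr rint; apply/funext => w; rewrite mulrA.
  have r1 := rint_mulX mq bq rioY'; have r2 := rint_mulX mq bq c5.1.
  have qE w : q (X w) * (iO false w * iD a w * Y w) - g a (X w) / g false (X w) * Y w =
     q (X w) * (iO false w * iD a w * Y w - pi false (X w) * g a (X w) * Y w).
    by rewrite /q /weight0; field; rewrite p0 g0.
  have r3 : rint P (fun w => g a (X w) / g false (X w) * Y w).
    by have := rintB r1 r2; congr rint; apply/funext => w; rewrite -qE; ring.
  split=> //; apply/eqP; rewrite -subr_eq0 -ExB//; apply/eqP.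
  by rewrite (eq_Ex P qE); exact: (cmean0_mul mX c5 mq r2).
have [r1 r1' s1] := strat true Y1 fst erefl measurable_fst rY1.
have [r0 r0' s0] := strat false Y0 snd erefl measurable_snd rY0.
have e5 : Ex P (fun w => q (X w) * (iO false w * Ytilde D Y1 Y0 w)) =
    Ex P (fun w => g true (X w) / g false (X w) * Y1 w) + Ex P Y0.
  have -> : Ex P Y0 = Ex P (fun w => g false (X w) / g false (X w) * Y0 w).
    by apply: eq_Ex => w; rewrite divff// mul1r.
  rewrite -s1 -s0 -ExD//; apply: eq_Ex => w; rewrite !idE /Ytilde.
  by case: (D w); rewrite /=; ring.
rewrite e2 e3 e4 e5.
rewrite (eq_Ex P (g := fun w => Y1 w + g true (X w) / g false (X w) * Y1 w)); last first.
  by move=> w; rewrite /weight1; ring.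
by rewrite ExD//; ring.
Qed.

Definition fitted_score (muh nuh : E -> R) (pih : bool -> E -> R) w :=
  Scens muh nuh pih g (X w, O w, Yobs O D Y1 Y0 w).

Lemma fitted_score_error (muh nuh : E -> R) (pih : bool -> E -> R) w :
  fitted_score muh nuh pih w - score w =
  arm_error X (iO true) residual1 (pi true) weight1 (pih true) (fun e => mu e - muh e) w -
  arm_error X (iO false) residual0 (pi false) weight0 (pih false) (fun e => nu e - nuh e) w.
Proof.
rewrite /fitted_score /score /arm_error /arm1 /arm0 /score_mean /residual1 /residual0 /weight1 /weight0.
rewrite /Scens /Yobs !ioE invfM invfM.
have p1 : pi true (X w) != 0 by rewrite gt_eqF// (lt_trans c0).
have p0 : pi false (X w) != 0 by rewrite gt_eqF// (lt_trans c0).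
have h1 (a b : R) : pi true (X w) * a - b = pi true (X w) * a - b * (pi true (X w) / pi true (X w)).
  by rewrite divff// mulr1.
(* The identity must hold for any fitted propensity, zero values included, so the inverses are made
   opaque and only the true propensities are simplified. *)
by case: (O w); rewrite /=; set v1 := (pih true _)^-1; set v0 := (pih false _)^-1;
  set gf := (g false _)^-1; field; rewrite p0 p1.
Qed.

Lemma score_error_bounds (c' eps : R) : 0 < c' -> 0 < eps -> exists2 del : R, 0 < del &
  forall (muh nuh : E -> R) (pih : bool -> E -> R) (k : R),
  measurable_fun [set: E] muh -> measurable_fun [set: E] nuh ->
  (forall a, measurable_fun [set: E] (pih a)) ->
  (forall a, {ae P, forall w, c' <= pih a (X w)}) ->
  (forall a, (l2_sqr X (pi a) (pih a) <= del%:E)%E) ->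
  (l2_sqr X mu muh <= del%:E)%E -> (l2_sqr X nu nuh <= del%:E)%E -> 0 <= k ->
  (l2_sqr X (pi true) (pih true) * l2_sqr X mu muh <= (k ^+ 2)%:E)%E ->
  (l2_sqr X (pi false) (pih false) * l2_sqr X nu nuh <= (k ^+ 2)%:E)%E ->
  [/\ rint P (fun w => fitted_score muh nuh pih w - score w),
      rint P (fun w => (fitted_score muh nuh pih w - score w) ^+ 2),
      Ex P (fun w => (fitted_score muh nuh pih w - score w) ^+ 2) <= eps &
      `|Ex P (fun w => fitted_score muh nuh pih w - score w)| <= 2 * (1 + c^-1) / c' * k].
Proof.
(* The square of a difference is at most twice the sum of the squares, so each arm may contribute
   eps / 4. *)
move=> c'0 eps0; have e40 : 0 < eps / 4 by rewrite divr_gt0.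
have C0 : 0 <= 1 + c^-1 by rewrite addr_ge0// invr_ge0 ltW.
have mio o : measurable_fun [set: T] (iO o) := rint_measurable (rio o).
have [d1 d10 H1] := arm_error_bounds mX (mio true) (io01 true) (mpi true) measurable_weight1
  cmean0_residual1 (cpi true) rint_arm1_sqr c0 C0 (propensity_le1 true) weight1_le c'0 e40.
have [d2 d20 H2] := arm_error_bounds mX (mio false) (io01 false) (mpi false) measurable_weight0
  cmean0_residual0 (cpi false) rint_arm0_sqr c0 C0 (propensity_le1 false) weight0_le c'0 e40.
exists (Num.min d1 d2); first by rewrite lt_min d10.
move=> muh nuh pih k mmuh mnuh mpih pihc lpi lmu lnu k0 k1 k2.
have min1 : Num.min d1 d2 <= d1 by rewrite ge_min lexx.
have min2 : Num.min d1 d2 <= d2 by rewrite ge_min lexx orbT.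
have [rp1 ep1] := l2_sqr_le_rint (mpi true) (mpih true) (lpi true).
have [rp0 ep0] := l2_sqr_le_rint (mpi false) (mpih false) (lpi false).
have [rm em] := l2_sqr_le_rint mmu mmuh lmu.
have [rn en] := l2_sqr_le_rint mnu mnuh lnu.
have := lpi true; have := lpi false; move: lmu lnu k1 k2.
rewrite ep1 ep0 em en -!EFinM !lee_fin => lmu lnu k1 k2 lp0 lp1.
have me1 : measurable_fun [set: E] (fun e => mu e - muh e) by exact: measurable_funB.
have me0 : measurable_fun [set: E] (fun e => nu e - nuh e) by exact: measurable_funB.
pose A1 := arm_error X (iO true) residual1 (pi true) weight1 (pih true) (fun e => mu e - muh e).
pose A0 := arm_error X (iO false) residual0 (pi false) weight0 (pih false) (fun e => nu e - nuh e).
have [r1 q1 s1 bb1] := H1 _ _ k (mpih true) me1 (pihc true) rm rp1 (le_trans lmu min1)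
  (le_trans lp1 min1) k0 k1.
have [r0 q0 s0 bb0] := H2 _ _ k (mpih false) me0 (pihc false) rn rp0 (le_trans lnu min2)
  (le_trans lp0 min2) k0 k2.
have DE w : fitted_score muh nuh pih w - score w = A1 w - A0 w by exact: fitted_score_error.
have DE2 w : (fitted_score muh nuh pih w - score w) ^+ 2 = (A1 w - A0 w) ^+ 2 by rewrite DE.
rewrite (funext DE) (funext DE2).
have mA : measurable_fun [set: T] (fun w => A1 w - A0 w).
  exact: rint_measurable (rintB r1 r0).
have bnd w : (A1 w - A0 w) ^+ 2 <= 2 * A1 w ^+ 2 + 2 * A0 w ^+ 2.
  by have := sqrrD_le (A1 w) (- A0 w); rewrite sqrrN.
have rb : rint P (fun w => 2 * A1 w ^+ 2 + 2 * A0 w ^+ 2) by apply: rintD; exact: rintZ.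
have rsq : rint P (fun w => (A1 w - A0 w) ^+ 2).
  apply: (rint_dom _ _ rb) => [|w]; first exact: measurable_funX.
  by rewrite ger0_norm ?sqr_ge0.
split=> //; first exact: rintB.
- apply: (le_trans (Ex_le rsq rb bnd)).
  rewrite ExD ?ExZ//; [|exact: rintZ..].
  by move: s1 s0; lra.
- rewrite ExB//; apply: (le_trans (ler_normB _ _)).
  rewrite (_ : 2 * _ / _ * _ = (1 + c^-1) / c' * k + (1 + c^-1) / c' * k); last by ring.
  exact: lerD.
Qed.

End square_integrable_score.

End population.

(** * Asymptotics *)

Lemma ereal_cvg0_sum (R : realType) (I : Type) (s : seq I) (u : I -> nat -> \bar R) :
  (forall i, u i n @[n --> \oo] --> 0%E) ->
  (\sum_(i <- s) u i n)%E @[n --> \oo] --> 0%E.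
Proof.
move=> u0; elim: s => [|i s IH].
  by rewrite (_ : (fun n => _) = fun=> 0%E); [exact: cvg_cst|apply/funext => n; rewrite big_nil].
rewrite (_ : (fun n => _) = fun n => (u i n + \sum_(j <- s) u j n)%E); last first.
  by apply/funext => n; rewrite big_cons.
by rewrite -[X in _ --> X](adde0 0%E); apply: cvgeD.
Qed.

Section studentized_limit.
Context (R : realType) dS (S : measurableType dS) (Q : probability S R).
Context d (T : measurableType d) (P : probability T R).
Variables (psi : S -> R) (W : nat -> T -> S).
Hypothesis mW : forall i, measurable_fun [set: T] (W i).
Hypothesis indepW : mutually_independent P W.
Hypothesis lawW : forall i B, measurable B -> P (W i @^-1` B) = Q B.
Hypothesis mpsi : measurable_fun [set: S] psi.
Hypothesis psi2 : rint Q (fun s => psi s ^+ 2).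
Hypothesis psi0 : Ex Q psi = 0.

(** Zero variance makes [psi] vanish almost everywhere for [Q], so averaging out the last summand
    changes nothing. *)
Lemma degenerate_sum (c : R) n (g : R -> R) : Ex Q (fun s => psi s ^+ 2) = 0 ->
  measurable_fun [set: R] g -> (forall x, `|g x| <= 1) ->
  Ex P (fun w => g (\sum_(i < n) c * psi (W i w))) = g 0.
Proof.
move=> V0 mg g1; elim: n => [|n IH].
  by rewrite -[RHS](Ex_cst P); apply: eq_Ex => w; rewrite big_ord0.
rewrite -IH (eq_Ex P (g := fun w => g (\sum_(j < n) c * psi (W j w) + c * psi (W n w)))); last first.
  by move=> w; rewrite big_ord_recr.
rewrite (psum_indep mW indepW lawW mpsi)//; apply: eq_Ex => w.
rewrite -[RHS](Ex_cst Q); apply: Ex_eq_ae.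
- apply: (@rint_bounded _ _ _ _ _ 1) => // s.
  apply: measurableT_comp => //; apply: measurable_funD => //; exact: measurable_funM.
- exact: rint_cst.
- have := Ex_eq0_ae psi2 (fun s => sqr_ge0 _) V0; apply: filterS => s /eqP.
  by rewrite sqrf_eq0 => /eqP ->; rewrite mulr0 addr0.
Qed.

Variable Y : nat -> T -> R.
Hypothesis mY : forall n, measurable_fun [set: T] (Y n).
Hypothesis Y0 : forall eta : R, 0 < eta ->
  P [set w | eta < `|Y n w|] @[n --> \oo] --> 0%E.

(** The replacement argument divides by nothing but needs a positive deviation; at variance zero the
    sum acts as the constant 0 on test functions, and the same perturbation argument applies to a
    point mass. *)
Lemma clt_cdf (x : R) : let nu := normal_law 0 (Ex Q (fun s => psi s ^+ 2)) in
  {for x, continuous (fun y : R => nu `]-oo, y]%classic)} ->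
  P ((fun w => \sum_(i < n) (Num.sqrt n%:R)^-1 * psi (W i w) + Y n w) @^-1` `]-oo, x]%classic)
    @[n --> \oo] --> nu `]-oo, x]%classic.
Proof.
set V := Ex Q _; pose X n w := \sum_(i < n) (Num.sqrt n%:R)^-1 * psi (W i w).
have mX n : measurable_fun [set: T] (X n).
  apply: measurable_sum => i; apply: measurable_funM => //; exact: measurableT_comp.
have V_ge0 : 0 <= V by apply: Ex_ge0 => s; exact: sqr_ge0.
rewrite /normal_law; case: eqP => [V0|/eqP V0].
- apply: (@slutsky_cdf R d T P (\d_(0 : measurableTypeR R)) X Y mX mY Y0) => k a k0.
  rewrite (_ : Ex _ _ = logistic k a 0); last first.
    rewrite /Ex /Rintegral integral_dirac// ?diracT ?mul1e//.
    by have /measurable_EFinP := measurable_logistic k a.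
  rewrite (_ : (fun n => _) = fun=> logistic k a 0); first exact: cvg_cst.
  apply/funext => n; apply: degenerate_sum => //; first exact: measurable_logistic.
  exact: logistic_norm_le1.
- apply: (@slutsky_cdf R d T P (normal_prob 0 (Num.sqrt V)) X Y mX mY Y0) => k a k0.
  have [K [C [f1 [f2 t2]]]] := logistic_taylor2 a k0.
  rewrite (_ : Ex _ _ = navg (Num.sqrt V) (logistic k a) 0); last first.
    by apply: eq_Ex => y; rewrite add0r.
  apply: (clt_smooth mpsi mW psi2 psi0 (erefl V) _ _ _ t2).
  - by rewrite lt_neqAle V_ge0 eq_sym V0.
  - by move=> c n g mg g1; exact: (psum_indep mW indepW lawW mpsi).
  - by move=> y; rewrite ltW ?logistic_gt0// logistic_le1.
Qed.

End studentized_limit.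

Lemma measurable_gt_set (R : realType) d1 (T1 : measurableType d1) (h : T1 -> \bar R) (r : \bar R) :
  measurable_fun [set: T1] h -> measurable [set z | (r < h z)%E].
Proof.
move=> mh; rewrite (_ : [set z | _] = h @^-1` `]r, +oo[%classic); last first.
  by apply/seteqP; split => z /=; rewrite in_itv/= andbT.
by apply: measurable_preimage => //; exact: emeasurable_itv.
Qed.

(** * The cross-fitted estimator *)

Section cross_fitting_asymptotics.
Context (R : realType) dE (E : measurableType dE).
Local Notation obs := (E * bool * R)%type.
Context d0 (T0 : measurableType d0) (P0 : probability T0 R).
Variables (X : {RV P0 >-> E}) (O D : {RV P0 >-> bool}) (Y1 Y0 : {RV P0 >-> R}).
Variables (mu nu : E -> R) (pi g : bool -> E -> R) (c : R).
Hypotheses (rY1 : rint P0 Y1) (rY0 : rint P0 Y0).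
Hypothesis Hpi : forall o, is_cond_probability P0 X [set: T0] [set w | O w = o] (pi o).
Hypothesis Hg : forall a, is_cond_probability P0 X [set w | O w = false] [set w | D w = a] (g a).
Hypothesis Hmu : is_cond_expectation P0 X [set: T0] Y1 mu.
Hypothesis Hnu : is_cond_expectation P0 X [set w | O w = false] (Ytilde D Y1 Y0) nu.
Hypothesis UV : cond_independent P0 X (fun w => (Y1 w, Y0 w)) (fun w => (O w, D w)).
Hypothesis c0 : 0 < c.
Hypothesis pic : forall o w, c < pi o (X w).
Hypothesis gc : forall a w, c < g a (X w).

Let Z w := (X w, O w, Yobs O D Y1 Y0 w).
Let tau := ate P0 Y1 Y0.
Let V := Vcens P0 mu nu pi g Z tau.
Hypothesis V_fin : (V < +oo)%E.

Context d (T : measurableType d) (P : probability T R).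
Variable W : nat -> {RV P >-> obs}.
Hypothesis indepW : mutually_independent P W.
Hypothesis lawW : forall i B, measurable B -> P (W i @^-1` B) = P0 (Z @^-1` B).
Variables (L : nat) (F : forall n, T -> {ffun 'I_n -> 'I_L}).
Hypothesis foldsF : random_folds P W F.
Variables (muhat nuhat : estimator R L obs E).
Variable pihat : bool -> estimator R L obs E.
Hypotheses (cf_mu : cross_fitted muhat) (cf_nu : cross_fitted nuhat).
Hypothesis cf_pi : forall a, cross_fitted (pihat a).

Let mpi o : measurable_fun [set: E] (pi o). Proof. by case: (Hpi o). Qed.
Let mg a : measurable_fun [set: E] (g a). Proof. by case: (Hg a). Qed.
Let mmu : measurable_fun [set: E] mu. Proof. by case: Hmu. Qed.
Let mnu : measurable_fun [set: E] nu. Proof. by case: Hnu. Qed.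
Let sc := score X O D Y1 Y0 mu nu pi g.
Let scE w : sc w = Scens mu nu pi g (Z w). Proof. exact: (score_E _ _ _ _ _ _ c0 pic gc). Qed.

Let mZ : measurable_fun [set: T0] Z.
Proof.
apply/measurable_fun_pair; first by apply/measurable_fun_pair; exact: measurable_funPT.
have mif (f : {RV P0 >-> bool}) (u v : T0 -> R) : measurable_fun [set: T0] u ->
    measurable_fun [set: T0] v -> measurable_fun [set: T0] (fun w => if f w then u w else v w).
  by move=> mu' mv; apply: measurable_fun_ifT => //; exact: measurable_funPT.
by apply: (mif O) => //; apply: (mif D).
Qed.

Let ZRV : {RV P0 >-> obs} := HB.pack Z (isMeasurableFun.Build _ _ _ _ _ mZ).
Let Q : probability obs R := distribution P0 ZRV.
Let mW i : measurable_fun [set: T] (W i) := measurable_funPT (W i).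
Let lawWQ i B : measurable B -> P (W i @^-1` B) = Q B. Proof. exact: lawW. Qed.

Let psi s := Scens mu nu pi g s - tau.

Let mScens : measurable_fun [set: obs] (Scens mu nu pi g).
Proof.
have m1 (f : E -> R) : measurable_fun [set: E] f ->
    measurable_fun [set: obs * E] (fun zx => f zx.2).
  by move=> mf; apply: (measurableT_comp mf); exact: measurable_snd.
have := @measurable_Scens R _ obs _ E (fun zx => mu zx.2)
  (fun zx => nu zx.2) (fun a zx => pi a zx.2) (fun a zx => g a zx.2) (m1 _ mmu) (m1 _ mnu)
  (fun a => m1 _ (mpi a)) (fun a => m1 _ (mg a)).
have mdup : measurable_fun [set: obs] (fun s => (s, s)).
  by apply/measurable_fun_pair; exact: measurable_id.
by move=> h; exact: (measurableT_comp h mdup).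
Qed.

Let mpsi : measurable_fun [set: obs] psi. Proof. exact: measurable_funB. Qed.

Let rpsiZ : rint P0 (fun w => (sc w - tau) ^+ 2).
Proof.
have e : (fun w => (sc w - tau) ^+ 2) = fun w => psi (ZRV w) ^+ 2.
  by apply/funext => w; rewrite scE.
apply/integrableP; split.
  rewrite e; apply/measurable_EFinP; apply: measurable_funX.
  by apply: measurableT_comp => //; exact: measurable_funPT.
move: V_fin; rewrite /V /Vcens unlock; congr (_ < _)%E; apply: eq_integral => w _.
by rewrite /= ger0_norm ?sqr_ge0// scE.
Qed.

Let rS : rint P0 (fun w => sc w ^+ 2).
Proof.
have ms : measurable_fun [set: T0] sc.
  rewrite (_ : sc = Scens mu nu pi g \o ZRV); last by apply/funext => w; rewrite scE.
  by apply: measurableT_comp => //; exact: measurable_funPT.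
have rb := rintD (rintZ 2 rpsiZ) (rint_cst P0 (2 * tau ^+ 2)).
apply: (rint_dom _ _ rb); first exact: measurable_funX.
by move=> w; rewrite ger0_norm ?sqr_ge0//; have := sqrrD_le (sc w - tau) tau; rewrite subrK.
Qed.

Let VE : fine V = Ex P0 (fun w => (sc w - tau) ^+ 2).
Proof.
rewrite /V /Vcens unlock /Ex /Rintegral; congr fine; apply: eq_integral => w _.
by rewrite /= scE.
Qed.

Let tauE : tau = Ex P0 (fun w => Y1 w - Y0 w).
Proof. by rewrite /tau /ate unlock. Qed.

Let rsc : rint P0 sc.
Proof.
apply: rint_of_sqr => //.
rewrite (_ : sc = Scens mu nu pi g \o ZRV); last by apply/funext => w; rewrite scE.
by apply: measurableT_comp => //; exact: measurable_funPT.
Qed.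

Let psiZ : psi \o ZRV = fun w => sc w - tau.
Proof. by apply/funext => w; rewrite /= scE. Qed.

Let psi2 : rint Q (fun s => psi s ^+ 2).
Proof.
apply: rint_distribution; first exact: measurable_funX.
by move: rpsiZ; congr rint; apply/funext => w; rewrite /= scE.
Qed.

Let psi0 : Ex Q psi = 0.
Proof.
rewrite Ex_distribution//; last by rewrite psiZ; apply: rintB => //; exact: rint_cst.
rewrite psiZ ExB//; last exact: rint_cst.
by rewrite Ex_cst (Ex_score rY1 rY0 Hpi Hg Hmu Hnu UV c0 pic gc rS) tauE subrr.
Qed.

Let psiV : Ex Q (fun s => psi s ^+ 2) = fine V.
Proof.
rewrite VE Ex_distribution; [|exact: measurable_funX|].
  by apply: eq_Ex => w; rewrite /= scE.
by move: rpsiZ; congr rint; apply/funext => w; rewrite /= scE.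
Qed.

(** The training sample and the point of evaluation are separate arguments: in the estimator the
    second is an entry of the first, in the moment bounds it is a fresh draw from [Q]. *)
Let Delta l n f (zs : n.-tuple obs * obs) :=
  Scens (muhat f l zs.1) (nuhat f l zs.1) (fun a => pihat a f l zs.1) g zs.2 -
  Scens mu nu pi g zs.2.

Let mDelta l n f : measurable_fun [set: n.-tuple obs * obs] (@Delta l n f).
Proof.
apply: measurable_funB; last by apply: (measurableT_comp mScens); exact: measurable_snd.
have m1 (h : E -> R) : measurable_fun [set: E] h ->
    measurable_fun [set: n.-tuple obs * E] (fun zx => h zx.2).
  by move=> mf; apply: (measurableT_comp mf); exact: measurable_snd.
exact: (@measurable_Scens R _ _ _ E (fun zx => muhat f l zx.1 zx.2)
  (fun zx => nuhat f l zx.1 zx.2) (fun a zx => pihat a f l zx.1 zx.2) (fun a zx => g a zx.2)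
  (cf_mu f l).1 (cf_nu f l).1 (fun a => (cf_pi a f l).1) (fun a => m1 _ (mg a))).
Qed.

Let DeltaI l n (f : {ffun 'I_n -> 'I_L}) z z' :
  (forall i, f i != l -> tnth z i = tnth z' i) -> forall s, Delta l f (z, s) = Delta l f (z', s).
Proof.
move=> zz' s; rewrite /Delta /= ((cf_mu f l).2 _ _ zz') ((cf_nu f l).2 _ _ zz').
by rewrite (_ : (fun a => pihat a f l z) = fun a => pihat a f l z')//;
  apply/funext => a; exact: (cf_pi a f l).2.
Qed.

Lemma scaled_error_decomposition n w :
  Num.sqrt n%:R * (tau_cens_eff muhat nuhat pihat g W F n w - tau) =
  \sum_(i < n) (Num.sqrt n%:R)^-1 * psi (W i w) +
  \sum_(l < L) fold_remainder W F l (Delta l) n w.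
Proof.
rewrite /fold_remainder -!mulr_sumr -mulrDr.
(* At n = 0 both sides vanish, the inverse of 0 being 0. *)
case: n => [|n]; first by rewrite sqrtr0 invr0 !mul0r.
have s0 : Num.sqrt n.+1%:R != 0 :> R by rewrite gt_eqF// sqrtr_gt0 ltr0n.
have part (u : 'I_n.+1 -> R) : \sum_(i < n.+1) u i =
    \sum_(l < L) \sum_(i < n.+1 | F n.+1 w i == l) u i.
  by rewrite (partition_big (F n.+1 w) xpredT).
rewrite /psi sumrB part sumr_const card_ord -[tau *+ _]mulr_natl.
have -> : tau_cens_eff muhat nuhat pihat g W F n.+1 w = n.+1%:R^-1 *
   \sum_(l < L) (\sum_(i < n.+1 | F n.+1 w i == l) Scens mu nu pi g (W i w) +
    \sum_(i < n.+1 | F n.+1 w i == l) Delta l (F n.+1 w) (sample W n.+1 w, W i w)).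
  congr (_ * _); apply: eq_bigr => l _; rewrite -big_split/=; apply: eq_bigr => i _.
  by rewrite /Delta addrC subrK.
rewrite big_split/=; set a := \sum_(l < L) _; set b := \sum_(l < L) _.
have n0 : n.+1%:R = Num.sqrt n.+1%:R ^+ 2 :> R by rewrite sqr_sqrtr.
set q := Num.sqrt _ in s0 n0 *; rewrite n0; field; exact: s0.
Qed.

Hypothesis overlap : exists2 c' : R, 0 < c' & forall (l : 'I_L) (a : bool),
  P [set w | (0 < P0 [set v | (fitted (pihat a) W F l n w (X v) < c')%R])%E]
    @[n --> \oo] --> 0%E.
Hypothesis rate_pi : forall l a, little_op P
  (fun n w => l2_dist X (pi a) (fitted (pihat a) W F l n w)) (fun=> 1).
Hypothesis rate_mu : forall l, little_op P
  (fun n w => l2_dist X mu (fitted muhat W F l n w)) (fun=> 1).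
Hypothesis rate_nu : forall l, little_op P
  (fun n w => l2_dist X nu (fitted nuhat W F l n w)) (fun=> 1).
Hypothesis rate_pi_mu : forall l a, little_op P
  (fun n w => (l2_dist X (pi a) (fitted (pihat a) W F l n w) *
               l2_dist X mu (fitted muhat W F l n w))%E) (fun n => (Num.sqrt n%:R)^-1).
Hypothesis rate_pi_nu : forall l, little_op P
  (fun n w => (l2_dist X (pi false) (fitted (pihat false) W F l n w) *
               l2_dist X nu (fitted nuhat W F l n w))%E) (fun n => (Num.sqrt n%:R)^-1).

Let mmuhat n (f : {ffun 'I_n -> 'I_L}) l z : measurable_fun [set: E] (muhat f l z).
Proof. exact: measurableT_comp (cf_mu f l).1 (measurable_pair1 z). Qed.
Let mnuhat n (f : {ffun 'I_n -> 'I_L}) l z : measurable_fun [set: E] (nuhat f l z).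
Proof. exact: measurableT_comp (cf_nu f l).1 (measurable_pair1 z). Qed.
Let mpihat a n (f : {ffun 'I_n -> 'I_L}) l z : measurable_fun [set: E] (pihat a f l z).
Proof. exact: measurableT_comp (cf_pi a f l).1 (measurable_pair1 z). Qed.

(** Good training samples avoid eight bad events, indexed by three booleans: two for overlap, two
    for the propensities, one for each outcome regression and one for each product rate. Each has
    vanishing probability by hypothesis. *)
Lemma fold_error_negligible l (eta : R) : 0 < eta ->
  P [set w | eta < `|fold_remainder W F l (Delta l) n w|] @[n --> \oo] --> 0%E.
Proof.
case: foldsF => mF indepF _; case: overlap => c' c'0 ov.
apply: (fold_remainder_negligible mW indepW lawWQ mF indepF (mDelta l) (@DeltaI l)) => eps eps0.
pose C := 2 * (1 + c^-1) / c'.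
have C0 : 0 < C by rewrite divr_gt0// mulr_gt0// addr_gt0// invr_gt0.
(* With k = kappa / sqrt n the mean bound C k of [score_error_bounds] becomes eps / sqrt n. *)
pose kappa := eps / C; have kappa0 : 0 < kappa by rewrite divr_gt0.
have [del del0 Hdel] := score_error_bounds rY1 rY0 Hpi Hg Hmu Hnu UV c0 pic gc rS c'0 eps0.
pose Bad (i : bool * bool * bool) (n : nat) (mh nh : E -> R) (ph : bool -> E -> R) : bool :=
  match i with
  | (true, true, a) => (0 < P0 [set v | (ph a (X v) < c')%R])%E
  | (true, false, a) => (del%:E < l2_sqr X (pi a) (ph a))%E
  | (false, true, true) => (del%:E < l2_sqr X mu mh)%E
  | (false, true, false) => (del%:E < l2_sqr X nu nh)%E
  | (false, false, true) => (((kappa * (Num.sqrt n%:R)^-1) ^+ 2)%:E <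
      l2_sqr X (pi true) (ph true) * l2_sqr X mu mh)%E
  | (false, false, false) => (((kappa * (Num.sqrt n%:R)^-1) ^+ 2)%:E <
      l2_sqr X (pi false) (ph false) * l2_sqr X nu nh)%E
  end.
pose B i n (f : {ffun 'I_n -> 'I_L}) : set (n.-tuple obs) :=
  [set z | Bad i n (muhat f l z) (nuhat f l z) (fun a => pihat a f l z)].
have msqr_mu n (f : {ffun 'I_n -> 'I_L}) :
    measurable_fun [set: n.-tuple obs] (fun z => l2_sqr X mu (muhat f l z)).
  exact: (measurable_l2_sqr X mmu (cf_mu f l).1).
have msqr_nu n (f : {ffun 'I_n -> 'I_L}) :
    measurable_fun [set: n.-tuple obs] (fun z => l2_sqr X nu (nuhat f l z)).
  exact: (measurable_l2_sqr X mnu (cf_nu f l).1).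
have msqr_pi a n (f : {ffun 'I_n -> 'I_L}) :
    measurable_fun [set: n.-tuple obs] (fun z => l2_sqr X (pi a) (pihat a f l z)).
  exact: (measurable_l2_sqr X (mpi a) (cf_pi a f l).1).
have mB i n f : measurable (B i n f).
  case: i => -[[] []] a; [| |case: a|case: a]; apply: measurable_gt_set.
  - exact: (measurable_probability_lt X c' (cf_pi a f l).1).
  - exact: msqr_pi.
  - exact: msqr_mu.
  - exact: msqr_nu.
  - by apply: emeasurable_funM; [exact: msqr_pi|exact: msqr_mu].
  - by apply: emeasurable_funM; [exact: msqr_pi|exact: msqr_nu].
(* The rates concern distances and the bad events squared distances, hence the root of [del]. *)
have sd0 : 0 <= Num.sqrt del by exact: sqrtr_ge0.
have sdE : Num.sqrt del ^+ 2 = del by rewrite sqr_sqrtr// ltW.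
have kn0 n : 0 <= kappa * (Num.sqrt n%:R)^-1 by rewrite mulr_ge0 ?invr_ge0 ?sqrtr_ge0// ltW.
have PB i : P [set w | B i n (F n w) (sample W n w)] @[n --> \oo] --> 0%E.
  have sd_gt0 : 0 < Num.sqrt del by rewrite sqrtr_gt0.
  have pE (f h : nat -> T -> bool) : (forall n w, f n w = h n w) ->
      P [set w | f n w] @[n --> \oo] --> 0%E -> P [set w | h n w] @[n --> \oo] --> 0%E.
    by move=> fh; rewrite (_ : f = h)//; apply/funext => n; apply/funext => w.
  case: i => -[[] []] a; [exact: ov| |case: a|case: a]; rewrite /B /=.
  - apply: pE (rate_pi l a sd_gt0) => n w.
    by rewrite mulr1 l2_dist_gtE// ?sdE//; exact: mpihat.
  - apply: pE (rate_mu l sd_gt0) => n w.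
    by rewrite mulr1 l2_dist_gtE// ?sdE//; exact: mmuhat.
  - apply: pE (rate_nu l sd_gt0) => n w.
    by rewrite mulr1 l2_dist_gtE// ?sdE//; exact: mnuhat.
  - apply: pE (rate_pi_mu l true kappa0) => n w.
    by rewrite l2_dist_mul_gtE//; [exact: mpihat|exact: mmuhat].
  - apply: pE (rate_pi_nu l kappa0) => n w.
    by rewrite l2_dist_mul_gtE//; [exact: mpihat|exact: mnuhat].
exists (fun n f => \bigcap_i ~` B i n f); split.
- by move=> n f; apply: fin_bigcap_measurable => // i _; apply: measurableC; exact: mB.
- move=> n f z z' zz' Gz i _; move: (Gz i I); rewrite /B /setC /=.
  have e3 : (fun a => pihat a f l z) = fun a => pihat a f l z'.
    by apply/funext => a; exact: (cf_pi a f l).2.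
  by rewrite ((cf_mu f l).2 _ _ zz') ((cf_nu f l).2 _ _ zz') e3.
- move=> n f z n_gt0 Gz.
  have sn0 : 0 < Num.sqrt n%:R :> R by rewrite sqrtr_gt0 ltr0n.
  (* Outside the overlap event the set of small fitted values has probability zero, which is an
     almost sure lower bound. *)
  have phc a : {ae P0, forall w, c' <= pihat a f l z (X w)}.
    exists [set v | (pihat a f l z (X v) < c')%R]; split.
    - by apply: measurable_set_lt => //; exact: measurableT_comp.
    - have := Gz (true, true, a) I; rewrite /setC /= => /negP; rewrite -leNgt => p0.
      by apply/eqP; rewrite eq_le p0 measure_ge0.
    - by move=> w /= /negP; rewrite -ltNge.
  have le i : ~ B i n f z by exact: Gz.
  have lpi a : (l2_sqr X (pi a) (pihat a f l z) <= del%:E)%E.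
    by have /negP := le (true, false, a); rewrite -leNgt.
  have lmu : (l2_sqr X mu (muhat f l z) <= del%:E)%E.
    by have /negP := le (false, true, true); rewrite -leNgt.
  have lnu : (l2_sqr X nu (nuhat f l z) <= del%:E)%E.
    by have /negP := le (false, true, false); rewrite -leNgt.
  have lpm : (l2_sqr X (pi true) (pihat true f l z) * l2_sqr X mu (muhat f l z) <=
      ((kappa * (Num.sqrt n%:R)^-1) ^+ 2)%:E)%E.
    by have /negP := le (false, false, true); rewrite -leNgt.
  have lpn : (l2_sqr X (pi false) (pihat false f l z) * l2_sqr X nu (nuhat f l z) <=
      ((kappa * (Num.sqrt n%:R)^-1) ^+ 2)%:E)%E.
    by have /negP := le (false, false, false); rewrite -leNgt.
  have [r1 r2 b2 b1] := Hdel (muhat f l z) (nuhat f l z) (fun a => pihat a f l z) _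
    (mmuhat f l z) (mnuhat f l z) (fun a => mpihat a f l z) phc lpi lmu lnu (kn0 n) lpm lpn.
  have mD : measurable_fun [set: obs] (fun s => Delta l f (z, s)).
    by apply: (measurableT_comp (mDelta l f)); exact: measurable_pair1.
  have DE : (fun s => Delta l f (z, s)) \o ZRV = fun w =>
      fitted_score X O D Y1 Y0 g (muhat f l z) (nuhat f l z) (fun a => pihat a f l z) w - sc w.
    by apply/funext => w; rewrite /Delta /= scE.
  have DE2 : (fun s => Delta l f (z, s) ^+ 2) \o ZRV = fun w =>
      (fitted_score X O D Y1 Y0 g (muhat f l z) (nuhat f l z) (fun a => pihat a f l z) w - sc w) ^+ 2.
    by apply/funext => w; rewrite /Delta /= scE.
  have mD2 : measurable_fun [set: obs] (fun s => Delta l f (z, s) ^+ 2).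
    exact: measurable_funX.
  split.
  - by apply: rint_distribution => //; rewrite DE2.
  - by rewrite Ex_distribution// DE2.
  - rewrite Ex_distribution// DE//; apply: (le_trans b1).
    by rewrite -/C /kappa mulrA [C * _]mulrC divfK ?gt_eqF.
- have sum0 := ereal_cvg0_sum (index_enum (bool * bool * bool)%type) PB.
  apply: ereal_cvg0 => // e e0.
  apply: filterS (ereal_cvg0_near sum0 e0) => n; apply: le_trans.
  rewrite -[leRHS]add0e -[X in (_ <= X + _)%E](measure0 P).
  apply: le_measure_sum => //.
  - apply: (measurable_fitted_set R mW mF (A := fun f => ~` (\bigcap_i ~` B i n f))) => f.
    apply: measurableC; apply: fin_bigcap_measurable => // i _; apply: measurableC; exact: mB.
  - by move=> i; apply: (measurable_fitted_set R mW mF) => f; exact: mB.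
  - move=> w /= nG; right; apply: contrapT => nB; apply: nG => i _ Bi.
    by apply: nB; exists i.
Qed.

Lemma cross_fitted_estimator_cvg : cvg_in_distribution P
  (fun n w => Num.sqrt n%:R * (tau_cens_eff muhat nuhat pihat g W F n w - tau))
  (normal_law 0 (fine V)).
Proof.
have [mF indepF _] := foldsF.
pose Y n w := \sum_(l < L) fold_remainder W F l (Delta l) n w.
have mR l n : measurable_fun [set: T] (fold_remainder W F l (Delta l) n).
  by apply: measurable_fold_remainder => // m f; exact: mDelta.
have mY n : measurable_fun [set: T] (Y n) by apply: measurable_sum => l; exact: mR.
have Y0' (eta : R) : 0 < eta -> P [set w | eta < `|Y n w|] @[n --> \oo] --> 0%E.
  (* [L] remainders of at most [h] add up to at most [eta]. *)
  move=> eta0; pose h := eta / L.+1%:R; have h0 : 0 < h by rewrite divr_gt0.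
  have sum0 := ereal_cvg0_sum (index_enum 'I_L) (fun l => fold_error_negligible l h0).
  apply: ereal_cvg0 => // e e0.
  apply: filterS (ereal_cvg0_near sum0 e0) => n; apply: le_trans.
  rewrite -[leRHS]add0e -[X in (_ <= X + _)%E](measure0 P).
  apply: le_measure_sum => //; [exact: measurable_abs_gt|by move=> l; exact: measurable_abs_gt|].
  move=> w /= etaY; right; apply: contrapT => nR.
  have : `|Y n w| <= eta; last by rewrite leNgt etaY.
  apply: (le_trans (ler_norm_sum _ _ _)).
  apply: (@le_trans _ _ (\sum_(l < L) h)).
    by apply: ler_sum => l _; rewrite leNgt; apply/negP => hl; apply: nR; exists l.
  rewrite sumr_const card_ord -[leLHS]mulr_natr /h -mulrA ler_piMr ?(ltW eta0)//.
  by rewrite mulrC ler_pdivrMr// mul1r ler_nat.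
have SE n : (fun w => Num.sqrt n%:R * (tau_cens_eff muhat nuhat pihat g W F n w - tau)) =
    fun w => \sum_(i < n) (Num.sqrt n%:R)^-1 * psi (W i w) + Y n w.
  by apply/funext => w; exact: scaled_error_decomposition.
split.
  move=> n; rewrite SE; apply: measurable_funD => //.
  by apply: measurable_sum => i; apply: measurable_funM => //; exact: measurableT_comp.
move=> x cx; under eq_cvg do rewrite SE.
have := @clt_cdf R _ _ Q _ T P psi W mW indepW lawWQ mpsi psi2 psi0 Y mY Y0' x.
by rewrite psiV; apply.
Qed.

End cross_fitting_asymptotics.

Theorem theorem4p7 (R : realType) (p : nat)
    (* population: covariates, observation and treatment indicators,
       potential outcomes *)
    (d0 : measure_display) (T0 : measurableType d0) (P0 : probability T0 R)
    (cX : set (p.-tuple R)) (X : {RV P0 >-> p.-tuple R})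
    (O D : {RV P0 >-> bool}) (Y1 Y0 : {RV P0 >-> R})
    (zeta0 zetaT muT0 nu0 : p.-tuple R -> R) (pi0 g0 : bool -> p.-tuple R -> R)
    (* sample, folds and cross-fitted nuisance estimators *)
    (d : measure_display) (T : measurableType d) (P : probability T R)
    (W : nat -> {RV P >-> (p.-tuple R * bool * R)%type})
    (L : nat) (F : forall n, T -> {ffun 'I_n -> 'I_L})
    (muhat nuhat : estimator R L (p.-tuple R * bool * R)%type (p.-tuple R))
    (pihat : bool -> estimator R L (p.-tuple R * bool * R)%type (p.-tuple R)) :
  let Ytl := Ytilde D Y1 Y0 in
  let Z := fun w => (X w, O w, Yobs O D Y1 Y0 w) in
  let tau0 := ate P0 Y1 Y0 in
  let V := Vcens P0 muT0 nu0 pi0 g0 Z tau0 in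
  (* censoring model *)
  measurable cX -> (forall w, cX (X w)) ->
  (forall w, O w -> D w) ->
  P0.-integrable [set: T0] (EFin \o Y1) ->
  P0.-integrable [set: T0] (EFin \o Y0) ->
  (* true nuisance functions *)
  has_density P0 X zeta0 ->
  has_density_given P0 X [set w | D w = true] zetaT ->
  (forall o, is_cond_probability P0 X [set: T0] [set w | O w = o] (pi0 o)) ->
  (forall a, is_cond_probability P0 X [set w | O w = false]
    [set w | D w = a] (g0 a)) ->
  is_cond_expectation P0 X [set: T0] Y1 muT0 ->
  is_cond_expectation P0 X [set w | O w = false] Ytl nu0 ->
  (V < +oo)%E ->
  (* i.i.d. copies of the observed vector *)
  mutually_independent P W ->
  (forall i B, measurable B -> P (W i @^-1` B) = P0 (Z @^-1` B)) ->
  (* unconfoundedness *)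
  cond_independent P0 X (fun w => (Y1 w, Y0 w)) (fun w => (O w, D w)) ->
  (* common support *)
  (exists2 c : R, 0 < c & forall x, cX x ->
    [/\ forall a, c < pi0 a x, forall a, c < g0 a x, c < zetaT x & c < zeta0 x]) ->
  (* cross-fitting *)
  (0 < L)%N ->
  random_folds P W F ->
  cross_fitted muhat -> cross_fitted nuhat -> (forall a, cross_fitted (pihat a)) ->
  (* overlap of the estimated propensity score, with probability tending to 1 *)
  (exists2 c : R, 0 < c & forall (l : 'I_L) (a : bool),
    P [set w | (0 < P0 [set v | (fitted (pihat a) W F l n w (X v) < c)%R])%E]
      @[n --> \oo] --> 0%E) ->
  (* convergence rates *)
  (forall l a, little_op P
    (fun n w => l2_dist X (pi0 a) (fitted (pihat a) W F l n w)) (fun=> 1)) ->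
  (forall l, little_op P
    (fun n w => l2_dist X muT0 (fitted muhat W F l n w)) (fun=> 1)) ->
  (forall l, little_op P
    (fun n w => l2_dist X nu0 (fitted nuhat W F l n w)) (fun=> 1)) ->
  (forall l a, little_op P
    (fun n w => (l2_dist X (pi0 a) (fitted (pihat a) W F l n w) *
                 l2_dist X muT0 (fitted muhat W F l n w))%E)
    (fun n => (Num.sqrt n%:R)^-1)) ->
  (forall l, little_op P
    (fun n w => (l2_dist X (pi0 false) (fitted (pihat false) W F l n w) *
                 l2_dist X nu0 (fitted nuhat W F l n w))%E)
    (fun n => (Num.sqrt n%:R)^-1)) ->
  cvg_in_distribution P
    (fun n w => Num.sqrt n%:R *
       (tau_cens_eff muhat nuhat pihat g0 W F n w - tau0))
    (normal_law 0 (fine V)).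
Proof.
move=> Ytl Z tau0 V _ cXX _ rY1 rY0 _ _ Hpi Hg Hmu Hnu Vfin indepW lawW UV [c c0 sup] _
  foldsF cf_mu cf_nu cf_pi overlap rate_pi rate_mu rate_nu rate_pi_mu rate_pi_nu.
have pic o w : c < pi0 o (X w) by case: (sup _ (cXX w)).
have gc a w : c < g0 a (X w) by case: (sup _ (cXX w)).
exact: (cross_fitted_estimator_cvg rY1 rY0 Hpi Hg Hmu Hnu UV c0 pic gc Vfin indepW lawW
  foldsF cf_mu cf_nu cf_pi overlap rate_pi rate_mu rate_nu rate_pi_mu rate_pi_nu).
Qed.
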